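(* Let $B\subset W$ be a good lattice and $A$ a self-dual lattice with $B\subset A\subset B^*$. The map $s_B:g\longmapsto(g,S^A_\psi(g))$ is a group homomorphism from $K_B$ into the metaplectic group $Mp(W)$ of $W$, i.e. into the subgroup $Mp(W)_\psi^A$ of $\widehat{Sp(W)}^A_\psi$.
   Context: $k$ is a non-archimedean local field of characteristic $0$ with ring of integers $\mathcal{O}$, uniformizer $\varpi$, residue field $\mathbb{F}_q$ of characteristic $p\neq2$; $\psi$ is a non-trivial unitary character of $(k,+)$ with conductor $\lambda_\psi$ (trivial on $\varpi^{\lambda_\psi}\mathcal{O}$, not on $\varpi^{\lambda_\psi-1}\mathcal{O}$); $\overline\psi$ is the character of $\mathbb{F}_q$ with $\overline\psi(x\bmod\varpi)=\psi(\varpi^{\lambda_\psi-1}x)$. $(W,\beta)$ is a symplectic $k$-space of dimension $2r>0$. A lattice is a compact open $\mathcal{O}$-submodule; $B^*=\{v\in W:\beta(v,b)\in\varpi^{\lambda_\psi}\mathcal{O}\ \forall b\in B\}$; $B$ is good if $\varpi B^*\subset B\subset B^*$, self-dual if $B=B^*$. $K_B$ is the stabilizer of $B$ in $Sp(W)$. $\mathrm{b}^*=B^*/B$ is an $\mathbb{F}_q$-space with symplectic form $\beta_{\mathrm{b}^*}(\bar v,\bar w)=\varpi^{1-\lambda_\psi}\beta(v,w)\bmod\varpi$, of dimension $2l$; $p_{Sp(\mathrm{b}^* )}:K_B\to Sp(\mathrm{b}^* )$ is the induced morphism. $\mathrm{x}=A/B$ is a Lagrangian of $\mathrm{b}^*$.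 Put $j(g)=l-\dim(\mathrm{x}\cap g\mathrm{x})$ for $g\in Sp(\mathrm b^* )$, $\omega(a)=q^{-1/2}\sum_{t\in\mathbb{F}_q}\overline\psi(\frac12at^2)$ for $a\in\mathbb F_q^\times$ (depends only on $a$ mod squares), and let $\theta:Sp(\mathrm{b}^* )\to\mathbb{F}_q^\times/(\mathbb{F}_q^\times)^2$ be the function with $\theta(p_1gp_2)=\theta(p_1)\theta(g)\theta(p_2)$ for $p_1,p_2$ in the stabilizer $P$ of $\mathrm{x}$, $\theta(p)=\det(p_{|\mathrm{x}})$ for $p\in P$, and $\theta(\tau_S)=1$ for $S\subset\{1,\dots,l\}$, where, for a symplectic basis $(\epsilon_i,\phi_i)$ of $\mathrm b^*$ with the $\epsilon_i$ spanning $\mathrm{x}$, $\tau_S \epsilon_i=\phi_i,\ \tau_S\phi_i=-\epsilon_i$ for $i\in S$ and $\tau_S$ fixes $\epsilon_i,\phi_i$ for $i\notin S$. Put $m(g)=\omega(\theta(g))^{-1}\omega(1)^{1-j(g)}$. $H(W)=W\times k$ with $(w,t)(w',t')=(w+w',t+t'+\frac12\beta(w,w'))$. $\mathcal{H}^A_\psi$ is the Hilbert space of functions $\varphi:W\to\mathbb{C}$ with $\varphi(a+w)=\psi(\frac12\beta(w,a))\varphi(w)$ ($a\in A$) and $\int_{W/A}|\varphi|^2<\infty$; $\rho_\psi^A(w,t)\varphi(w')=\psi(t+\frac12\beta(w',w))\varphi(w'+w)$ is the irreducible unitary representation of $H(W)$ with central character $\psi$. $\widehat{Sp(W)}_\psi^A$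 is the group of pairs $(g,U)\in Sp(W)\times U(\mathcal{H}^A_\psi)$ with $U\rho^A_\psi(w,t)U^{-1}=\rho^A_\psi(gw,t)$ for all $(w,t)$; $Mp(W)^A_\psi$ is its unique subgroup on which the projection to $Sp(W)$ is surjective with kernel of order $2$, and it is canonically identified with the metaplectic double cover $Mp(W)$ of $Sp(W)$. For $g\in Sp(W)$, $$M_A(g)\varphi(w)=[A:A\cap gA]^{-1}\sum_{a\in A/(A\cap gA)}\psi(\tfrac12\beta(a,w))\varphi(g^{-1}(a+w)),$$ and for $g\in K_B$, $S^A_\psi(g)=m(p_{Sp(\mathrm{b}^* )}(g))\,q^{\frac12j(p_{Sp(\mathrm{b}^* )}(g))}M_A(g)$. *)

(* Defs.v *)
From HB Require Import structures.
From mathcomp Require Import all_boot all_order all_algebra all_fingroup.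
From mathcomp Require Import finmap.
From mathcomp Require Import all_classical all_reals all_analysis.
From mathcomp Require Import complex.
From mathcomp Require Import ring lra.

Set Implicit Arguments.
Unset Strict Implicit.
Unset Printing Implicit Defensive.

Import Order.TTheory GRing.Theory Num.Theory.
Local Open Scope classical_set_scope.
Local Open Scope ring_scope.

(** The value of [v] at [0] is irrelevant. *)
Definition val_ring (k : fieldType) (v : k -> int) : set k :=
  [set x | x = 0 \/ 0 <= v x].

Definition val_ideal (k : fieldType) (v : k -> int) (pi : k) (n : int) : set k :=
  [set pi ^ n * y | y in val_ring v].

(** Non-archimedean local fields of characteristic 0, as complete discretely
    valued fields with finite residue field.  The residue field is presented
    as a finite field [F] with a surjective ring morphism from the valuation
    ring onto [F] whose kernel is the maximal ideal; [lf_res] is only meaningful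
    on the valuation ring. *)
Record local_field (k : fieldType) (F : finFieldType) := LocalField {
  lf_val : k -> int;
  lf_valM : forall x y, x != 0 -> y != 0 ->
    lf_val (x * y) = lf_val x + lf_val y;
  lf_valD : forall x y, x != 0 -> y != 0 -> x + y != 0 ->
    Num.min (lf_val x) (lf_val y) <= lf_val (x + y);
  lf_unif : k;
  lf_unif_neq0 : lf_unif != 0;
  lf_val_unif : lf_val lf_unif = 1;
  lf_char0 : [pchar k] =i pred0;
  lf_complete : forall u : nat -> k,
    (forall n : int, exists N : nat, forall i j : nat, (N <= i)%N -> (N <= j)%N ->
       val_ideal lf_val lf_unif n (u i - u j)) ->
    exists a : k, forall n : int, exists N : nat, forall i : nat, (N <= i)%N ->
       val_ideal lf_val lf_unif n (u i - a);
  lf_res : k -> F;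
  lf_res1 : lf_res 1 = 1;
  lf_resD : forall x y, val_ring lf_val x -> val_ring lf_val y ->
    lf_res (x + y) = lf_res x + lf_res y;
  lf_resM : forall x y, val_ring lf_val x -> val_ring lf_val y ->
    lf_res (x * y) = lf_res x * lf_res y;
  lf_res_surj : forall a : F, exists2 x, val_ring lf_val x & lf_res x = a;
  lf_res_ker : forall x, val_ring lf_val x ->
    (lf_res x = 0 <-> val_ideal lf_val lf_unif 1 x) }.

Section LocalFieldDefs.
Context (k : fieldType) (F : finFieldType) (K : local_field k F).

Definition ringO : set k := val_ring (lf_val K).
Definition idealO (n : int) : set k := val_ideal (lf_val K) (lf_unif K) n.
Definition lift_res (a : F) : k := xget 0 [set x | ringO x /\ lf_res K x = a].

Lemma idealO_le (m n : int) : m <= n -> idealO n `<=` idealO m.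
Proof.
have u0 := lf_unif_neq0 K.
have vX (j : nat) : lf_val K (lf_unif K ^+ j) = j%:Z.
  elim: j => [|j IH].
    have := @lf_valM _ _ K 1 1 (oner_neq0 _) (oner_neq0 _).
    by rewrite mulr1 expr0; lra.
  by rewrite exprS lf_valM ?expf_neq0 // IH lf_val_unif intS.
move=> mn x [y Oy <-]; exists (lf_unif K ^ (n - m) * y); last first.
  by rewrite mulrA -expfzDr // addrC subrK.
have [->|y0] := eqVneq y 0; first by left; rewrite mulr0.
case: Oy => [/eqP|Oy]; first by rewrite (negPf y0).
have -> : n - m = `|n - m|%N by rewrite gez0_abs // subr_ge0.
by right; rewrite -exprnP lf_valM ?expf_neq0 // vX addr_ge0.
Qed.

End LocalFieldDefs.

(** The topology of a finite-dimensional [k]-space: the product topology in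
    coordinates. *)
Definition kadic (k : fieldType) (F : finFieldType) (K : local_field k F)
  (W : vectType k) : Type := W.

Section KadicTopology.
Context (k : fieldType) (F : finFieldType) (K : local_field k F).
Context (W : vectType k).

HB.instance Definition _ := Choice.copy (kadic K W) W.

Definition kadic_ball (x : W) (n : int) : set W :=
  [set y | forall i, idealO K n (coord (vbasis {:W}) i (y - x))].

Definition kadic_open (U : set (kadic K W)) : Prop :=
  forall x, U x -> exists n, kadic_ball x n `<=` U.

Let kadic_openT : kadic_open setT. Proof. by move=> x _; exists 0. Qed.

Let kadic_openI (U V : set (kadic K W)) :
  kadic_open U -> kadic_open V -> kadic_open (U `&` V).
Proof.
move=> oU oV x [/oU[m mU] /oV[n nV]]; exists (Num.max m n) => y xy; split.
  by apply: mU => i; apply: idealO_le (xy i); rewrite le_max lexx.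
by apply: nV => i; apply: idealO_le (xy i); rewrite le_max lexx orbT.
Qed.

Let kadic_openU (I : Type) (f : I -> set (kadic K W)) :
  (forall i, kadic_open (f i)) -> kadic_open (\bigcup_i f i).
Proof.
move=> of_ x [i _ /of_[n nf]]; exists n => y /nf fy.
by exists i.
Qed.

HB.instance Definition _ := @isOpenTopological.Build (kadic K W)
  kadic_open kadic_openT kadic_openI kadic_openU.

End KadicTopology.

(** A non-trivial unitary character of [(k, +)]; continuity is triviality on
    the open subgroup [ach_cond_triv]. *)
Record add_char (R : realType) (k : fieldType) (F : finFieldType)
    (K : local_field k F) := AddChar {
  ach_fun :> k -> R[i];
  ach_D : forall x y, ach_fun (x + y) = ach_fun x * ach_fun y;
  ach_norm : forall x, `|ach_fun x| = 1;
  ach_cond : int;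
  ach_cond_triv : forall x, idealO K ach_cond x -> ach_fun x = 1;
  ach_cond_ntriv : exists2 x, idealO K (ach_cond - 1) x & ach_fun x <> 1 }.

Record symp_form (k : fieldType) (W : vectType k) := SympForm {
  sf_fun :> W -> W -> k;
  sf_linl : forall w, scalar (sf_fun ^~ w);
  sf_linr : forall w, scalar (sf_fun w);
  sf_alt : forall w, sf_fun w w = 0;
  sf_nondeg : forall v, (forall w, sf_fun v w = 0) -> v = 0 }.

(** The isometries of [form]; for a non-degenerate [form] on a
    finite-dimensional space they are invertible. *)
Definition Sp (k : fieldType) (V : vectType k) (form : V -> V -> k) : set 'End(V) :=
  [set g | forall v w, form (g v) (g w) = form v w].

Record lattice (k : fieldType) (F : finFieldType) (K : local_field k F)
    (W : vectType k) := Lattice {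
  lat_set :> set W;
  lat_0 : lat_set 0;
  lat_D : forall x y, lat_set x -> lat_set y -> lat_set (x + y);
  lat_Z : forall a x, ringO K a -> lat_set x -> lat_set (a *: x);
  lat_open : open (lat_set : set (kadic K W));
  lat_compact : compact (lat_set : set (kadic K W)) }.

(** Cosets of [M] meeting [L], as sets: the quotient [L / M] when [M] is a
    subgroup of [L]. *)
Definition quot (W : zmodType) (L M : set W) : set (set W) :=
  [set [set a + x | x in M] | a in L].

Definition crepr (W : zmodType) (c : set W) : W := xget 0 c.

Section SymplecticLattices.
Context (R : realType) (k : fieldType) (F : finFieldType) (K : local_field k F).
Context (psi : add_char R K) (W : vectType k) (beta : symp_form W).

Definition dual_lat (B : set W) : set W :=
  [set v | forall b, B b -> idealO K (ach_cond psi) (beta v b)].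

Definition good_lattice (B : lattice K W) : Prop :=
  [set lf_unif K *: v | v in dual_lat B] `<=` B /\ B `<=` dual_lat B.

Definition self_dual (B : lattice K W) : Prop := B = dual_lat B :> set W.

Definition KB (B : lattice K W) : set 'End(W) :=
  [set g | Sp beta g /\ [set g x | x in B] = B].

End SymplecticLattices.

Definition sqmod (R : realType) (z : R[i]) : R :=
  complex.Re z ^+ 2 + complex.Im z ^+ 2.

Section SqMod.
Context (R : realType).

Lemma sqmod_ge0 (z : R[i]) : 0 <= sqmod z.
Proof. by rewrite addr_ge0 // sqr_ge0. Qed.

Lemma sqmodM (x y : R[i]) : sqmod (x * y) = sqmod x * sqmod y.
Proof. by case: x => a b; case: y => c d; rewrite /sqmod /=; ring. Qed.

Lemma sqmod_norm1 (z : R[i]) : `|z| = 1 -> sqmod z = 1.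
Proof.
rewrite normc_def => /(congr1 (@complex.Re R)) /= s1.
by rewrite -[LHS]sqr_sqrtr ?sqmod_ge0 // s1 expr1n.
Qed.

Lemma sqmodD (x y : R[i]) : sqmod (x + y) <= 2 * sqmod x + 2 * sqmod y.
Proof.
case: x => a b; case: y => c d; rewrite /sqmod /= -subr_ge0.
have -> : 2 * (a ^+ 2 + b ^+ 2) + 2 * (c ^+ 2 + d ^+ 2)
  - ((a + c) ^+ 2 + (b + d) ^+ 2) = (a - c) ^+ 2 + (b - d) ^+ 2 by ring.
by rewrite addr_ge0 // sqr_ge0.
Qed.

End SqMod.

Section LatticeModel.
Context (R : realType) (k : fieldType) (F : finFieldType) (K : local_field k F).
Context (psi : add_char R K) (W : vectType k) (beta : symp_form W).
Context (A : lattice K W).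

(** The integral over the discrete space [W / A] of the [A]-invariant function
    [|f|^2], for the counting measure. *)
Definition normsq (f : W -> R[i]) : \bar R :=
  (\esum_(c in quot setT A) (sqmod (f (crepr c)))%:E)%E.

Definition inH : set (W -> R[i]) :=
  [set f | (forall a w, lat_set A a -> f (a + w) = psi (2^-1 * beta w a) * f w)
           /\ (normsq f < +oo)%E].

Definition Hpred : {pred W -> R[i]} := mem inH.

Lemma Hpred_submod : submod_closed Hpred.
Proof.
split=> [|c f g].
  rewrite inE; split=> [a w _|]; first by rewrite mulr0.
  by rewrite /normsq esum1 ?ltry // => x _; rewrite /sqmod /= expr0n addr0.
rewrite !inE => -[ef nf] [eg ng]; split=> [a w Aa|].
  have -> u : (c *: f + g) u = c * f u + g u by [].
  by rewrite ef // eg // mulrDr mulrCA.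
pose r : R := 2 * sqmod c.
have r0 : 0 <= r by rewrite mulr_ge0 ?sqmod_ge0.
have bound h s : 0 <= s -> (normsq h < +oo)%E ->
    (\esum_(x in quot setT A) (s * sqmod (h (crepr x)))%:E < +oo)%E.
  move=> s0 nh; apply: (@le_lt_trans _ _ (s%:E * normsq h)%E); last first.
    by rewrite lte_mul_pinfty // ?lee_fin.
  apply: ub_ereal_sup => _ [X [Xfin XS] <-].
  have -> : (\sum_(x \in X) (s * sqmod (h (crepr x)))%:E =
             s%:E * \sum_(x \in X) (sqmod (h (crepr x)))%:E)%E.
    rewrite !fsbig_finite //= ge0_sume_distrr //.
    by move=> i _; rewrite lee_fin sqmod_ge0.
  by rewrite lee_wpmul2l ?lee_fin //; apply: ereal_sup_ubound; exists X.
have := lte_add_pinfty (bound f r r0 nf) (bound g 2 (ler0n _ _) ng).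
rewrite -esumD; last 2 first.
- by move=> x _; rewrite lee_fin mulr_ge0 ?sqmod_ge0.
- by move=> x _; rewrite lee_fin mulr_ge0 ?sqmod_ge0.
apply: le_lt_trans; apply: le_esum => x _.
rewrite -EFinD lee_fin.
have -> : (c *: f + g) (crepr x) = c * f (crepr x) + g (crepr x) by [].
by apply: le_trans (sqmodD _ _) _; rewrite sqmodM /r mulrA.
Qed.

Record Hilb := MkHilb { Hval :> W -> R[i]; HvalP : Hval \in Hpred }.

HB.instance Definition _ := [isSub for Hval].
HB.instance Definition _ := [Choice of Hilb by <:].
HB.instance Definition _ := GRing.isSubmodClosed.Build _ _ Hpred Hpred_submod.
HB.instance Definition _ := [SubChoice_isSubLmodule of Hilb by <:].

(** The Heisenberg representation; [rho w t] is the operator attached to the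
    element [(w, t)] of the Heisenberg group [W x k]. *)
Definition rho_fun (w : W) (t : k) (f : W -> R[i]) : W -> R[i] :=
  fun w' => psi (t + 2^-1 * beta w' w) * f (w' + w).

Lemma rho_subproof (w : W) (t : k) (f : Hilb) : rho_fun w t f \in Hpred.
Proof.
case: f => f /=; rewrite !inE => -[ef nf].
have bDl u v x : beta (u + v) x = beta u x + beta v x.
  by have := sf_linl beta x 1 u v; rewrite scale1r mul1r.
have bDr x u v : beta x (u + v) = beta x u + beta x v.
  by have := sf_linr beta x 1 u v; rewrite scale1r mul1r.
have bN u v : beta v u = - beta u v.
  have := sf_alt beta (u + v); rewrite bDl !bDr !sf_alt add0r addr0.
  by move/eqP; rewrite addr_eq0 => /eqP ->; rewrite opprK.
split=> [a u Aa|].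
  rewrite /rho_fun -addrA (ef a) // !mulrA -!ach_D; congr (psi _ * _).
  by rewrite !bDl (bN a w); ring.
have fA c v : quot setT A c -> c v -> sqmod (f v) = sqmod (f (crepr c)).
  move=> [u _ <-{c}] cv.
  have sq y : [set u + x | x in A] y -> sqmod (f y) = sqmod (f u).
    move=> [a Aa <-]; rewrite addrC ef // sqmodM sqmod_norm1 ?mul1r //.
    exact: ach_norm.
  rewrite (sq v cv) sq // /crepr.
  by case: xgetP => [y -> //|/(_ v)].
pose e (x : W) (c : set W) : set W := [set y + x | y in c].
have eK x y c : x + y = 0 -> e x (e y c) = c.
  move=> xy; apply/seteqP; split=> [_ [_ [z cz <-] <-]|z cz].
    by rewrite -addrA [y + x]addrC xy addr0.
  by exists (z + y); [exists z|rewrite -addrA [y + x]addrC xy addr0].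
have eq x c : quot setT A c -> quot setT A (e x c).
  move=> [u _ <-]; exists (u + x) => //; apply/seteqP; split=> [_ [a Aa <-]|].
    by exists (u + a); [exists a|rewrite addrAC].
  by move=> _ [_ [a Aa <-] <-]; exists a => //; rewrite addrAC.
apply: le_lt_trans nf.
rewrite [leRHS](@reindex_esum _ _ _ (quot setT A) (quot setT A) (e w)); last first.
  split.
  + by move=> c; exact: eq.
  + by move=> c d _ _ /(congr1 (e (- w))); rewrite !eK ?addNr.
  + by move=> c qc; exists (e (- w) c); [exact: eq|rewrite eK ?subrr].
apply: le_esum => c qc; rewrite lee_fin /rho_fun sqmodM sqmod_norm1 ?mul1r.
  rewrite -(fA (e w c) (crepr c + w)) //; first exact: eq.
  exists (crepr c) => //; rewrite /crepr; case: xgetP => [y -> //|].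
  by case: qc => u _ <- /(_ (u + 0)) []; exists 0 => //; exact: lat_0.
exact: ach_norm.
Qed.

Definition rho (w : W) (t : k) (f : Hilb) : Hilb := MkHilb (rho_subproof w t f).

Definition unitary_op (U : Hilb -> Hilb) : Prop :=
  [/\ linear U, (forall f, exists f', U f' = f)
    & forall f, normsq (U f) = normsq f].

Definition pair_type : Type := ('End(W) * (Hilb -> Hilb))%type.
Definition pair_one : pair_type := (\1%VF, id).
Definition pair_mul (x y : pair_type) : pair_type := ((x.1 \o y.1)%VF, x.2 \o y.2).

Definition Sp_hat : set pair_type :=
  [set x | [/\ Sp beta x.1, unitary_op x.2
             & forall w t f, x.2 (rho w t f) = rho (x.1 w) t (x.2 f)]].

Definition is_subgroup (G : set pair_type) : Prop :=
  [/\ G `<=` Sp_hat, G pair_one, (forall x y, G x -> G y -> G (pair_mul x y))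
    & forall x, G x ->
        exists y, [/\ G y, pair_mul x y = pair_one & pair_mul y x = pair_one]].

Definition is_metaplectic (G : set pair_type) : Prop :=
  [/\ is_subgroup G, (forall g, Sp beta g -> exists U, G (g, U))
    & ([set x | G x /\ x.1 = \1%VF] #= `I_2)%card].

(** [(g^-1)%VF] is the inverse of [g] for invertible [g]. *)
Definition M_op (g : 'End(W)) (f : W -> R[i]) : W -> R[i] :=
  let Q := quot A (A `&` [set g x | x in A]) in
  fun w => (#|` fset_set Q |%:R)^-1 *
    \sum_(c \in Q) psi (2^-1 * beta (crepr c) w) * f ((g^-1)%VF (crepr c + w)).

End LatticeModel.

(** A presentation of the [F]-space [L / B], for [O]-modules [B] contained
    in [L] and such that [L / B] is killed by the uniformizer; [qs_pr] is only
    meaningful on [L]. *)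
Record quot_space (k : fieldType) (F : finFieldType) (K : local_field k F)
    (W : vectType k) (L B : set W) (b : vectType F) := QuotSpace {
  qs_pr :> W -> b;
  qs_D : forall v w, L v -> L w -> qs_pr (v + w) = qs_pr v + qs_pr w;
  qs_Z : forall a v, ringO K a -> L v -> qs_pr (a *: v) = lf_res K a *: qs_pr v;
  qs_surj : forall x, exists2 v, L v & qs_pr v = x;
  qs_ker : forall v, L v -> (qs_pr v = 0 <-> B v) }.

(** The determinant of the restriction of [g] to a [g]-stable subspace [U]. *)
Definition det_on (F : fieldType) (V : vectType F) (U : {vspace V}) (g : 'End(V)) : F :=
  \det (\matrix_(i < \dim U, j < \dim U) coord (vbasis U) j (g (vbasis U)`_i)).

Definition unit_squares (F : finFieldType) : {set {unit F}} :=
  [set (x ^+ 2)%g | x in ([set: {unit F}])%SET]%SET.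

(** [F^* / (F^* )^2]; the squares already form a subgroup, [<<_>>] only makes
    this visible to the quotient construction. *)
Notation sq_class F := (coset_of <<unit_squares F>>%g).

(** Only meaningful for [a != 0]. *)
Definition to_sq_class (F : finFieldType) (a : F) : sq_class F :=
  coset <<unit_squares F>>%g (insubd (1%g : {unit F}) a).

Section Splitting.
Context (R : realType) (k : fieldType) (F : finFieldType) (K : local_field k F).
Context (psi : add_char R K) (W : vectType k) (beta : symp_form W).
Context (A B : lattice K W).
Context (b : vectType F) (pr : quot_space K (dual_lat psi beta B) B b).

Definition psibar (a : F) : R[i] :=
  psi (lf_unif K ^ (ach_cond psi - 1) * lift_res K a).

Definition lift_b (x : b) : W := xget 0 [set v | dual_lat psi beta B v /\ pr v = x].

Definition beta_b (x y : b) : F :=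
  lf_res K (lf_unif K ^ (1 - ach_cond psi) * beta (lift_b x) (lift_b y)).

Definition p_Sp (g : 'End(W)) : 'End(b) :=
  xget (0 : 'End(b)) [set h : 'End(b) | forall v, dual_lat psi beta B v -> h (pr v) = pr (g v)].

Definition x_space : {vspace b} :=
  xget 0%VS [set U : {vspace b} | [set` U] = [set pr a | a in A]].

Definition P_stab : set 'End(b) :=
  [set g | Sp beta_b g /\ (g @: x_space)%VS = x_space].

(** The normalisation [beta_b (eps i) (phi j) = (i == j)] (and not its opposite)
    is the one for which [S_op] is multiplicative when [q = 3 mod 4]. *)
Definition is_symp_basis (l : nat) (eps phi : 'I_l -> b) : Prop :=
  [/\ basis_of {:b} (codom eps ++ codom phi), <<codom eps>>%VS = x_space,
      (forall i j, beta_b (eps i) (eps j) = 0),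
      (forall i j, beta_b (phi i) (phi j) = 0)
    & (forall i j, beta_b (eps i) (phi j) = (i == j)%:R)].

Definition is_tau (l : nat) (eps phi : 'I_l -> b) (S : {set 'I_l}) (t : 'End(b)) : Prop :=
  forall i, t (eps i) = (if i \in S then phi i else eps i) /\
            t (phi i) = (if i \in S then - eps i else phi i).

Definition is_theta (l : nat) (eps phi : 'I_l -> b) (theta : 'End(b) -> sq_class F) : Prop :=
  [/\ (forall p1 g p2, P_stab p1 -> Sp beta_b g -> P_stab p2 ->
         theta (p1 \o g \o p2)%VF = (theta p1 * theta g * theta p2)%g),
      (forall p, P_stab p -> theta p = to_sq_class (det_on x_space p))
    & (forall S t, is_tau eps phi S t -> theta t = 1%g)].

Definition omega (a : F) : R[i] :=
  ((Num.sqrt (#|F|%:R : R))^-1)%:C%C * \sum_(t : F) psibar (2^-1 * a * t ^+ 2).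

Definition omega_class (c : sq_class F) : R[i] := omega (FinRing.uval (repr c)).

Context (l : nat) (theta : 'End(b) -> sq_class F).

Definition j_fun (g : 'End(b)) : nat := (l - \dim (x_space :&: g @: x_space))%N.

Definition m_fun (g : 'End(b)) : R[i] :=
  (omega_class (theta g))^-1 * omega 1 ^ (1 - (j_fun g)%:Z).

Definition S_op (g : 'End(W)) (f : W -> R[i]) : W -> R[i] :=
  fun w => m_fun (p_Sp g) * ((Num.sqrt (#|F|%:R : R)) ^+ j_fun (p_Sp g))%:C%C
           * M_op psi beta A g f w.

(** [S_op g] as an operator on the Hilbert space.  The junk value (the identity
    on those [f] with [S_op g f] outside the space) is excluded separately by
    the requirement that [S_op g] preserve [inH]. *)
Definition s_B (g : 'End(W)) : pair_type psi beta A :=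
  (g, fun f : Hilb psi beta A => insubd f (S_op g f)).

End Splitting.

(* Main.v *)
Require Import Defs.
From HB Require Import structures.
From mathcomp Require Import all_boot all_order all_algebra all_fingroup.
From mathcomp Require Import finmap.
From mathcomp Require Import all_classical all_reals all_analysis.
From mathcomp Require Import complex ring lra zify.
From mathcomp Require pgroup abelian finfield.
Import Order.TTheory GRing.Theory Num.Theory.
Set Implicit Arguments.
Unset Strict Implicit.
Unset Printing Implicit Defensive.
Local Open Scope classical_set_scope.
Local Open Scope ring_scope.

(** Any unitary [U] intertwining the Heisenberg action over [g] is a multiple of
    [M_op g]: the functional [f |-> (U f) 0] is invariant under [g^-1 A], hence
    proportional to the sum over [A / (A :&: g A)].  So [M_op] preserves the
    Hilbert space, the kernel of [Mp -> Sp] is [{1, -1}], and scalars are found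
    by evaluating the indicator function [phiA] of [A] at [0].

    For [g] in the stabilizer of [A], [M_op g f = f \o g^-1], and this
    operator lies in [Mp]: the stabilizer is generated by transvections, and each
    of them is a commutator of a transvection with the dilation of a hyperbolic
    pair by the uniformizer; conjugation by the dilation introduces no scalar
    because both operators fix [phiA].

    In general the image of [g] in [Sp(b)] is [p1 * tau_S * p2] (Bruhat).
    [S_op] is multiplicative under multiplication by the parabolic on either side,
    and a Gauss sum gives [S(w) = S(n) S(w) S(n') S(w)^-1 S(n)] for the
    elements [w] of the [SL_2]'s, with [n], [n'] unipotent in the parabolic.  Hence
    [S_op g] is in [Mp] for every [g], so that [S(g) S(h) = S(g h)] up to sign.
    The sign is removed by a determinant: on the [B]-invariant vectors, a space
    of odd dimension [q ^ l], the determinant of [S(g)] raised to the power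
    [p = char F] is [1], by the same decomposition. *)

(** * Symplectic forms, transvections and dilations *)

(** [Mp] is known only through its defining properties, so no lift can be computed inside it:
    membership of an explicit operator has to come from expressions in which every unknown scalar
    meets its inverse. Commutators do this over the stabilizer of [A]. For a long element [w], the
    right side of [S(w) = S(n) S(w) S(n') S(w)^-1 S(n)] does not change when [S(w)] is replaced by a
    multiple, so it can be formed with a lift taken from [Mp]. Checking [S(g) S(h) = S(g h)]
    directly for general pairs would lead to Weil indices of triples of Lagrangians. Only three
    kinds of products are computed: those with a parabolic factor, those of long elements for
    distinct hyperbolic pairs, and one rank-one relation. Perfectness of the symplectic group cannot
    be used to make the determinant 1, since SL_2 over the field with 3 elements is not perfect.
    Unipotents of the parabolic generators have order dividing [p] in [Sp(b)], which is the origin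
    of the exponent; as [p] and [q ^ l] are both odd, the [p]-th power still detects a sign. *)

Section SympForm.
Context (k : fieldType) (V : vectType k) (beta : symp_form V).
Implicit Types (u v w : V) (a c : k) (g h : 'End(V)).

Lemma sfDl u v w : beta (u + v) w = beta u w + beta v w.
Proof. by have := sf_linl beta w 1 u v; rewrite scale1r mul1r. Qed.

Lemma sfDr u v w : beta w (u + v) = beta w u + beta w v.
Proof. by have := sf_linr beta w 1 u v; rewrite scale1r mul1r. Qed.

Lemma sf0l w : beta 0 w = 0.
Proof. by apply: (addrI (beta 0 w)); rewrite -sfDl !addr0. Qed.

Lemma sf0r w : beta w 0 = 0.
Proof. by apply: (addrI (beta w 0)); rewrite -sfDr !addr0. Qed.

Lemma sfZl a u w : beta (a *: u) w = a * beta u w.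
Proof. by have := sf_linl beta w a u 0; rewrite !addr0 sf0l addr0. Qed.

Lemma sfZr a u w : beta w (a *: u) = a * beta w u.
Proof. by have := sf_linr beta w a u 0; rewrite !addr0 sf0r addr0. Qed.

Lemma sfNl u w : beta (- u) w = - beta u w.
Proof. by rewrite -scaleN1r sfZl mulN1r. Qed.

Lemma sfNr u w : beta w (- u) = - beta w u.
Proof. by rewrite -scaleN1r sfZr mulN1r. Qed.

Definition sfE := (sfDl, sfDr, sfZl, sfZr, sfNl, sfNr, sf0l, sf0r).

Lemma sfC u v : beta u v = - beta v u.
Proof.
have := sf_alt beta (u + v); rewrite !sfE !sf_alt add0r addr0.
by move/eqP; rewrite addr_eq0 => /eqP.
Qed.

Lemma sf_suml (I : Type) (r : seq I) (P : pred I) (F : I -> V) w :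
  beta (\sum_(i <- r | P i) F i) w = \sum_(i <- r | P i) beta (F i) w.
Proof. by apply: (big_morph (beta ^~ w)) => [x y|]; rewrite ?sfE. Qed.

Lemma sf_sumr (I : Type) (r : seq I) (P : pred I) (F : I -> V) w :
  beta w (\sum_(i <- r | P i) F i) = \sum_(i <- r | P i) beta w (F i).
Proof. by apply: (big_morph (beta w)) => [x y|]; rewrite ?sfE. Qed.

Lemma Sp_lker0 g : Sp beta g -> lker g == 0%VS.
Proof.
move=> Sg; apply/lker0P => u v guv; apply/eqP; rewrite -subr_eq0; apply/eqP.
apply: (@sf_nondeg _ _ beta) => w; rewrite -Sg linearB /= guv subrr sf0l //.
Qed.

Lemma SpK g : Sp beta g -> cancel g (g^-1)%VF.
Proof. by move/Sp_lker0/lker0_lfunK. Qed.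

Lemma SpVK g : Sp beta g -> cancel (g^-1)%VF g.
Proof. by move/Sp_lker0/lker0_lfunVK. Qed.

Lemma Sp1 : Sp beta \1%VF.
Proof. by move=> u v; rewrite !id_lfunE. Qed.

Lemma SpM g h : Sp beta g -> Sp beta h -> Sp beta (g \o h)%VF.
Proof. by move=> Sg Sh u v; rewrite !comp_lfunE Sg Sh. Qed.

Lemma SpV g : Sp beta g -> Sp beta (g^-1)%VF.
Proof. by move=> Sg u v; rewrite -Sg !SpVK. Qed.

Lemma Sp_compV g : Sp beta g -> (g \o g^-1)%VF = \1%VF.
Proof. by move=> Sg; apply/lfunP => v; rewrite comp_lfunE id_lfunE SpVK. Qed.

Lemma Sp_Vcomp g : Sp beta g -> (g^-1 \o g)%VF = \1%VF.
Proof. by move=> Sg; apply/lfunP => v; rewrite comp_lfunE id_lfunE SpK. Qed.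

Lemma Sp_invM g h : Sp beta g -> Sp beta h ->
  ((g \o h)^-1 = h^-1 \o g^-1)%VF.
Proof.
move=> Sg Sh; apply/lfunP => v; rewrite comp_lfunE.
have Sgh := SpM Sg Sh.
apply: (can_inj (SpK Sgh)); rewrite (SpVK Sgh) comp_lfunE /=.
by rewrite (SpVK Sh) (SpVK Sg).
Qed.

Definition tv_fun v a w := w + (a * beta w v) *: v.

Lemma tv_fun_linear v a : linear (tv_fun v a).
Proof.
move=> c x y; rewrite /tv_fun !sfE scalerDr addrACA scalerA mulrDr scalerDl.
by rewrite mulrCA.
Qed.

HB.instance Definition _ v a :=
  GRing.isLinear.Build k V V *:%R (tv_fun v a) (@tv_fun_linear v a).

Definition tv v a : 'End(V) := linfun (tv_fun v a).

Lemma tvE v a w : tv v a w = w + (a * beta w v) *: v.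
Proof. by rewrite lfunE. Qed.

Lemma Sp_tv v a : Sp beta (tv v a).
Proof.
move=> x y; rewrite !tvE !sfE !sf_alt (sfC v y); ring.
Qed.

Lemma tvD v a c : (tv v a \o tv v c)%VF = tv v (a + c).
Proof.
apply/lfunP => w; rewrite comp_lfunE !tvE !sfE sf_alt mulr0 addr0.
by rewrite -addrA -scalerDl mulrDl addrC [in RHS]addrC (addrC (c * _)).
Qed.

Lemma tv0 v : tv v 0 = \1%VF.
Proof. by apply/lfunP => w; rewrite tvE id_lfunE mul0r scale0r addr0. Qed.

Lemma tvV v a : ((tv v a)^-1 = tv v (- a))%VF.
Proof.
have S := Sp_tv v a.
apply/lfunP => w; apply: (can_inj (SpK S)); rewrite (SpVK S).
by rewrite -comp_lfunE tvD subrr tv0 id_lfunE.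
Qed.

Lemma Sp_conj_tv g v a : Sp beta g ->
  (g \o tv v a \o g^-1)%VF = tv (g v) a.
Proof.
move=> Sg; apply/lfunP => w; rewrite !comp_lfunE !tvE linearD linearZ /=.
by rewrite SpVK // -(SpVK Sg w) Sg SpK.
Qed.

(* [v, z] a hyperbolic pair: [dil v z c] maps [v] to [c v] and [z] to [c^-1 z]. *)
Definition dil_fun v z c w :=
  w + ((c - 1) * (beta w z / beta v z)) *: v
    + ((c^-1 - 1) * (beta v w / beta v z)) *: z.

Lemma dil_fun_linear v z c : linear (dil_fun v z c).
Proof.
have E d s A B N u : (s * ((d * A + B) / N)) *: u =
    d *: ((s * (A / N)) *: u) + (s * (B / N)) *: u.
  by rewrite scalerA -scalerDl; congr (_ *: _); ring.
move=> d x y; rewrite /dil_fun !sfE !E !scalerDr.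
by rewrite [RHS]addrACA; congr (_ + _); rewrite [RHS]addrACA.
Qed.

HB.instance Definition _ v z c :=
  GRing.isLinear.Build k V V *:%R (dil_fun v z c) (@dil_fun_linear v z c).

Definition dil v z c : 'End(V) := linfun (dil_fun v z c).

Lemma dilE v z c w : dil v z c w = w + ((c - 1) * (beta w z / beta v z)) *: v
    + ((c^-1 - 1) * (beta v w / beta v z)) *: z.
Proof. by rewrite lfunE. Qed.

Lemma Sp_dil v z c : c != 0 -> beta v z != 0 -> Sp beta (dil v z c).
Proof.
move=> c0 vz0 x y; rewrite !dilE !sfE !sf_alt (sfC z v) (sfC x v) (sfC z y).
have n1 : (beta v z)^-1 * beta v z - 1 = 0 by rewrite mulVf // subrr.
(* With [s = c - 1] and [t = c^-1 - 1] this is [(1 + s) (1 + t) = 1] expanded. *)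
have c1 : (c - 1) + (c^-1 - 1) + (c - 1) * (c^-1 - 1) = 0.
  by move: (mulfV c0) => cc; rewrite mulrBl mul1r mulrBr mulr1 cc; ring.
move: n1 c1; move: (_^-1) (_^-1 - 1) (c - 1) => n t s.
move: (beta v z) (beta x z) (beta v x) (beta y z) (beta v y) (beta x y).
move=> N a e a' e' xy n1 c1; apply/eqP; rewrite -subr_eq0; apply/eqP.
transitivity (n * (a * e' - e * a') * (s + t + s * t)
  + s * t * n * (a * e' - e * a') * (n * N - 1)); first by ring.
by rewrite n1 c1 !mulr0 addr0.
Qed.

Lemma dil_fix v z c : beta v z != 0 -> dil v z c v = c *: v.
Proof.
move=> vz0; rewrite dilE sf_alt mul0r mulr0 scale0r addr0 divff // mulr1.
by rewrite scalerBl scale1r addrC subrK.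
Qed.

Lemma dilK v z c w : c != 0 -> beta v z != 0 -> dil v z c (dil v z c^-1 w) = w.
Proof.
move=> c0 vz; set y := dil v z c^-1 w.
have yE : y = w + ((c^-1 - 1) * (beta w z / beta v z)) *: v
    + ((c - 1) * (beta v w / beta v z)) *: z by rewrite /y dilE invrK.
have yz : beta y z = c^-1 * beta w z.
  by rewrite yE !sfE sf_alt mulr0 addr0 mulrA divfK //; ring.
have vy : beta v y = c * beta v w.
  by rewrite yE !sfE sf_alt mulr0 addr0 mulrA divfK //; ring.
rewrite dilE yz vy yE; set p := beta w z / _; set q := beta v w / _.
have -> : (c - 1) * (c^-1 * beta w z / beta v z) = - ((c^-1 - 1) * p).
  rewrite [LHS](_ : _ = (c * c^-1) * p - c^-1 * p); last by rewrite /p; ring.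
  by rewrite mulfV //; ring.
have -> : (c^-1 - 1) * (c * beta v w / beta v z) = - ((c - 1) * q).
  rewrite [LHS](_ : _ = (c * c^-1) * q - c * q); last by rewrite /q; ring.
  by rewrite mulfV //; ring.
by rewrite !scaleNr [_ + _ *: z - _]addrAC addrK addrK.
Qed.

(** Conjugation by a dilation scales [v], hence multiplies the parameter of the transvection by a
    square; this is how transvections become commutators. *)
Lemma tvZ v a c : tv (c *: v) a = tv v (c ^+ 2 * a).
Proof.
apply/lfunP => w; rewrite !tvE !sfE scalerA; congr (_ + _ *: _).
by ring.
Qed.

End SympForm.

(** * Symplectic bases: generation of the parabolic, Bruhat decomposition *)

Section SymplecticBasis.
Context (F : fieldType) (V : vectType F) (beta : symp_form V).
Context (l : nat) (eps phi : 'I_l -> V).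
Hypothesis F2 : 2 != 0 :> F.
Hypothesis basV : basis_of {:V} (codom eps ++ codom phi).
Hypothesis bee : forall i j, beta (eps i) (eps j) = 0.
Hypothesis bpp : forall i j, beta (phi i) (phi j) = 0.
Hypothesis bep : forall i j, beta (eps i) (phi j) = (i == j)%:R.

Local Notation X := <<codom eps>>%VS.

Lemma span_codomP (f : 'I_l -> V) y : y \in <<codom f>>%VS ->
  exists a, y = \sum_i a i *: f i.
Proof.
rewrite span_def big_map big_enum /= => /memv_sumP [vs vsP ->].
have /choice [a aP] (i : 'I_l) : exists c, vs i = c *: f i by apply/vlineP/vsP.
by exists a; apply: eq_bigr.
Qed.

Lemma mem_eps i : eps i \in X.
Proof. by apply: memv_span; apply: codom_f. Qed.

Lemma sum_deltal (c : 'I_l -> F) j : \sum_i c i * (i == j)%:R = c j.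
Proof.
rewrite (bigD1 j) //= eqxx mulr1 big1 ?addr0 // => i /negPf ->.
by rewrite mulr0.
Qed.

Lemma symp_expand y :
  y = \sum_i beta y (phi i) *: eps i + \sum_i beta (eps i) y *: phi i.
Proof.
have : y \in <<codom eps ++ codom phi>>%VS by rewrite (span_basis basV) memvf.
rewrite span_cat => /memv_addP [_ /span_codomP [a ->]] [_ /span_codomP [c ->] ->].
congr (_ + _); apply: eq_bigr => j _; congr (_ *: _).
  rewrite !sfE !sf_suml (eq_bigr (fun i => a i * (i == j)%:R)) => [|i _].
    rewrite sum_deltal big1 ?addr0 // => i _.
    by rewrite !sfE bpp mulr0.
  by rewrite !sfE bep.
rewrite !sfE !sf_sumr big1 ?add0r => [|i _]; last by rewrite !sfE bee mulr0.
rewrite (eq_bigr (fun i => c i * (i == j)%:R)) ?sum_deltal // => i _.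
by rewrite !sfE bep eq_sym.
Qed.

Lemma memXP y : reflect (forall i, beta (eps i) y = 0) (y \in X).
Proof.
apply: (iffP idP) => [/span_codomP [a ->] i|y0].
  by rewrite sf_sumr big1 // => j _; rewrite !sfE bee mulr0.
rewrite [y]symp_expand [X in _ + X]big1 ?addr0 => [|i _]; last by rewrite y0 scale0r.
by apply: rpred_sum => i _; apply: rpredZ; apply: mem_eps.
Qed.

Lemma X_isotropic u v : u \in X -> v \in X -> beta u v = 0.
Proof.
move=> /span_codomP [a ->] /memXP v0; rewrite sf_suml big1 // => i _.
by rewrite !sfE v0 mulr0.
Qed.

Lemma X_expand y : y \in X -> y = \sum_i beta y (phi i) *: eps i.
Proof.
move=> /memXP y0; rewrite [LHS]symp_expand [X in _ + X]big1 ?addr0 // => i _.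
by rewrite y0 scale0r.
Qed.

Lemma eq_on_basis (g h : 'End(V)) : (forall i, g (eps i) = h (eps i)) ->
  (forall i, g (phi i) = h (phi i)) -> g = h.
Proof.
move=> ge gp; apply/lfunP => y; rewrite [y]symp_expand !linearD !linear_sum /=.
congr (_ + _); apply: eq_bigr => i _; rewrite !linearZ /=.
  by rewrite ge.
by rewrite gp.
Qed.

Lemma free_eps : free (codom eps).
Proof. by apply: (catl_free (Y := codom phi)); apply: basis_free basV. Qed.

Lemma dimX : \dim X = l.
Proof. by have := free_eps; rewrite /free size_codom card_ord => /eqP. Qed.

(** * Unipotent and diagonal elements of the parabolic *)

Definition T_fun u v y := y + beta y u *: v + beta y v *: u.

Lemma T_fun_linear u v : linear (T_fun u v).
Proof.
move=> c x y; rewrite /T_fun !sfE !scalerDl -!scalerA !scalerDr.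
by rewrite [RHS]addrACA; congr (_ + _); rewrite [RHS]addrACA.
Qed.

HB.instance Definition _ u v :=
  GRing.isLinear.Build F V V *:%R (T_fun u v) (@T_fun_linear u v).

(** For [beta u v = 0] this is [1 + N] with [N ^ 2 = 0]. With [u] in [X] one family covers both
    kinds of unipotents of the parabolic: for [v] in [X] it is trivial on [X], for other [v] it
    restricts to the transvection [y + beta y v *: u] of [X]. *)
Definition T_op u v : 'End(V) := linfun (T_fun u v).

Lemma T_opE u v y : T_op u v y = y + beta y u *: v + beta y v *: u.
Proof. by rewrite lfunE. Qed.

(** Polarisation of the quadratic map [v |-> beta y v *: v]; [beta u v = 0] removes the cross terms
    of the composition. Through this formula [T_op] is lifted from [b] to [W]. *)
Lemma T_op_tv u v : beta u v = 0 ->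
  T_op u v = (tv beta (u + v) 1 \o (tv beta u (-1) \o tv beta v (-1)))%VF.
Proof.
move=> uv; have vu : beta v u = 0 by rewrite sfC uv oppr0.
apply/lfunP => y; rewrite T_opE !comp_lfunE !tvE !mul1r !mulN1r.
rewrite !sfE !sf_alt uv vu !mulr0 !addr0 !scaleNr.
rewrite !scalerDr !scalerDl [beta y u *: v + _]addrC [_ *: u + _ *: u + _]addrACA.
rewrite -[_ - _ - _]addrA -opprD [RHS]addrA (addrC (beta y v *: v)) subrK addrA.
by rewrite addrAC.
Qed.

Lemma Sp_T u v : beta u v = 0 -> Sp beta (T_op u v).
Proof. by move=> /T_op_tv ->; do 2?apply: SpM; apply: Sp_tv. Qed.

Lemma T_opK u v : beta u v = 0 -> (T_op u (- v) \o T_op u v)%VF = \1%VF.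
Proof.
move=> uv; have uv' : beta u (- v) = 0 by rewrite sfNr uv oppr0.
have vu : beta v u = 0 by rewrite sfC uv oppr0.
apply/lfunP => y; rewrite comp_lfunE id_lfunE !T_opE !sfE !sf_alt uv vu.
by rewrite !(mulr0, addr0, oppr0) scalerN scaleNr addrAC addrK addrK.
Qed.

Lemma T_opD u v v' : beta u v = 0 -> beta u v' = 0 -> beta v v' = 0 ->
  (T_op u v \o T_op u v')%VF = T_op u (v + v').
Proof.
move=> uv uv' vv'; have v'u : beta v' u = 0 by rewrite sfC uv' oppr0.
have v'v : beta v' v = 0 by rewrite sfC vv' oppr0.
apply/lfunP => y; rewrite comp_lfunE !T_opE !sfE sf_alt uv v'u v'v !mulr0 !addr0.
rewrite scalerDr scalerDl (addrC (beta y u *: v)) (addrC (beta y v *: u)) !addrA.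
by congr (_ + _); rewrite addrAC.
Qed.

Lemma T_op0 u : T_op u 0 = \1%VF.
Proof. by apply/lfunP => y; rewrite T_opE id_lfunE sf0r scale0r scaler0 !addr0. Qed.

Lemma T_op_fix u v y : beta u v = 0 -> beta y u = 0 -> beta y v = 0 ->
  T_op u v y = y.
Proof. by move=> uv yu yv; rewrite T_opE yu yv !scale0r !addr0. Qed.

Definition Pst (p : 'End(V)) : Prop := Sp beta p /\ (p @: X)%VS = X.

Lemma Sp_limg_dim (g : 'End(V)) (U : {vspace V}) :
  Sp beta g -> \dim (g @: U) = \dim U.
Proof. by move=> /Sp_lker0 /eqP k0; apply: limg_dim_eq; rewrite k0 capv0. Qed.

Lemma PstI p : Sp beta p -> (forall y, y \in X -> p y \in X) -> Pst p.
Proof.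
move=> Sp_p pX; split=> //; apply/eqP; rewrite eqEdim (Sp_limg_dim _ Sp_p) leqnn.
by rewrite andbT; apply/subvP => _ /memv_imgP [y yX ->]; apply: pX.
Qed.

Lemma Pst_mem p y : Pst p -> y \in X -> p y \in X.
Proof. by move=> [_ {2}<-]; apply: memv_img. Qed.

Lemma PstM p1 p2 : Pst p1 -> Pst p2 -> Pst (p1 \o p2)%VF.
Proof.
move=> P1 P2; apply: PstI => [|y yX]; first exact: SpM P1.1 P2.1.
by rewrite comp_lfunE; do 2?apply: Pst_mem.
Qed.

Lemma Pst_T u v : u \in X -> beta u v = 0 -> Pst (T_op u v).
Proof.
move=> uX uv; apply: PstI => [|y yX]; first exact: Sp_T.
rewrite T_opE (X_isotropic yX uX) scale0r addr0.
by rewrite rpredD // rpredZ.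
Qed.

Lemma phi_eps i j : beta (phi i) (eps j) = - (i == j)%:R.
Proof. by rewrite sfC bep eq_sym. Qed.

Definition hd i c : 'End(V) := dil beta (eps i) (phi i) c.

Lemma bepii i : beta (eps i) (phi i) = 1. Proof. by rewrite bep eqxx. Qed.

Lemma hdE i c y : hd i c y = y + ((c - 1) * beta y (phi i)) *: eps i
  + ((c^-1 - 1) * beta (eps i) y) *: phi i.
Proof. by rewrite /hd dilE bepii !divr1. Qed.

Lemma Sp_hd i c : c != 0 -> Sp beta (hd i c).
Proof. by move=> c0; apply: Sp_dil; rewrite // bepii oner_neq0. Qed.

Lemma Pst_hd i c : c != 0 -> Pst (hd i c).
Proof.
move=> c0; apply: PstI => [|y yX]; first exact: Sp_hd.
have /memXP/(_ i) e0 := yX.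
by rewrite hdE e0 mulr0 scale0r addr0 rpredD // rpredZ // mem_eps.
Qed.

Lemma hd_eps i c j : hd i c (eps j) = (if j == i then c else 1) *: eps j.
Proof.
rewrite hdE bee bep mulr0 scale0r addr0; case: eqVneq => [->|_].
  by rewrite mulr1 scalerBl scale1r addrC subrK.
by rewrite mulr0 scale0r addr0 scale1r.
Qed.

Lemma hd_phi i c j : hd i c (phi j) = (if j == i then c^-1 else 1) *: phi j.
Proof.
rewrite hdE bpp bep mulr0 scale0r addr0 eq_sym; case: eqVneq => [->|_].
  by rewrite mulr1 scalerBl scale1r addrC subrK.
by rewrite mulr0 scale0r addr0 scale1r.
Qed.

Lemma hdK i c : c != 0 -> (hd i c \o hd i c^-1)%VF = \1%VF.
Proof.
move=> c0; apply: eq_on_basis => j; rewrite comp_lfunE id_lfunE /=.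
  rewrite hd_eps linearZ /= hd_eps; case: eqP => _; last by rewrite !scale1r.
  by rewrite scalerA mulVf // scale1r.
rewrite hd_phi linearZ /= hd_phi; case: eqP => _; last by rewrite !scale1r.
by rewrite scalerA invrK mulfV // scale1r.
Qed.

(** The pair [r = u - a *: eps i], [v = - a^-1 *: phi i] is chosen so that [beta u v = -1]: then
    [T_op r v] subtracts [r] from [u]. The last clause protects vectors that are already in
    place. *)
Lemma T_to_eps u i : u \in X -> beta u (phi i) != 0 ->
  exists r v, [/\ r \in X, beta r v = 0,
    T_op r v u = beta u (phi i) *: eps i &
    forall y, beta y (phi i) = 0 -> beta y u = 0 -> beta y (eps i) = 0 ->
      T_op r v y = y].
Proof.
move=> uX; set a := beta u (phi i) => a0.
have rX : u - a *: eps i \in X by rewrite rpredB // rpredZ // mem_eps.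
have rv : beta (u - a *: eps i) (- a^-1 *: phi i) = 0.
  by rewrite !sfE bepii -/a; ring.
exists (u - a *: eps i), (- a^-1 *: phi i); split=> //.
  rewrite T_opE (X_isotropic uX rX) scale0r addr0 !sfE -/a mulNr mulVf //.
  by rewrite scaleN1r opprB addrC subrK.
move=> y yp yu ye; apply: T_op_fix => //; rewrite !sfE ?yu ?ye ?yp.
  by rewrite mulr0 oppr0 addr0.
by rewrite mulr0.
Qed.

(** Solving [u - c *: v + beta u v *: eps i = c *: phi i] determines [v] up to a multiple of
    [eps i]; the term with [a / (2 * c)] cancels the component along [eps i]. *)
Lemma T_to_phi u i : beta (eps i) u != 0 ->
  exists v, [/\ beta (eps i) v = 0,
    T_op (eps i) v u = beta (eps i) u *: phi i &
    forall y, beta y (phi i) = 0 -> beta y u = 0 -> beta y (eps i) = 0 ->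
      T_op (eps i) v y = y].
Proof.
set c := beta (eps i) u => c0; pose a := beta u (phi i).
have rv : beta (eps i) (c^-1 *: (u - c *: phi i) - (a / (2 * c)) *: eps i) = 0.
  by rewrite !sfE bepii bee -/c; ring.
exists (c^-1 *: (u - c *: phi i) - (a / (2 * c)) *: eps i); split=> //.
  rewrite T_opE (sfC beta u (eps i)) -/c !sfE sf_alt (sfC beta u (eps i)) -/c -/a.
  have -> : c^-1 * (0 - c * a) - a / (2 * c) * - c = - (a / 2).
    by field; rewrite F2 c0.
  rewrite scalerBr !scalerA !mulNr mulfV // scaleN1r opprB.
  have -> : c * (a / (2 * c)) = a / 2 by field; rewrite F2 c0.
  by rewrite !scaleNr opprK addrA addrK [u + _]addrC subrK.
move=> y yp yu ye; apply: T_op_fix => //; rewrite !sfE yp yu ye; ring.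
Qed.

(** * Generators of the parabolic *)

Section Generation.
Variable G : 'End(V) -> Prop.
Hypothesis G1 : G \1%VF.
Hypothesis GT : forall u v p, u \in X -> beta u v = 0 -> G p -> G (T_op u v \o p)%VF.
Hypothesis Gh : forall i (c : F) p, c != 0 -> G p -> G (hd i c \o p)%VF.

Let GTV u v p : u \in X -> beta u v = 0 -> G (T_op u v \o p)%VF -> G p.
Proof.
move=> uX uv Gp; have -> : p = (T_op u (- v) \o (T_op u v \o p))%VF.
  by rewrite comp_lfunA T_opK // comp_lfun1l.
by apply: GT => //; rewrite sfNr uv oppr0.
Qed.

Let fixes (p : 'End(V)) m := forall i : 'I_l, (i < m)%N ->
  p (eps i) = eps i /\ p (phi i) = phi i.

Let fixes_comp (p t : 'End(V)) m : fixes p m -> (forall i : 'I_l, (i < m)%N ->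
  t (eps i) = eps i /\ t (phi i) = phi i) -> fixes (t \o p)%VF m.
Proof.
by move=> fp ft i im; rewrite !comp_lfunE /=; have [-> ->] := fp i im; apply: ft.
Qed.

(** Row reduction: the hyperbolic pairs with index below [m] are already fixed, and left
    multiplication by generators restores first [eps im], then [phi im]. Membership in [G] is pulled
    back along each step because the inverse of a [T_op] is again a [T_op]. *)
Lemma P_gen p : Pst p -> G p.
Proof.
suff H n m : (m + n = l)%N -> forall q, Pst q -> fixes q m -> G q.
  by move=> Pp; apply: (H l 0%N).
elim: n m => [|n IH] m mn q.
  rewrite addn0 in mn; subst m => _ fq.
  suff -> : q = \1%VF by [].
  by apply: eq_on_basis => i; have [] := fq i (ltn_ord i); rewrite id_lfunE.
have ml : (m < l)%N by rewrite -mn addnS ltnS leq_addr.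
pose im := Ordinal ml.
have neq (i : 'I_l) : (i < m)%N -> i != im.
  by move=> lim; apply: contraTneq lim => ->; rewrite ltnn.
have fe p0 i : Pst p0 -> fixes p0 m -> (i < m)%N -> 
   forall i' : 'I_l, i' = i :> nat -> [/\ beta (eps i') (p0 (eps im)) = 0,
   beta (phi i') (p0 (eps im)) = 0, beta (eps i') (p0 (phi im)) = 0 &
   beta (phi i') (p0 (phi im)) = 0].
  move=> [S _] f lim i' ei; have lim' : (i' < m)%N by rewrite ei.
  have [f1 f2] := f i' lim'.
  have ni := negPf (neq _ lim').
  by split; [rewrite -f1|rewrite -f2|rewrite -f1|rewrite -f2];
    rewrite S ?bee ?bpp ?phi_eps ?bep ?ni ?oppr0.
have aux3 p0 : Pst p0 -> fixes p0 m -> p0 (eps im) = eps im -> G p0.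
  move=> Pp fp pe; have [Spp _] := Pp.
  have ev : beta (eps im) (p0 (phi im)) = 1 by rewrite -[eps im]pe Spp bepii.
  have ev0 : beta (eps im) (p0 (phi im)) != 0 by rewrite ev oner_neq0.
  have [v [uv Tv Tfix]] := T_to_phi ev0.
  apply: (GTV (mem_eps im) uv); apply: (IH m.+1); first by rewrite addSnnS.
    by apply: PstM => //; apply: Pst_T => //; apply: mem_eps.
  move=> i; rewrite ltnS leq_eqVlt => /orP [/eqP ei|lim].
    have -> : i = im by apply: val_inj.
    rewrite !comp_lfunE /= pe Tv ev scale1r T_op_fix //; exact: sf_alt.
  have [f1 f2] := fp i lim; rewrite !comp_lfunE f1 f2 /=.
  have [_ _ e1 e2] := fe p0 i Pp fp lim i (erefl _).
  have ni := negPf (neq _ lim).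
  by rewrite !Tfix ?e1 ?e2 ?bee ?bpp ?phi_eps ?bep ?ni ?oppr0.
have aux2 p0 a : a != 0 -> Pst p0 -> fixes p0 m -> p0 (eps im) = a *: eps im -> G p0.
  move=> a0 Pp fp pe.
  have -> : p0 = (hd im a \o (hd im a^-1 \o p0))%VF.
    by rewrite comp_lfunA hdK // comp_lfun1l.
  apply: Gh => //; apply: aux3.
  - by apply: PstM => //; apply: Pst_hd; rewrite invr_eq0.
  - apply: fixes_comp => // i lim; rewrite hd_eps hd_phi (negPf (neq _ lim)).
    by rewrite !scale1r.
  - by rewrite comp_lfunE pe linearZ /= hd_eps eqxx scalerA mulfV // scale1r.
have aux1 p0 : Pst p0 -> fixes p0 m -> beta (p0 (eps im)) (phi im) != 0 -> G p0.
  move=> Pp fp pe; have uX := Pst_mem Pp (mem_eps im).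
  have [r [v [rX rv Tu Tfix]]] := T_to_eps uX pe.
  apply: (GTV rX rv); apply: (@aux2 _ (beta (p0 (eps im)) (phi im))) => //.
  - by apply: PstM => //; apply: Pst_T.
  - apply: fixes_comp => // i lim.
    have [e1 e2 _ _] := fe p0 i Pp fp lim i (erefl _).
    have ni := negPf (neq _ lim).
    by rewrite !Tfix ?e1 ?e2 ?bee ?bpp ?phi_eps ?bep ?ni ?oppr0.
  - by rewrite comp_lfunE Tu.
move=> Pq fq; have uX := Pst_mem Pq (mem_eps im).
have [z|nz] := eqVneq (beta (q (eps im)) (phi im)) 0; last exact: aux1.
have [i iP] : exists i, beta (q (eps im)) (phi i) != 0.
  apply/existsP; apply: contraT; rewrite negb_exists => /forallP qz.
  have q0 : q (eps im) = 0.
    by rewrite [LHS]X_expand // big1 // => i _; move: (qz i); rewrite negbK => /eqP ->; rewrite scale0r.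
  by have := bepii im; rewrite -(Pq.1) q0 sf0l => /esym/eqP; rewrite oner_eq0.
have nim : i != im by apply: contraNneq iP => ->; rewrite z.
have uv : beta (eps im) (phi i) = 0 by rewrite bep eq_sym (negPf nim).
(* [T_op (eps im) (phi i)] adds [beta (q (eps im)) (phi i) *: eps im], which makes the vanishing
   pivot non-zero. *)
apply: (GTV (mem_eps im) uv); apply: aux1.
- by apply: PstM => //; apply: Pst_T => //; apply: mem_eps.
- apply: fixes_comp => // j lim.
  have ni := negPf (neq _ lim).
  have nij : j == i = false.
    apply/negP => /eqP ji; have [_ e2 _ _] := fe q j Pq fq lim j (erefl _).
    by move: iP; rewrite -ji sfC e2 oppr0 eqxx.
  by rewrite !T_op_fix // ?bee ?bpp ?phi_eps ?bep ?ni ?nij ?oppr0.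
- rewrite comp_lfunE T_opE (X_isotropic uX (mem_eps im)) scale0r addr0.
  by rewrite !sfE z bepii mulr1 add0r.
Qed.

End Generation.

(** * Weyl elements and the Bruhat decomposition *)

Definition tau1 i c : 'End(V) :=
  (tv beta (eps i) c^-1 \o (tv beta (phi i) c \o tv beta (eps i) c^-1))%VF.

Lemma Sp_tau1 i c : Sp beta (tau1 i c).
Proof. by do 2?apply: SpM; apply: Sp_tv. Qed.

(** The SL_2 identity that writes the antidiagonal matrix with entries [c] and [- c^-1] as a product
    of three unipotents. *)
Lemma tau1_eps i c j : c != 0 ->
  tau1 i c (eps j) = if j == i then c *: phi j else eps j.
Proof.
move=> c0; rewrite !comp_lfunE !tvE !sfE !bee !bep !phi_eps eqxx.
case: eqVneq => [->|nij]; last by rewrite !(mulr0n, mulr1n, mul0r, mulr0, addr0, scale0r, oppr0).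
rewrite !(mulr0n, mulr1n, mul0r, mulr0, addr0, scale0r, mulr1, add0r) mulrN mulr1 mulrN mulVf //.
by rewrite scaleN1r addrAC subrr add0r.
Qed.

Lemma tau1_phi i c j : c != 0 ->
  tau1 i c (phi j) = if j == i then - c^-1 *: eps j else phi j.
Proof.
move=> c0; rewrite !comp_lfunE !tvE !sfE !bee !bpp !bep !phi_eps eqxx.
case: eqVneq => [->|nij]; last by rewrite !(mulr0n, mulr1n, mul0r, mulr0, addr0, scale0r, oppr0).
rewrite !(mulr0n, mulr1n, mul0r, mulr0, addr0, scale0r, mulr1, add0r, mulrN, mulfV) //.
by rewrite subrr mulr0 scale0r addr0 scaleN1r addrAC subrr add0r.
Qed.

Definition tauS (s : seq 'I_l) : 'End(V) :=
  foldr (fun i t => tau1 i 1 \o t)%VF \1%VF s.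

Lemma Sp_tauS s : Sp beta (tauS s).
Proof. by elim: s => [|i s IH]; [apply: Sp1 | apply: SpM => //; apply: Sp_tau1]. Qed.

Lemma tauSE s : uniq s -> forall i,
  tauS s (eps i) = (if i \in s then phi i else eps i) /\
  tauS s (phi i) = (if i \in s then - eps i else phi i).
Proof.
elim: s => [|j s IH] /=; first by move=> _ i; rewrite !id_lfunE.
move=> /andP [js us] i; have [e1 e2] := IH us i.
have cE (t : 'End(V)) y : (tau1 j 1 \o t)%VF y = tau1 j 1 (t y).
  by rewrite comp_lfunE.
rewrite !cE e1 e2 !in_cons; case: (boolP (i \in s)) => /= is_.
  have nij : i == j = false by apply: contraNF js => /eqP <-.
  by rewrite linearN /= tau1_eps ?tau1_phi ?oner_neq0 // nij.
rewrite orbF tau1_eps ?tau1_phi ?oner_neq0 // invr1 scale1r scaleN1r.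
by [].
Qed.

(** The left factor of the Bruhat decomposition needs no diagonal elements: these are absorbed by
    the right factor. *)
Inductive Tgen : 'End(V) -> Prop :=
| Tgen1 : Tgen \1%VF
| TgenM u v p : u \in X -> beta u v = 0 -> Tgen p -> Tgen (T_op u v \o p)%VF.

Lemma limgX_isotropic g u v : Sp beta g ->
  u \in (g @: X)%VS -> v \in (g @: X)%VS -> beta u v = 0.
Proof.
move=> Sg /memv_imgP [u' uX ->] /memv_imgP [v' vX ->].
by rewrite Sg X_isotropic.
Qed.

(** Induction on the number of indices outside [D]. For [i] in [D] the standard vector [zt S i] lies
    in [h X]; once [D] is everything, [h X] is the image of [X] under [tau_S], and [h] differs from
    [tau_S] by an element of the parabolic. *)
Lemma bruhat g : Sp beta g -> exists p1 s p2,
  [/\ Tgen p1, uniq s, Pst p2 & g = (p1 \o (tauS s \o p2))%VF].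
Proof.
pose Br (h : 'End(V)) := exists p1 s p2,
  [/\ Tgen p1, uniq s, Pst p2 & h = (p1 \o (tauS s \o p2))%VF].
have BrT u v h : u \in X -> beta u v = 0 -> Br (T_op u v \o h)%VF -> Br h.
  move=> uX uv [p1 [s [p2 [T1 us P2 E]]]].
  exists (T_op u (- v) \o p1)%VF, s, p2; split=> //.
    by apply: TgenM => //; rewrite sfNr uv oppr0.
  by rewrite -comp_lfunA -E comp_lfunA T_opK // comp_lfun1l.
pose zt (S : {set 'I_l}) i := if i \in S then phi i else eps i.
suff H n (D S : {set 'I_l}) : #|~: D| = n -> S \subset D -> forall h, Sp beta h ->
    (forall i, i \in D -> zt S i \in (h @: X)%VS) -> Br h.
  move=> Sg; apply: (H _ finset.set0 finset.set0 erefl _ _ Sg) => //.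
  by move=> i; rewrite inE.
elim: n D S => [|n IH] D S cD sSD h Sh hD.
  have DT i : i \in D.
    by move/eqP: cD; rewrite cards_eq0 => /eqP/setP/(_ i); rewrite !inE => /negbFE.
  exists \1%VF, (enum S), ((tauS (enum S))^-1 \o h)%VF; split.
  - exact: Tgen1.
  - exact: enum_uniq.
  - have St := Sp_tauS (enum S).
    have tE := tauSE (enum_uniq S).
    have tXh : (tauS (enum S) @: X = h @: X)%VS.
      apply/eqP; rewrite eqEdim !Sp_limg_dim // leqnn andbT.
      apply/subvP => _ /memv_imgP [y yX ->].
      rewrite [y](X_expand yX) linear_sum /=; apply: rpred_sum => i _.
      rewrite linearZ rpredZ //=; have [-> _] := tE i.
      by have := hD i (DT i); rewrite /zt mem_enum.
    apply: PstI => [|y yX]; first by apply: SpM => //; apply: SpV.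
    have : h y \in (tauS (enum S) @: X)%VS by rewrite tXh memv_img.
    by rewrite comp_lfunE => /memv_imgP [z zX ->]; rewrite (SpK St).
  - by rewrite comp_lfun1l comp_lfunA (Sp_compV (Sp_tauS _)) comp_lfun1l.
pose Z := [seq zt S i | i <- enum D].
(* [h X] has dimension [l], which exceeds the number of vectors in [Z]. *)
have [u0 u0h u0Z] : exists2 u, u \in (h @: X)%VS & u \notin <<Z>>%VS.
  apply/subvPn; apply/negP => /dimvS; rewrite Sp_limg_dim // dimX => lZ.
  have := leq_trans lZ (dim_span Z); rewrite size_map -cardE.
  have := cardsC D; rewrite cD card_ord => cl.
  by rewrite leqNgt -[X in (_ < X)%N]cl addnS ltnS leq_addr.
(* For each index in [D] only one coordinate of [u0] has to be removed: the other one vanishes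
   because [h X] is isotropic and contains [zt S i]. *)
pose cf i := if i \in S then beta (eps i) u0 else beta u0 (phi i).
pose u := u0 - \sum_(i in D) cf i *: zt S i.
have uh : u \in (h @: X)%VS.
  rewrite rpredB //; apply: rpred_sum => i iD; rewrite rpredZ //.
  exact: hD.
have uD i : i \in D -> beta (eps i) u = 0 /\ beta u (phi i) = 0.
  move=> iD.
  have uz : beta (zt S i) u = 0 by apply: (limgX_isotropic Sh) => //; apply: hD.
  have zu : beta u (zt S i) = 0 by rewrite sfC uz oppr0.
  have [iS|iS] := boolP (i \in S).
    move: uz zu; rewrite /zt iS => _ ->; split=> //.
    rewrite /u !sfE sf_sumr (bigD1 i) //= /cf /zt iS !sfE bepii mulr1.
    rewrite big1 ?addr0 ?subrr // => j /andP [jD ji].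
    rewrite !sfE; case: ifP => _; rewrite ?bee ?bep ?mulr0 //.
    by rewrite eq_sym (negPf ji) mulr0.
  move: uz zu; rewrite /zt (negPf iS) => -> _; split=> //.
  rewrite /u !sfE sf_suml (bigD1 i) //= /cf /zt (negPf iS) !sfE bepii mulr1.
  rewrite big1 ?addr0 ?subrr // => j /andP [jD ji].
  by rewrite !sfE; case: ifP => _; rewrite ?bpp ?bep ?mulr0 // (negPf ji) mulr0.
have u0' : u != 0.
  apply: contraNneq u0Z => /eqP; rewrite subr_eq0 => /eqP ->.
  apply: rpred_sum => i iD; rewrite rpredZ // memv_span //.
  by apply: map_f; rewrite mem_enum.
have step i r v (c : F) : i \notin D -> r \in X -> beta r v = 0 -> c != 0 ->
    forall S' : {set 'I_l}, S' \subset i |: S -> S \subset S' ->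
    T_op r v u = c *: zt S' i ->
    (forall y, beta y (phi i) = 0 -> beta y u = 0 -> beta y (eps i) = 0 ->
      T_op r v y = y) -> Br h.
  move=> iD rX rv c0 S' S'1 SS' Tu Tfix; apply: (BrT _ _ _ rX rv).
  apply: (IH (i |: D) S').
  - have := cardsD1 i (~: D); rewrite inE iD cD add1n => -[->].
    by apply: eq_card => j; rewrite !inE negb_or.
  - by apply: (fintype.subset_trans S'1); apply: finset.setUS.
  - by apply: SpM => //; apply: Sp_T.
  - move=> j; rewrite in_setU1 limg_comp => /orP [/eqP ->|jD].
      have : c *: zt S' i \in (T_op r v @: (h @: X))%VS by rewrite -Tu memv_img.
      by rewrite rpredZeq (negPf c0).
    have jni : j == i = false by apply: contraNF iD => /eqP <-.
    have SSj : (j \in S') = (j \in S).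
      apply/idP/idP; last by apply: (fintype.subsetP SS').
      by move/(fintype.subsetP S'1); rewrite in_setU1 jni.
    have -> : zt S' j = zt S j by rewrite /zt SSj.
    have [e1 e2] := uD j jD.
    rewrite -[zt S j]Tfix; first by rewrite memv_img // hD.
    + by rewrite /zt; case: ifP; rewrite ?bpp ?bep ?jni.
    + by apply: (limgX_isotropic Sh) => //; apply: hD.
    + by rewrite /zt; case: ifP; rewrite ?bee ?phi_eps ?jni ?oppr0.
(* If [u] has a component on some [phi i], it is moved to a multiple of [phi i] and [i] joins [S];
   otherwise [u] lies in [X] and is moved to a multiple of some [eps i]. *)
have [/existsP [i ci]|] := boolP [exists i, beta (eps i) u != 0].
  have iD : i \notin D.
    by apply: contraNN ci => iD; have [-> _] := uD i iD; rewrite eqxx.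
  have [v [uv Tu Tfix]] := T_to_phi ci.
  apply: (step i (eps i) v _ iD (mem_eps i) uv ci (i |: S)) => //.
    exact: finset.subsetUr.
  by rewrite /zt in_setU1 eqxx.
rewrite negb_exists => /forallP ue.
have uX : u \in X by apply/memXP => i; move: (ue i); rewrite negbK => /eqP.
have [i ci] : exists i, beta u (phi i) != 0.
  apply/existsP; apply: contraNT u0'; rewrite negb_exists => /forallP uz.
  apply/eqP; rewrite [LHS]X_expand // big1 // => i _.
  by move: (uz i); rewrite negbK => /eqP ->; rewrite scale0r.
have iD : i \notin D.
  by apply: contraNN ci => iD; have [_ ->] := uD i iD; rewrite eqxx.
have [r [v [rX rv Tu Tfix]]] := T_to_eps uX ci.
apply: (step i r v _ iD rX rv ci S) => //; first exact: finset.subsetUr.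
rewrite /zt ifN //; apply: contraNN iD; exact: (fintype.subsetP sSD).
Qed.

End SymplecticBasis.

(** * Local fields and additive characters *)

Section LocalFieldBasics.
Context (k : fieldType) (F : finFieldType) (K : local_field k F).
Local Notation O := (ringO K).
Local Notation I := (idealO K).
Local Notation v := (lf_val K).
Local Notation pi := (lf_unif K).
Local Notation res := (lf_res K).

Lemma val1 : v 1 = 0.
Proof. by have := lf_valM K (oner_neq0 k) (oner_neq0 k); rewrite mulr1; lra. Qed.

Lemma valN x : x != 0 -> v (- x) = v x.
Proof.
have N1 : (-1 : k) != 0 by rewrite oppr_eq0 oner_neq0.
move=> x0; rewrite -mulN1r lf_valM //.
by have := lf_valM K N1 N1; rewrite mulrNN mulr1 val1; lra.
Qed.

Lemma valV x : x != 0 -> v x^-1 = - v x.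
Proof.
move=> x0; have x0' : x^-1 != 0 by rewrite invr_eq0.
by have := lf_valM K x0 x0'; rewrite mulfV // val1; lra.
Qed.

Lemma val_unifX (n : nat) : v (pi ^+ n) = n%:Z.
Proof.
elim: n => [|n IH]; first by rewrite expr0 val1.
by rewrite exprS lf_valM ?expf_neq0 ?lf_unif_neq0 // IH lf_val_unif intS.
Qed.

Lemma unifXz_neq0 (n : int) : pi ^ n != 0.
Proof. by rewrite expfz_neq0 ?lf_unif_neq0. Qed.

Lemma val_unifXz (n : int) : v (pi ^ n) = n.
Proof.
case: n => n; first exact: val_unifX.
by rewrite NegzE -exprnN valV ?expf_neq0 ?lf_unif_neq0 // val_unifX.
Qed.

Lemma idealP n x : I n x <-> (x = 0 \/ n <= v x).
Proof.
split=> [[y Oy <-]|].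
  have [->|y0] := eqVneq y 0; first by left; rewrite mulr0.
  case: Oy => [/eqP|vy]; first by rewrite (negPf y0).
  by right; rewrite lf_valM ?unifXz_neq0 // val_unifXz lerDl.
have [->|x0] := eqVneq x 0; first by exists 0; [left|rewrite mulr0].
case=> [/eqP|nx]; first by rewrite (negPf x0).
exists (pi ^ (- n) * x).
  by right; rewrite lf_valM ?unifXz_neq0 // val_unifXz; lra.
by rewrite mulrA -expfzDr ?lf_unif_neq0 // subrr expr0z mul1r.
Qed.

Lemma ringO_ideal x : O x <-> I 0 x. Proof. by rewrite idealP. Qed.

Lemma ideal0 n : I n 0. Proof. by apply/idealP; left. Qed.

Lemma idealD n x y : I n x -> I n y -> I n (x + y).
Proof.
have [->|x0] := eqVneq x 0; first by rewrite add0r.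
have [->|y0] := eqVneq y 0; first by rewrite addr0.
have [->|xy0] := eqVneq (x + y) 0; first by move=> _ _; apply: ideal0.
rewrite !idealP => -[/eqP|nx]; first by rewrite (negPf x0).
case=> [/eqP|ny]; first by rewrite (negPf y0).
by right; apply: le_trans (lf_valD K x0 y0 xy0); rewrite le_min nx.
Qed.

Lemma idealN n x : I n x -> I n (- x).
Proof.
have [->|x0] := eqVneq x 0; first by rewrite oppr0.
rewrite !idealP valN // => -[->|nx]; [left|right] => //.
by rewrite oppr0.
Qed.

Lemma idealM m n x y : I m x -> I n y -> I (m + n) (x * y).
Proof.
have [->|x0] := eqVneq x 0; first by rewrite mul0r => _ _; apply: ideal0.
have [->|y0] := eqVneq y 0; first by rewrite mulr0 => _ _; apply: ideal0.
rewrite !idealP => -[/eqP|nx]; first by rewrite (negPf x0).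
case=> [/eqP|ny]; first by rewrite (negPf y0).
by right; rewrite lf_valM // lerD.
Qed.

Lemma idealMl n a x : O a -> I n x -> I n (a * x).
Proof. by rewrite ringO_ideal => Oa Ix; rewrite -[n]add0r; apply: idealM. Qed.

Lemma idealMr n a x : I n x -> O a -> I n (x * a).
Proof. by move=> Ix Oa; rewrite mulrC; apply: idealMl. Qed.

Lemma ideal_unifXz n : I n (pi ^ n).
Proof. by apply/idealP; right; rewrite val_unifXz. Qed.

Lemma ideal_div m n x y : y != 0 -> v y = n -> I m x -> I (m - n) (x / y).
Proof.
move=> y0 vy Ix; apply: idealM Ix _; apply/idealP; right.
by rewrite valV // vy.
Qed.

Lemma ringO0 : O 0. Proof. by left. Qed.
Lemma ringO1 : O 1. Proof. by right; rewrite val1. Qed.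
Lemma ringOD x y : O x -> O y -> O (x + y).
Proof. by rewrite !ringO_ideal; apply: idealD. Qed.
Lemma ringON x : O x -> O (- x).
Proof. by rewrite !ringO_ideal; apply: idealN. Qed.
Lemma ringOM x y : O x -> O y -> O (x * y).
Proof. by move=> Ox; rewrite !ringO_ideal; apply: idealMl. Qed.
Lemma ringO_nat n : O n%:R.
Proof.
elim: n => [|n IH]; first exact: ringO0.
by rewrite mulrS; apply: ringOD => //; apply: ringO1.
Qed.

Lemma res0 : res 0 = 0.
Proof.
by apply: (addrI (res 0)); rewrite -lf_resD ?addr0 //; apply: ringO0.
Qed.

Lemma resN x : O x -> res (- x) = - res x.
Proof.
move=> Ox; apply/eqP; rewrite -addr_eq0 -lf_resD ?addNr ?res0 //.
exact: ringON.
Qed.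

Lemma res_nat n : res n%:R = n%:R.
Proof.
elim: n => [|n IH]; first exact: res0.
by rewrite !mulrS lf_resD ?IH ?lf_res1 //; [apply: ringO1|apply: ringO_nat].
Qed.

Lemma res_eq0 x : O x -> (res x = 0 <-> I 1 x).
Proof. exact: lf_res_ker. Qed.

Lemma res_eq x y : O x -> O y -> (res x = res y <-> I 1 (x - y)).
Proof.
move=> Ox Oy; rewrite -res_eq0; last by apply: ringOD => //; apply: ringON.
rewrite lf_resD ?resN //; last exact: ringON.
by split=> [->|/eqP]; rewrite ?subrr // subr_eq0 => /eqP.
Qed.

Lemma res_unit x : O x -> res x != 0 -> [/\ x != 0, v x = 0 & O x^-1].
Proof.
move=> Ox rx.
have x0 : x != 0 by apply: contraNneq rx => ->; rewrite res0.
have vx : v x = 0.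
  case: (Ox) => [/eqP|v0]; first by rewrite (negPf x0).
  apply/eqP; rewrite eq_le v0 andbT leNgt; apply/negP => v1.
  by case/eqP: rx; apply/res_eq0 => //; apply/idealP; right; rewrite -gtz0_ge1.
by split=> //; right; rewrite valV // vx oppr0.
Qed.

Lemma resV x : O x -> res x != 0 -> res x^-1 = (res x)^-1.
Proof.
move=> Ox rx; have [x0 _ Ox'] := res_unit Ox rx.
by apply: (mulfI rx); rewrite -lf_resM // !mulfV // lf_res1.
Qed.

Lemma lift_resP a : O (lift_res K a) /\ res (lift_res K a) = a.
Proof.
rewrite /lift_res; case: xgetP => [x _ //|H].
by have [x Ox rx] := lf_res_surj K a; case: (H x).
Qed.

Lemma k2_neq0 : 2 != 0 :> k.
Proof.
by apply/negP => /eqP k2; have := lf_char0 K 2%N; rewrite !inE /= k2 eqxx.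
Qed.

Hypothesis odd_res : 2%N \notin [pchar F].

Lemma F2_neq0 : 2 != 0 :> F.
Proof. by apply: contraNneq odd_res => F2; rewrite inE /= F2 eqxx. Qed.

Lemma ringO_half : O 2^-1.
Proof. by have [] := res_unit (ringO_nat 2) _; rewrite ?res_nat ?F2_neq0. Qed.

Lemma res_half : res 2^-1 = 2^-1.
Proof. by rewrite resV ?res_nat ?F2_neq0 //; apply: ringO_nat. Qed.

End LocalFieldBasics.

Section Character.
Context (R : realType) (k : fieldType) (F : finFieldType) (K : local_field k F).
Context (psi : add_char R K).

Lemma psi_neq0 x : psi x != 0.
Proof. by rewrite -normr_gt0 ach_norm ltr01. Qed.

Lemma psi0 : psi 0 = 1.
Proof. by apply: (mulfI (psi_neq0 0)); rewrite -ach_D addr0 mulr1. Qed.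

Lemma psi_congr x y : idealO K (ach_cond psi) (x - y) -> psi x = psi y.
Proof. by move=> Ixy; rewrite -(subrK y x) ach_D ach_cond_triv // mul1r. Qed.

(** Outside the conductor ideal, the multiples of [x] by integers of [k] fill the ideal of exponent
    [ach_cond psi - 1], on which [psi] is non-trivial. *)
Lemma psi_ntriv x : ~ idealO K (ach_cond psi) x ->
  exists2 t, ringO K t & psi (t * x) <> 1.
Proof.
move=> nIx; have [y Iy py] := ach_cond_ntriv psi.
have x0 : x != 0 by apply/eqP => x0; apply: nIx; rewrite x0; apply: ideal0.
exists (y / x); last by rewrite divfK.
have vx : lf_val K x <= ach_cond psi - 1.
  by rewrite leNgt; apply/negP => xv; apply: nIx; apply/idealP; right; lia.
apply/ringO_ideal; have := ideal_div x0 erefl Iy; apply: idealO_le; lia.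
Qed.

End Character.

(** * The lattice model *)

Section Quot.
Context (W : zmodType) (L N : set W).
Hypothesis N0 : N 0.
Hypothesis ND : forall x y, N x -> N y -> N (x + y).
Hypothesis NN : forall x, N x -> N (- x).
Hypothesis NL : N `<=` L.
Hypothesis LD : forall x y, L x -> L y -> L (x + y).

Lemma quot_crepr c : quot L N c -> L (crepr c) /\ c = [set crepr c + x | x in N].
Proof.
move=> [a La <-{c}]; rewrite /crepr; case: xgetP => [_ -> [x Nx <-]|/(_ (a + 0)) []].
  split; first by apply: LD => //; apply: NL.
  apply/seteqP; split=> [_ [y Ny <-]|_ [y Ny <-]].
    exists (y - x); first by apply: ND => //; apply: NN.
    by rewrite addrA addrAC addrK.
  by exists (x + y); rewrite ?addrA //; apply: ND.
by exists 0.
Qed.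

Lemma quot_cover a : L a -> exists2 c, quot L N c & N (a - crepr c).
Proof.
move=> La; exists [set a + x | x in N]; first by exists a.
have qc : quot L N [set a + x | x in N] by exists a.
have [_ E] := quot_crepr qc.
have : [set a + x | x in N] a by exists 0; rewrite ?addr0.
by rewrite {1}E => -[x Nx xa]; rewrite -{1}xa addrAC subrr add0r.
Qed.

Lemma quot_inj c d : quot L N c -> quot L N d -> N (crepr c - crepr d) -> c = d.
Proof.
move=> qc qd Ncd; have [_ ->] := quot_crepr qc; have [_ Ed] := quot_crepr qd.
rewrite [RHS]Ed; apply/seteqP; split=> [_ [y Ny <-]|_ [y Ny <-]].
  exists (crepr c - crepr d + y); first exact: ND.
  by rewrite addrA [_ + (_ - _)]addrC subrK.
exists (crepr d - crepr c + y); first by apply: ND => //; rewrite -opprB; apply: NN.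
by rewrite addrA [_ + (_ - _)]addrC subrK.
Qed.

End Quot.

Section LatticeModelFacts.
Context (R : realType) (k : fieldType) (F : finFieldType) (K : local_field k F).
Hypothesis odd_res : 2%N \notin [pchar F].
Context (psi : add_char R K) (W : vectType k) (beta : symp_form W).
Context (A : lattice K W).
Hypothesis Asd : self_dual psi beta A.
Local Notation I := (idealO K (ach_cond psi)).
Local Notation inA := (lat_set A).
Local Notation H := (Hilb psi beta A).
Local Notation rho := (@rho R k F K psi W beta A).

Lemma latN (L : lattice K W) x : lat_set L x -> lat_set L (- x).
Proof. by rewrite -scaleN1r; apply: lat_Z; apply/ringON/ringO1. Qed.

Lemma latB (L : lattice K W) x y : lat_set L x -> lat_set L y -> lat_set L (x - y).
Proof. by move=> Lx Ly; apply: lat_D => //; apply: latN. Qed.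

Lemma half_ideal n x : idealO K n x -> idealO K n (2^-1 * x).
Proof. by apply: idealMl; apply: ringO_half. Qed.

Lemma Aideal a c : inA a -> inA c -> I (beta a c).
Proof. by rewrite {1}Asd => /[apply]. Qed.

Lemma HE (f : H) a w : inA a -> f (a + w) = psi (2^-1 * beta w a) * f w.
Proof. by case: f => f /=; rewrite inE => -[+ _]; apply. Qed.

Lemma H_A (f : H) a : inA a -> f a = f 0.
Proof. by move=> Aa; rewrite -[a]addr0 HE // sf0l mulr0 psi0 mul1r. Qed.

Lemma H_fin (f : H) : (normsq A f < +oo)%E.
Proof. by case: f => f /=; rewrite inE => -[]. Qed.

Lemma sqmod0 : sqmod (0 : R[i]) = 0.
Proof. by rewrite /sqmod /= expr0n addr0. Qed.

Lemma sqmod_eq0 (z : R[i]) : sqmod z = 0 -> z = 0.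
Proof.
case: z => a c; rewrite /sqmod /= => /eqP.
by rewrite paddr_eq0 ?sqr_ge0 // !sqrf_eq0 => /andP [/eqP -> /eqP ->].
Qed.

Definition phi_fun : W -> R[i] := fun w => if `[< inA w >] then 1 else 0.

Lemma phi_funT w : inA w -> phi_fun w = 1.
Proof. by move=> Aw; rewrite /phi_fun asboolT. Qed.
Lemma phi_funF w : ~ inA w -> phi_fun w = 0.
Proof. by move=> Aw; rewrite /phi_fun asboolF. Qed.

Let A0set := [set (0 : W) + x | x in (A : set W)].

Lemma quotTA : quot setT (A : set W) A0set.
Proof. by exists 0. Qed.

Let Aquot c : quot setT (A : set W) c ->
  setT (crepr c) /\ c = [set crepr c + x | x in (A : set W)].
Proof.
apply: quot_crepr => //; [exact: lat_0|exact: lat_D|exact: latN].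
Qed.

Lemma crepr_A0 : inA (crepr A0set).
Proof.
rewrite /crepr; case: xgetP => [_ -> [x Ax <-]|/(_ 0) []]; first by rewrite add0r.
by exists 0; rewrite ?addr0 //; apply: lat_0.
Qed.

Lemma crepr_notA c : quot setT (A : set W) c -> c != A0set -> ~ inA (crepr c).
Proof.
move=> qc /eqP cn Ac; apply: cn; have [_ ->] := Aquot qc.
apply/seteqP; split=> [_ [y Ay <-]|_ [y Ay <-]]; last first.
  exists (y - crepr c); first exact: latB.
  by rewrite add0r addrC subrK.
by exists (crepr c + y); rewrite ?add0r //; apply: lat_D.
Qed.

Lemma normsq_ge0 (f : W -> R[i]) : (0 <= normsq A f)%E.
Proof. by apply: esum_ge0 => c _; rewrite lee_fin sqmod_ge0. Qed.

Lemma phi_subproof : phi_fun \in Hpred psi beta A.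
Proof.
rewrite inE; split=> [a w Aa|].
  have [Aw|Aw] := pselect (inA w).
    rewrite !phi_funT //; last exact: lat_D.
    by rewrite ach_cond_triv ?mulr1 //; apply/half_ideal/Aideal.
  rewrite !phi_funF ?mulr0 // => Aaw; apply: Aw.
  by rewrite -(addKr a w) addrC; apply: latB.
rewrite /normsq (esumID [set A0set]); last by move=> c _; rewrite lee_fin sqmod_ge0.
rewrite [X in (_ + X)%E]esum1 ?adde0; last first.
  move=> c [qc /eqP cA]; rewrite phi_funF ?sqmod0 //; exact: crepr_notA.
rewrite (_ : _ `&` _ = [set A0set]) ?esum_set1 ?lee_fin ?sqmod_ge0 ?ltry //.
by apply/seteqP; split=> [c [] //|c ->]; split => //; apply: quotTA.
Qed.

Definition phiA : H := MkHilb phi_subproof.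

Lemma phiAT w : inA w -> phiA w = 1. Proof. exact: phi_funT. Qed.
Lemma phiAF w : ~ inA w -> phiA w = 0. Proof. exact: phi_funF. Qed.

Lemma H_eqP (f f' : H) : (forall w, f w = f' w) -> f = f'.
Proof. by move=> ff; apply: val_inj; apply/funext. Qed.

Lemma HD (f f' : H) w : (f + f') w = f w + f' w. Proof. by []. Qed.
Lemma HZ c (f : H) w : (c *: f) w = c * f w. Proof. by []. Qed.
Lemma HN (f : H) w : (- f) w = - f w. Proof. by []. Qed.
Lemma H0 w : (0 : H) w = 0. Proof. by []. Qed.
Lemma Hsum (T : Type) (s : seq T) (P : pred T) (f : T -> H) w :
  (\sum_(i <- s | P i) f i) w = \sum_(i <- s | P i) f i w.
Proof. exact: (big_morph (fun f : H => f w)). Qed.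

Lemma rhoE w t (f : H) w' : rho w t f w' = psi (t + 2^-1 * beta w' w) * f (w' + w).
Proof. by []. Qed.

(** For [w] outside [A], self-duality gives [a] in [A] with [psi (beta w a)] different from 1 after
    scaling. Invariance under [rho a 0] and quasi-periodicity each contribute
    [psi (2^-1 * beta w a)], and the product forces [f w = 0]. *)
Lemma rho_fixed (f : H) : (forall a, inA a -> rho a 0 f = f) -> f = f 0 *: phiA.
Proof.
move=> fx; apply: H_eqP => w; rewrite HZ; have [Aw|Aw] := pselect (inA w).
  by rewrite phiAT // mulr1 H_A.
rewrite phiAF // mulr0.
have [a Aa nI] : exists2 a, inA a & ~ I (beta w a).
  apply: contrapT => ex; apply: Aw; rewrite Asd => a Aa.
  by apply: contrapT => nI; apply: ex; exists a.
have [t Ot pt] := psi_ntriv nI.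
have Ata : inA (t *: a) by apply: lat_Z.
have E : f w = psi (t * beta w a) * f w.
  rewrite -{1}(fx _ Ata) rhoE [w + _]addrC HE // mulrA -ach_D sfZr.
  congr (psi _ * _); have := k2_neq0 K; move: (t * _) => z k2.
  by field.
apply/eqP; apply: contrapT => /negP fw; apply: pt.
by apply: (mulIf fw); rewrite mul1r -E.
Qed.

(** The delta function of the coset [y + A], normalised to be 1 at [y]. *)
Definition dlt (y : W) : H := rho (- y) 0 phiA.

Lemma dltT y w : inA (w - y) -> dlt y w = psi (2^-1 * beta y w).
Proof. by move=> Aw; rewrite rhoE phiAT // mulr1 add0r sfNr sfC opprK. Qed.

Lemma dltF y w : ~ inA (w - y) -> dlt y w = 0.
Proof. by move=> Aw; rewrite rhoE phiAF // mulr0. Qed.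

Lemma H_dlt (f : H) y w : inA (w - y) -> f w = f y * dlt y w.
Proof.
move=> Aw; rewrite dltT // -{1}(subrK y w) HE // mulrC; congr (_ * psi (_ * _)).
by rewrite sfDr sfNr sf_alt subr0.
Qed.

Lemma le_normsq (f : H) : ((sqmod (f 0))%:E <= normsq A f)%E.
Proof.
apply: esum_ge; exists [set A0set].
  split; first exact: finite_set1.
  by move=> c ->; apply: quotTA.
by rewrite fsbig_set1 (H_A f) //; apply: crepr_A0.
Qed.

(** Stands in for the orthogonality of [phiA] to functions vanishing on [A]: unitarity is given as
    preservation of [normsq], and the two values of [normsq] differ by exactly that of
    [(2 * z) *: phiA]. *)
Lemma normsq_phi_ext (f h : H) (z : R[i]) :
  f 0 = 2 * z -> h 0 = 0 -> (forall w, ~ inA w -> f w = h w) ->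
  normsq A f = normsq A h -> z = 0.
Proof.
move=> f0 h0 fh E; apply: sqmod_eq0.
have e1 : normsq A f = (normsq A h + normsq A ((2 * z) *: phiA))%E.
  rewrite /normsq -esumD; [|by move=> *; rewrite lee_fin sqmod_ge0..].
  apply: eq_esum => c qc; rewrite -EFinD HZ.
  have [->|cA] := eqVneq c A0set.
    have Ac := crepr_A0; rewrite (H_A f) // (H_A h) // f0 h0 phiAT //.
    by rewrite mulr1 sqmod0 add0r.
  have Ac := crepr_notA qc cA; rewrite phiAF // fh // mulr0 sqmod0 addr0 //.
have hf : normsq A h \is a fin_num by rewrite ge0_fin_numE ?normsq_ge0 // H_fin.
have e2 : normsq A ((2 * z) *: phiA) = 0%E.
  by rewrite -[LHS](addeK _ hf) [X in (X - _)%E]addeC -e1 E subee.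
have : ((sqmod (2 * z))%:E <= 0 :> \bar R)%E.
  rewrite -e2; apply: le_trans (le_normsq _).
  by rewrite HZ phiAT ?mulr1 //; apply: lat_0.
rewrite lee_fin sqmodM => le0.
have s4 : sqmod (2 : R[i]) = 4 by rewrite /sqmod /=; ring.
apply/eqP; rewrite eq_le sqmod_ge0 andbT; move: le0; rewrite s4.
by rewrite pmulr_rle0 // ltr0n.
Qed.

End LatticeModelFacts.
Arguments phiA : simpl never.
Arguments dlt : simpl never.
Arguments rho : simpl never.

(** * Intertwining operators *)

Section Intertwiner.
Context (R : realType) (k : fieldType) (F : finFieldType) (K : local_field k F).
Hypothesis odd_res : 2%N \notin [pchar F].
Context (psi : add_char R K) (W : vectType k) (beta : symp_form W).
Context (A : lattice K W).
Hypothesis Asd : self_dual psi beta A.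
Local Notation inA := (lat_set A).
Local Notation I := (idealO K (ach_cond psi)).
Local Notation H := (Hilb psi beta A).
Local Notation rho := (@rho R k F K psi W beta A).
Local Notation phiA := (phiA odd_res Asd).
Local Notation dlt := (dlt odd_res Asd).

Definition latI (g : 'End(W)) : set W := inA `&` [set g x | x in inA].
Definition latQ (g : 'End(W)) : set (set W) := quot inA (latI g).

Section QuotFacts.
Context (g : 'End(W)).

Lemma latI_0 : latI g 0.
Proof. by split; [exact: lat_0|exists 0; rewrite ?linear0 //; apply: lat_0]. Qed.

Lemma latI_D x y : latI g x -> latI g y -> latI g (x + y).
Proof.
move=> [Ax [x' Ax' gx]] [Ay [y' Ay' gy]]; split; first exact: lat_D.
rewrite -gx -gy; by exists (x' + y'); rewrite ?linearD //; apply: lat_D.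
Qed.

Lemma latI_N x : latI g x -> latI g (- x).
Proof.
move=> [Ax [x' Ax' gx]]; split; first exact: latN.
rewrite -gx; by exists (- x'); rewrite ?linearN //; apply: latN.
Qed.

Let latI_sub : latI g `<=` inA. Proof. by move=> x []. Qed.

Lemma latQ_crepr c : latQ g c -> inA (crepr c).
Proof.
by case/(quot_crepr latI_0 latI_D latI_N latI_sub (@lat_D _ _ _ _ A)).
Qed.

Lemma latQ_cover a : inA a -> exists2 c, latQ g c & latI g (a - crepr c).
Proof.
exact: (quot_cover latI_0 latI_D latI_N latI_sub (@lat_D _ _ _ _ A)).
Qed.

Lemma latQ_inj c d : latQ g c -> latQ g d -> latI g (crepr c - crepr d) -> c = d.
Proof.
exact: (quot_inj latI_0 latI_D latI_N latI_sub (@lat_D _ _ _ _ A)).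
Qed.

End QuotFacts.

Lemma latI_inv g e : Sp beta g -> latI g e -> inA ((g^-1)%VF e).
Proof. by move=> Sg [_ [x Ax <-]]; rewrite (SpK Sg). Qed.

Lemma latI_of_inv g e : Sp beta g -> inA e -> inA ((g^-1)%VF e) -> latI g e.
Proof. by move=> Sg Ae Age; split=> //; exists ((g^-1)%VF e); rewrite ?(SpVK Sg). Qed.

Section Uniqueness.
Context (g : 'End(W)) (U : H -> H).
Hypothesis gU : Sp_hat (g, U).
Hypothesis Qfin : finite_set (latQ g).

Let Sg : Sp beta g. Proof. by case: gU. Qed.
Let Ulin : linear U. Proof. by case: gU => _ []. Qed.
Let Usurj f : exists f', U f' = f. Proof. by case: gU => _ [] _ /(_ f). Qed.
Let Unorm f : normsq A (U f) = normsq A f. Proof. by case: gU => _ []. Qed.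
Let Urho w t f : U (rho w t f) = rho (g w) t (U f). Proof. by case: gU. Qed.

Let U0 : U 0 = 0.
Proof. by apply: (addrI (U 0)); have := Ulin 1 0 0; rewrite !scale1r !addr0 => <-. Qed.
Let UD f f' : U (f + f') = U f + U f'.
Proof. by have := Ulin 1 f f'; rewrite !scale1r. Qed.
Let UZ c f : U (c *: f) = c *: U f.
Proof. by have := Ulin c f 0; rewrite !addr0 U0 addr0. Qed.
Let Usum (T : Type) (s : seq T) (f : T -> H) :
  U (\sum_(i <- s) f i) = \sum_(i <- s) U (f i).
Proof. by apply: (big_morph U) => [x y|]; rewrite ?UD ?U0. Qed.

Let Q := fset_set (latQ g).
Let QP c : (c \in Q) = (c \in latQ g). Proof. by rewrite /Q in_fset_set. Qed.
Let y c := (g^-1)%VF (crepr c).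

Let y_inj c d w : c \in Q -> d \in Q -> inA (w - y c) -> inA (w - y d) -> c = d.
Proof.
rewrite !QP !inE => qc qd Ac Ad.
apply: (latQ_inj qc qd); apply: latI_of_inv => //.
  by apply: latB; apply: latQ_crepr; [apply: qc|apply: qd].
rewrite linearB /= -/(y c) -/(y d).
have -> : y c - y d = (w - y d) - (w - y c).
  by rewrite opprB [RHS]addrC addrA subrK.
exact: latB.
Qed.

Let sumdlt (F0 : set W -> R[i]) d w : d \in Q -> inA (w - y d) ->
  \sum_(c <- Q) F0 c * dlt (y c) w = F0 d * dlt (y d) w.
Proof.
move=> dQ Ad.
transitivity (F0 d * dlt (y d) w + \sum_(c <- Q | c != d) F0 c * dlt (y c) w).
  by apply: bigD1_seq => //; apply: fset_uniq.
rewrite big_seq_cond big1 ?addr0 //.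
move=> c /andP [cQ cd]; rewrite dltF ?mulr0 // => Ac.
by case/eqP: cd; apply: (y_inj cQ dQ Ac Ad).
Qed.

(** The support [covered] of this sum of delta functions is [g^-1 A + A]. It is built to be
    invariant under [rho (g^-1 a) 0], so that [U] sends it to a multiple of [phiA]. *)
Let xi : H := \sum_(c <- Q) dlt (y c).
Let covered w := exists2 d, d \in Q & inA (w - y d).

Let xiE d w : d \in Q -> inA (w - y d) -> xi w = psi (2^-1 * beta (y d) w).
Proof.
move=> dQ Ad; rewrite /xi Hsum.
under eq_bigr => c _ do rewrite -[dlt _ _]mul1r.
by rewrite (sumdlt (fun=> 1) dQ Ad) mul1r dltT.
Qed.

Let xi0 w : ~ covered w -> xi w = 0.
Proof.
move=> nc; rewrite /xi Hsum big_seq_cond big1 // => c /andP [cQ _].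
by apply: dltF => Ac; apply: nc; exists c.
Qed.

Let yg c a : beta (y c) ((g^-1)%VF a) = beta (crepr c) a.
Proof. by rewrite /y (SpV Sg). Qed.

(** Translation by [g^-1 a] permutes the cosets that make up the support; [e] records the
    discrepancy between chosen representatives. *)
Let move_cover d w a : d \in Q -> inA (w - y d) -> inA a ->
  exists c e, [/\ c \in Q, latI g e, inA (w + (g^-1)%VF a - y c) &
    y c = y d + (g^-1)%VF a - (g^-1)%VF e].
Proof.
move=> dQ Ad Aa; move: (dQ); rewrite QP inE => /latQ_crepr Acd.
have [c cQ ce] := latQ_cover g (lat_D Acd Aa).
exists c, (crepr d + a - crepr c); split=> //; first by rewrite QP inE.
  have -> : w + (g^-1)%VF a - y c = (w - y d) + (g^-1)%VF (crepr d + a - crepr c).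
    by rewrite !linearB linearD /= -/(y d) -/(y c) !addrA subrK.
  by apply: lat_D => //; apply: latI_inv.
rewrite /y -(linearD (g^-1)%VF) -(linearB (g^-1)%VF).
by congr (_ _); rewrite opprB addrC subrK.
Qed.

Let covered_move w a : inA a -> covered w -> covered (w + (g^-1)%VF a).
Proof.
by move=> Aa [d dQ Ad]; have [c [e [cQ _ Ac _]]] := move_cover dQ Ad Aa; exists c.
Qed.

Let xi_fixed a : inA a -> rho ((g^-1)%VF a) 0 xi = xi.
Proof.
move=> Aa; apply: H_eqP => w; rewrite rhoE add0r.
have [[d dQ Ad]|nc] := pselect (covered w); last first.
  rewrite !xi0 ?mulr0 // => /(covered_move (latN Aa)).
  by rewrite linearN /= addrK.
have [c [e [cQ Ne Ac yc]]] := move_cover dQ Ad Aa.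
rewrite (xiE cQ Ac) (xiE dQ Ad) -ach_D; apply: psi_congr.
have Acr : inA (crepr c) by apply: latQ_crepr; move: cQ; rewrite QP inE; apply.
have Adr : inA (crepr d) by apply: latQ_crepr; move: dQ; rewrite QP inE; apply.
have -> : 2^-1 * beta w ((g^-1)%VF a) + 2^-1 * beta (y c) (w + (g^-1)%VF a)
   - 2^-1 * beta (y d) w = 2^-1 * (beta (crepr c) a
      - (beta ((g^-1)%VF e) (w - y d) - beta (crepr d) e)).
  rewrite sfDr yg yc !sfE -(yg d e) (sfC beta w) (sfC beta (y d) ((g^-1)%VF e)).
  ring.
apply: half_ideal => //; apply: idealD; first exact: (Aideal Asd).
apply/idealN/idealD; last by apply/idealN/(Aideal Asd) => //; case: Ne.
by apply: (Aideal Asd) => //; apply: latI_inv.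
Qed.

Let Uxi : U xi = U xi 0 *: phiA.
Proof.
apply: rho_fixed => a Aa; rewrite -[in LHS](SpVK Sg a) -Urho xi_fixed //.
Qed.

Let Uxi0 : U xi 0 != 0.
Proof.
apply/eqP => u0; have [c cQ c0] := latQ_cover g (lat_0 A).
have : xi 0 = 1.
  rewrite (@xiE c) ?sf0r ?mulr0 ?psi0 //; first by rewrite QP inE.
  by rewrite sub0r -linearN -sub0r; apply: latI_inv.
have n0 : normsq A xi = 0%E.
  by rewrite -Unorm Uxi u0 scale0r /normsq esum1 // => d _; rewrite H0 sqmod0.
have := le_normsq xi; rewrite n0 lee_fin => x0.
suff -> : xi 0 = 0 by move/eqP; rewrite eq_sym oner_eq0.
by apply: sqmod_eq0; apply/eqP; rewrite eq_le x0 sqmod_ge0.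
Qed.

(** The vectors [f + s *: xi] and [f - s *: xi] have the same norm since the supports are disjoint.
    Their images differ by a multiple of [phiA], and with this [s] the second image vanishes at 0,
    so [normsq_phi_ext] applies. *)
Let U_uncovered (f : H) : (forall w, covered w -> f w = 0) -> U f 0 = 0.
Proof.
move=> fc; pose s := U f 0 / U xi 0.
have e w : (f + s *: xi) w = (f - s *: xi) w \/ (f + s *: xi) w = - (f - s *: xi) w.
  rewrite !HD !HN !HZ; have [/fc ->|/xi0 ->] := pselect (covered w).
    by right; rewrite !add0r opprK.
  by left; rewrite mulr0 oppr0.
have sqN (z : R[i]) : sqmod (- z) = sqmod z.
  by case: z => a c; rewrite /sqmod /= !sqrrN.
have En : normsq A (U (f + s *: xi)) = normsq A (U (f - s *: xi)).
  by rewrite !Unorm; apply: eq_esum => c _; have [->|->] := e (crepr c); rewrite ?sqN.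
have U1 : U (f + s *: xi) = U f + U f 0 *: phiA.
  by rewrite UD UZ Uxi scalerA divfK.
have U2 : U (f - s *: xi) = U f - U f 0 *: phiA.
  by rewrite UD -scaleNr UZ Uxi scalerA mulNr divfK // scaleNr.
rewrite U1 U2 in En.
have A0 : inA 0 by apply: lat_0.
apply: (normsq_phi_ext odd_res Asd (f := U f + U f 0 *: phiA)
  (h := U f - U f 0 *: phiA)) => //.
- by rewrite HD HZ phiAT // mulr1 mulr_natl mulr2n.
- by rewrite HD HN HZ phiAT // mulr1 subrr.
- by move=> w Aw; rewrite !HD HN !HZ phiAF // mulr0 oppr0.
Qed.

(** [f1] is the part of [f] on the covered cosets; the rest contributes nothing. [U] turns
    [dlt (y c)] into the translate of [U phiA] by [- crepr c], which lies in [A] and so does not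
    affect the value at 0. *)
Let U_at0 (f : H) : U f 0 = U phiA 0 * \sum_(c <- Q) f (y c).
Proof.
pose f1 : H := \sum_(c <- Q) f (y c) *: dlt (y c).
have -> : f = f1 + (f - f1) by rewrite addrC subrK.
have f1y : \sum_(c <- Q) (f1 + (f - f1)) (y c) = \sum_(c <- Q) f (y c).
  by rewrite [f1 + _]addrC subrK.
rewrite f1y UD HD [X in _ + X]U_uncovered ?addr0; last first.
  move=> w [d dQ Ad]; rewrite HD HN /f1 Hsum.
  under eq_bigr => c _ do rewrite HZ.
  by rewrite (sumdlt (fun c => f (y c)) dQ Ad) -H_dlt // subrr.
rewrite /f1 Usum Hsum mulr_sumr big_seq [RHS]big_seq; apply: eq_bigr => c cQ.
rewrite UZ HZ mulrC; congr (_ * _).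
have Ac : inA (- crepr c).
  by apply: latN; apply: latQ_crepr; move: cQ; rewrite QP inE; apply.
rewrite /dlt Urho rhoE sf0l mulr0 addr0 psi0 mul1r add0r linearN /= (SpVK Sg).
by rewrite H_A.
Qed.

Lemma M_opE (f : H) w : M_op psi beta A g f w = (#|` Q|%:R)^-1 *
  \sum_(c <- Q) psi (2^-1 * beta (crepr c) w) * f ((g^-1)%VF (crepr c + w)).
Proof. by rewrite /M_op fsbig_finite. Qed.

Lemma card_latQ : (#|` Q|%:R : R[i]) != 0.
Proof.
have [c cQ _] := latQ_cover g (lat_0 A).
rewrite pnatr_eq0 cardfs_eq0; apply/eqP => Q0.
by have : c \in Q by [rewrite QP inE]; rewrite Q0 inE.
Qed.

Lemma intertwiner_phi0 : U phiA 0 != 0.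
Proof.
apply/eqP => u0; have [f Uf] := Usurj phiA.
have := U_at0 f; rewrite Uf u0 mul0r phiAT; last exact: lat_0.
by move/eqP; rewrite oner_eq0.
Qed.

Lemma intertwiner_M_op : exists2 c : R[i], c != 0 &
  forall (f : H) w, U f w = c * M_op psi beta A g f w.
Proof.
exists (U phiA 0 * #|` Q|%:R); first
  by rewrite mulf_neq0 ?card_latQ ?intertwiner_phi0.
move=> f w; rewrite M_opE mulrA mulfK ?card_latQ //.
(* A Heisenberg translation moves the evaluation point [w] to 0. *)
have -> : U f w = U (rho ((g^-1)%VF w) 0 f) 0.
  by rewrite Urho (SpVK Sg) rhoE sf0l mulr0 addr0 psi0 mul1r add0r.
rewrite U_at0; congr (_ * _); apply: eq_bigr => c _.
by rewrite rhoE add0r yg linearD.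
Qed.

End Uniqueness.
End Intertwiner.

(** * Generation of the stabilizer of a self-dual lattice by transvections *)

Section LatticeTransvections.
Context (R : realType) (k : fieldType) (F : finFieldType) (K : local_field k F).
Context (psi : add_char R K) (W : vectType k) (beta : symp_form W).
Context (A : lattice K W).
Hypothesis Asd : self_dual psi beta A.
Local Notation inA := (lat_set A).
Local Notation lam := (ach_cond psi).
Local Notation I := (idealO K).
Local Notation pi := (lf_unif K).
Local Notation v := (lf_val K).
Local Notation N := (pi ^ lam).

Definition KA (g : 'End(W)) := Sp beta g /\ forall x, inA (g x) <-> inA x.

Lemma KA_mem g x : KA g -> inA x -> inA (g x). Proof. by move=> [_ gA] /gA. Qed.

Lemma KA1 : KA \1%VF.
Proof. by split=> [|x]; [apply: Sp1|rewrite id_lfunE]. Qed.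

Lemma KAM g h : KA g -> KA h -> KA (g \o h)%VF.
Proof.
move=> [Sg gA] [Sh hA]; split=> [|x]; first exact: SpM.
by rewrite comp_lfunE gA.
Qed.

Lemma KAV g : KA g -> KA (g^-1)%VF.
Proof.
by move=> [Sg gA]; split=> [|x]; [exact: SpV|rewrite -gA (SpVK Sg)].
Qed.

Lemma tvA_mem u a x : inA u -> I (- lam) a -> inA x -> inA (tv beta u a x).
Proof.
move=> Au Ia Ax; rewrite tvE; apply: lat_D => //; apply: lat_Z => //.
by apply/ringO_ideal; rewrite -[0](subrr lam) addrC; apply: idealM => //; apply: (Aideal Asd).
Qed.

Lemma KA_tv u a : inA u -> I (- lam) a -> KA (tv beta u a).
Proof.
move=> Au Ia; split=> [|x]; first exact: Sp_tv.
split; last exact: tvA_mem.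
move/(tvA_mem Au (idealN Ia)); rewrite -tvV (SpK (Sp_tv _ _ _)) //.
Qed.

Lemma N_neq0 : N != 0. Proof. exact: unifXz_neq0. Qed.

Lemma lat_absorb (L : lattice K W) w : exists n : nat, lat_set L (pi ^+ n *: w).
Proof.
have [n nL] : exists n, kadic_ball K 0 n `<=` lat_set L.
  by apply: (@lat_open _ _ _ _ L); apply: lat_0.
pose c i := coord (vbasis {:W}) i w.
pose m := (\sum_i `|n - v (c i)|)%N.
exists m; apply: nL => i /=; rewrite subr0 linearZ /= -/(c i); apply/idealP.
have [->|c0] := eqVneq (c i) 0; first by left; rewrite mulr0.
right; rewrite lf_valM ?expf_neq0 ?lf_unif_neq0 // val_unifX.
have : (`|n - v (c i)| <= m)%N by rewrite /m (bigD1 i) //= leq_addr.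
lia.
Qed.

(** The valuations of [beta w a] for [a] in [A] are bounded below because a multiple of [w] lies in
    [A]. A vector [z] attaining the minimum gives the factor [c = N / beta w z], and self-duality
    puts [c *: w] into [A]. *)
Lemma lat_primitive w : w != 0 -> exists c z,
  [/\ inA (c *: w), inA z & beta (c *: w) z = N].
Proof.
move=> w0.
have [n nA] := lat_absorb A w.
have lb a : inA a -> I (lam - n%:Z) (beta w a).
  move=> Aa; have -> : beta w a = beta (pi ^+ n *: w) a / pi ^+ n.
    by rewrite sfZl mulrC mulKf // expf_neq0 // lf_unif_neq0.
  apply: ideal_div; rewrite ?expf_neq0 ?lf_unif_neq0 ?val_unifX //.
  exact: (Aideal Asd).
have [y wy] : exists y, beta w y != 0.
  apply: contrapT => ex; case/eqP: w0; apply: (sf_nondeg (s := beta)) => y.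
  by apply/eqP; apply: contrapT => /negP wy; apply: ex; exists y.
have [m mA] := lat_absorb A y.
have vn a : inA a -> beta w a != 0 -> lam - n%:Z <= v (beta w a).
  by move=> /lb/idealP [->|//]; rewrite eqxx.
pose P j := `[< exists a, [/\ inA a, beta w a != 0 & v (beta w a) = (lam - n%:Z) + j%:Z] >].
have exP : exists j, P j.
  have ay : beta w (pi ^+ m *: y) != 0.
    by rewrite sfZr mulf_neq0 // expf_neq0 // lf_unif_neq0.
  exists (absz (v (beta w (pi ^+ m *: y)) - (lam - n%:Z))%R); apply/asboolP.
  exists (pi ^+ m *: y); split=> //; have := vn _ mA ay; lia.
case: (ex_minnP exP) => j /asboolP [z [Az wz vz]] jmin.
exists (N / beta w z), z; split=> //; last by rewrite sfZl divfK.
rewrite Asd => a Aa; rewrite sfZl; apply/idealP.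
have [->|wa] := eqVneq (beta w a) 0; first by left; rewrite mulr0.
right; rewrite !lf_valM ?mulf_neq0 ?invr_eq0 ?N_neq0 // valV // val_unifXz vz.
have va := vn a Aa wa.
have /jmin : P (absz (v (beta w a) - (lam - n%:Z))%R).
  by apply/asboolP; exists a; split=> //; lia.
lia.
Qed.

(** Pairings of vectors of [A] are integral multiples of [N]; [un] singles out the unit
    multiples. *)
Definition un x := x != 0 /\ v x = lam.

Lemma unE x : I lam x -> ~ un x -> I (lam + 1) x.
Proof.
move=> /idealP [->|lx] nu; first exact: ideal0.
have [->|x0] := eqVneq x 0; first exact: ideal0.
apply/idealP; right; have : v x <> lam by move=> vx; apply: nu.
lia.
Qed.

Lemma un_N x : I (lam + 1) x -> un (N + x).
Proof.
move=> Ix; have Ix' : I lam x by apply: idealO_le Ix; lia.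
apply: contrapT => /unE H; have /H : I lam (N + x).
  by apply: idealD => //; apply: ideal_unifXz.
move=> /idealD/(_ (idealN Ix)); rewrite addrK => /idealP [/eqP|].
  by rewrite (negPf N_neq0).
rewrite val_unifXz; lia.
Qed.

Lemma unN x : un x -> un (- x).
Proof. by move=> [x0 vx]; split; rewrite ?oppr_eq0 // valN. Qed.

Section TvGeneration.
Variable X : 'End(W) -> Prop.
Hypothesis X1 : X \1%VF.
Hypothesis XT : forall u z a p, inA u -> inA z -> beta u z = N -> I (- lam) a ->
  X p -> X (tv beta u a \o p)%VF.

Let XTV u z a p : inA u -> inA z -> beta u z = N -> I (- lam) a ->
  X (tv beta u a \o p)%VF -> X p.
Proof.
move=> Au Az uz Ia Xp; have -> : p = (tv beta u (- a) \o (tv beta u a \o p))%VF.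
  by rewrite comp_lfunA tvD addNr tv0 comp_lfun1l.
by apply: XT Xp => //; [exact: Az|by []|apply: idealN].
Qed.

Let perp (s : seq W) w := forall x, x \in s -> beta w x = 0.
Let fixes (g : 'End(W)) (s : seq W) := forall x, x \in s -> g x = x.

Let perpB s x y : perp s x -> perp s y -> perp s (x - y).
Proof. by move=> px py w ws; rewrite !sfE px ?py ?subrr. Qed.

Let perpD s x y : perp s x -> perp s y -> perp s (x + y).
Proof. by move=> px py w ws; rewrite !sfE px ?py ?addr0. Qed.

Let tv_perp s x a w : perp s x -> w \in s -> tv beta x a w = w.
Proof. by move=> px ws; rewrite tvE sfC px // oppr0 mulr0 scale0r addr0. Qed.

Let fix_tv s x a q : perp s x -> fixes q s -> fixes (tv beta x a \o q)%VF s.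
Proof. by move=> px fq w ws; rewrite comp_lfunE fq // (tv_perp _ px). Qed.

Let un_inv x : un x -> I (- lam) x^-1.
Proof. by move=> [x0 vx]; apply/idealP; right; rewrite valV // vx. Qed.

(** The transvection along [x - y] with parameter [(beta x y)^-1] sends [x] to [y] and fixes every
    [t] with [beta t x = beta t y]. The hypothesis [un] puts the parameter in the range that
    preserves [A], and a multiple of [y] serves as the partner required by [XT]. *)
Let tv_move s q x y w : inA x -> inA y -> perp s x -> perp s y -> un (beta x y) ->
  fixes q s -> KA q -> q w = x ->
  (forall q', fixes q' s -> KA q' -> q' w = y ->
     (forall t, beta t x = beta t y -> q t = t -> q' t = t) -> X q') -> X q.
Proof.
move=> Ax Ay px py uxy fq Kq qw Hq; have [xy0 vxy] := uxy.
have Axy : inA (x - y) by apply: latB.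
have Az : inA ((N / beta x y) *: y).
  apply: lat_Z => //; right; rewrite lf_valM ?N_neq0 ?invr_eq0 // valV // vxy.
  by rewrite val_unifXz subrr.
have xyz : beta (x - y) ((N / beta x y) *: y) = N.
  by rewrite sfZr sfDl sfNl sf_alt subr0 divfK.
apply: (XTV Axy Az xyz (un_inv uxy)); apply: Hq.
- by apply: fix_tv => //; apply: perpB.
- by apply: KAM => //; apply: KA_tv => //; apply: un_inv.
- rewrite comp_lfunE qw tvE !sfE sf_alt add0r mulrN mulVf // scaleN1r.
  by rewrite opprB addrC subrK.
- move=> t txy qt; rewrite comp_lfunE qt tvE !sfE txy subrr mulr0 scale0r.
  by rewrite addr0.
Qed.

(** The list [s] is built from hyperbolic pairs fixed by [q], and [A] splits into its part
    orthogonal to [s] and its part in the span. Each round adds a pair [u], [z] with [beta u z = N]: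
    first [u] is brought back, then [z]. The partner demanded by [XT] completes the pair on which a
    dilation will act. *)
Lemma KA_gen g : KA g -> X g.
Proof.
have gz q s w : KA q -> fixes q s -> perp s w -> perp s (q w).
  by move=> [Sq _] fq pw x xs; rewrite -[x]fq // Sq pw.
suff H n (s : seq W) : free s -> (\dim {:W} - size s <= n)%N ->
   (forall a, inA a -> exists a0 a1,
      [/\ inA a0, inA a1, a = a0 + a1, perp s a0 & a1 \in << s>>%VS]) ->
   forall q, KA q -> fixes q s -> X q.
  move=> Kg; apply: (H (\dim {:W}) [::]) => //; first exact: nil_free.
    exact: leq_subr.
  by move=> a Aa; exists a, 0; rewrite addr0 mem0v; split=> //; apply: lat_0.
elim: n s => [|n IH] s fs sn dec q Kq fq.
  suff -> : q = \1%VF by [].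
  have sT : << s>>%VS = fullv.
    apply/eqP; rewrite eqEdim subvf /=; move: fs; rewrite /free => /eqP ->.
    by rewrite -subn_eq0 -leqn0.
  apply/lfunP => w; rewrite id_lfunE; have : w \in << s>>%VS by rewrite sT memvf.
  rewrite -{1}[s]/(val (in_tuple s)) => ws.
  rewrite (coord_span ws) linear_sum; apply: eq_bigr => i _.
  by rewrite linearZ /= fq // mem_nth.
have [sT|sT] := leqP (\dim {:W}) (size s).
  by apply: (IH s) => //; rewrite (_ : (_ - _ = 0)%N) //; apply/eqP; rewrite subn_eq0.
have [w0 _ w0s] : exists2 w, w \in fullv & w \notin << s>>%VS.
  apply/subvPn; apply/negP => /dimvS; move: fs; rewrite /free => /eqP ->.
  by rewrite leqNgt sT.
have [m mA] := lat_absorb A w0.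
have pm0 : pi ^+ m != 0 by rewrite expf_neq0 // lf_unif_neq0.
have [a0 [a1 [Aa0 Aa1 Ea pa0 a1s]]] := dec _ mA.
have a00 : a0 != 0.
  apply: contraNneq w0s => a00.
  by move: a1s; rewrite -[a1]add0r -a00 -Ea rpredZeq (negPf pm0).
have [c [z' [Au Az' uz']]] := lat_primitive a00.
set u := c *: a0 in Au uz'.
have pu : perp s u by move=> x xs; rewrite sfZl pa0 ?mulr0.
clearbody u.
have perp_span y : perp s y -> forall x, x \in << s>>%VS -> beta y x = 0.
  move=> py x xs; rewrite -{1}[s]/(val (in_tuple s)) in xs.
  rewrite (coord_span xs) sf_sumr big1 // => i _.
  by rewrite sfZr py ?mulr0 // mem_nth.
have [z [z1 [Az Az1 Ez pz z1s]]] := dec _ Az'.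
have uz : beta u z = N by rewrite -uz' Ez sfDr (perp_span u pu _ z1s) addr0.
have zu : beta z u = - N by rewrite sfC uz.
have unN1 : un N by split; rewrite ?N_neq0 ?val_unifXz.
have claimA q0 : KA q0 -> fixes q0 s -> q0 u = u -> q0 z = z -> X q0.
  move=> K0 f0 qu qz; apply: (IH [:: u, z & s]) => //.
  - rewrite !free_cons fs andbT; apply/andP; split; last first.
      apply/negP => /(perp_span u pu); rewrite uz => /eqP.
      by rewrite (negPf N_neq0).
    apply/negP; rewrite span_cons => /memv_addP [_ /vlineP [d ->] [x xs ux]].
    have := zu; rewrite ux !sfE sf_alt (perp_span z pz _ xs) mulr0 addr0.
    by move/eqP; rewrite eq_sym oppr_eq0 (negPf N_neq0).
  - by move: sn => /=; lia.
  - move=> a Aa; have [b0 [b1 [Ab0 Ab1 Eb pb0 b1s]]] := dec _ Aa.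
    (* Coordinates of [b0] in the plane of [u] and [z]; they are integral because [beta] takes
       values in [N] times the integers on [A]. *)
    pose al := beta b0 z / N; pose ga := beta u b0 / N.
    have Od x : I lam x -> ringO K (x / N).
      move=> Ix; apply/ringO_ideal; rewrite -(subrr lam).
      by apply: ideal_div; rewrite ?N_neq0 ?val_unifXz.
    have Aal : inA (al *: u) by apply: lat_Z => //; apply/Od/(Aideal Asd).
    have Aga : inA (ga *: z) by apply: lat_Z => //; apply/Od/(Aideal Asd).
    have Auz : inA (al *: u + ga *: z) by apply: lat_D.
    exists (b0 - (al *: u + ga *: z)), (b1 + (al *: u + ga *: z)); split.
    + exact: latB.
    + exact: lat_D.
    + by rewrite Eb [b1 + _]addrC addrA subrK.
    + move=> x; rewrite !inE => /or3P [/eqP ->|/eqP ->|xs].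
      * rewrite !sfE sf_alt zu mulr0 add0r mulrN opprK /ga divfK ?N_neq0 //.
        by rewrite [X in X + _]sfC addNr.
      * by rewrite !sfE sf_alt uz mulr0 addr0 /al divfK ?N_neq0 // subrr.
      * by rewrite !sfE pb0 // pu // pz // !mulr0 addr0 subrr.
    + rewrite !span_cons addvA addrC memv_add //.
      by rewrite memv_add // rpredZ // memv_line.
  - by move=> x; rewrite !inE => /or3P [/eqP ->|/eqP ->|/f0].
have claimB q0 : KA q0 -> fixes q0 s -> q0 u = u -> X q0.
  have B1 q1 : KA q1 -> fixes q1 s -> q1 u = u -> un (beta (q1 z) z) -> X q1.
    move=> K1 f1 qu uqz; apply: (tv_move (w := z) (x := q1 z) (y := z) (s := s)) => //.
    - exact: KA_mem.
    - exact: gz.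
    - move=> q2 f2 K2 qz fx; apply: claimA => //; apply: fx => //.
      by rewrite -{1}qu K1.1.
  move=> K0 f0 qu; have [uqz|nu] := pselect (un (beta (q0 z) z)); first exact: B1.
  have qzu : beta (q0 z) u = - N by rewrite -{1}qu K0.1.
  (* This transvection replaces [q0 z] by [q0 z + u], which changes [beta (q0 z) z] by [N] and turns
     a non-unit multiple of [N] into a unit one. *)
  apply: (XTV Au Az uz (idealN (un_inv unN1))); apply: B1.
  - by apply: KAM => //; apply: KA_tv => //; apply/idealN/un_inv.
  - exact: fix_tv.
  - by rewrite comp_lfunE qu tvE sf_alt mulr0 scale0r addr0.
  - rewrite comp_lfunE tvE qzu mulrNN mulVf ?N_neq0 // scale1r sfDl uz addrC.
    by apply: un_N; apply: unE => //; apply: (Aideal Asd) => //; apply: KA_mem.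
have claimC q0 : KA q0 -> fixes q0 s -> un (beta (q0 u) u) -> X q0.
  move=> K0 f0 uqu.
  apply: (tv_move (w := u) (x := q0 u) (y := u) (s := s)) => //.
  - exact: KA_mem.
  - exact: gz.
  - by move=> q2 f2 K2 qu _; apply: claimB.
have [uqu|nu] := pselect (un (beta (q u) u)); first exact: claimC.
(* When [beta (q u) u] is not [un], the vector [q u] reaches [u] through an intermediate [y] that
   pairs well with both; one of [q z], [z], [q z + z] works. *)
have [y [Ay py y1 y2]] : exists y, [/\ inA y, perp s y, un (beta (q u) y) & un (beta y u)].
  have Aqz : inA (q z) by apply: KA_mem.
  have Aqu : inA (q u) by apply: KA_mem.
  have quz : beta (q u) (q z) = N by rewrite Kq.1.
  have [u1|n1] := pselect (un (beta (q z) u)).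
    by exists (q z); split=> //; [apply: gz|rewrite quz].
  have [u2|n2] := pselect (un (beta (q u) z)).
    by exists z; split=> //; rewrite zu; apply: unN.
  exists (q z + z); split; [exact: lat_D|by apply: perpD => //; apply: gz| |].
    by rewrite sfDr quz; apply: un_N; apply: unE => //; apply: (Aideal Asd).
  rewrite sfDl zu -[X in un X]opprK; apply: unN; rewrite opprD opprK addrC.
  by apply: un_N; apply: idealN; apply: unE => //; apply: (Aideal Asd).
apply: (tv_move (w := u) (x := q u) (y := y) (s := s)) => //.
- exact: KA_mem.
- exact: gz.
- by move=> q2 f2 K2 qu _; apply: claimC => //; rewrite qu.
Qed.

End TvGeneration.

End LatticeTransvections.

(** * The metaplectic group *)

Section Metaplectic.
Context (R : realType) (k : fieldType) (F : finFieldType) (K : local_field k F).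
Hypothesis odd_res : 2%N \notin [pchar F].
Context (psi : add_char R K) (W : vectType k) (beta : symp_form W).
Context (A : lattice K W).
Hypothesis Asd : self_dual psi beta A.
Context (Mp : set (pair_type psi beta A)).
Hypothesis MpP : is_metaplectic Mp.
Local Notation inA := (lat_set A).
Local Notation H := (Hilb psi beta A).
Local Notation phiA := (phiA odd_res Asd).
Local Notation KA := (KA beta A).
Local Notation M_op := (M_op psi beta A).

Lemma Mp_hat x : Mp x -> Sp_hat x.
Proof. by case: MpP => -[+ _ _ _] _ _; apply. Qed.

Lemma Mp_mul g U h V : Mp (g, U) -> Mp (h, V) -> Mp ((g \o h)%VF, U \o V).
Proof. by case: MpP => -[_ _ MpM _] _ _ gU hV; apply: (MpM (g, U) (h, V)). Qed.

Lemma Mp_inv g U : Mp (g, U) -> exists V, [/\ Mp ((g^-1)%VF, V),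
  forall f, U (V f) = f & forall f, V (U f) = f].
Proof.
case: MpP => -[sub _ _ MpV] _ _ gU; have [[h V] [hV]] := MpV _ gU.
rewrite /pair_mul /pair_one /= => -[gh UV] [hg VU].
have Sg : Sp beta g by case: (sub _ gU).
have eh : h = (g^-1)%VF.
  apply/lfunP => w; apply: (can_inj (SpK Sg)).
  by rewrite (SpVK Sg) -comp_lfunE gh id_lfunE.
by exists V; rewrite -eh; split=> // f; [apply: (congr1 (@^~ f) UV)|apply: (congr1 (@^~ f) VU)].
Qed.

Lemma Mp_lift g : Sp beta g -> exists U, Mp (g, U).
Proof. by case: MpP => _ + _; apply. Qed.

Lemma Mp_M_op g U : Mp (g, U) -> finite_set (latQ A g) ->
  exists2 c : R[i], c != 0 & forall f w, U f w = c * M_op g f w.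
Proof. by move=> /Mp_hat gU Qf; apply: (intertwiner_M_op odd_res Asd gU Qf). Qed.

Lemma Mp_linear g U : Mp (g, U) -> linear U.
Proof. by move/Mp_hat => [_ []]. Qed.

Lemma Mp_Z g U c f : Mp (g, U) -> U (c *: f) = c *: U f.
Proof.
move=> gU; have L := Mp_linear gU.
have U0 : U 0 = 0.
  by apply: (addrI (U 0)); have := L 1 0 0; rewrite !scale1r !addr0 => <-.
by have := L c f 0; rewrite !addr0 U0 addr0.
Qed.

Lemma inH_M_op g (f : H) : Sp beta g -> finite_set (latQ A g) ->
  (M_op g f : W -> R[i]) \in Hpred psi beta A.
Proof.
move=> Sg Qf; have [U gU] := Mp_lift Sg; have [c c0 Uc] := Mp_M_op gU Qf.
suff -> : M_op g f = c^-1 *: U f by apply: HvalP.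
by apply/funext => w; rewrite HZ Uc mulKf.
Qed.

Definition Mop (g : 'End(W)) (f : H) : H := insubd f (M_op g f).

Lemma MopE g f w : Sp beta g -> finite_set (latQ A g) -> Mop g f w = M_op g f w.
Proof. by move=> Sg Qf; rewrite /Mop /= val_insubd inH_M_op. Qed.

Lemma latQ_KA g : KA g -> finite_set (latQ A g).
Proof.
move=> [Sg gA]; have [c qc _] := latQ_cover g (lat_0 A).
apply: (sub_finite_set (B := [set c])); last exact: finite_set1.
move=> d qd /=; apply: (latQ_inj qd qc).
have Adc : inA (crepr d - crepr c) by apply: latB; apply: latQ_crepr; [exact: qd|exact: qc].
by apply: (latI_of_inv Sg) => //; apply/gA; rewrite (SpVK Sg).
Qed.

Lemma M_op_KA g (f : H) w : KA g -> M_op g f w = f ((g^-1)%VF w).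
Proof.
move=> Kg; have [Sg gA] := Kg; rewrite M_opE; last exact: latQ_KA.
have Q0 := card_latQ R (latQ_KA Kg).
rewrite big_seq (eq_bigr (fun=> f ((g^-1)%VF w))) => [|c].
  by rewrite -big_seq big_const_seq count_predT iter_addr_0 -[X in _ * X]mulr_natl mulKf.
rewrite in_fset_set ?inE; last exact: latQ_KA.
move=> /latQ_crepr Ac; rewrite linearD HE; last by apply/gA; rewrite (SpVK Sg).
rewrite mulrA -ach_D (SpV Sg) (sfC beta w) mulrN subrr psi0 mul1r //.
Qed.

Lemma Mop_KA g (f : H) w : KA g -> Mop g f w = f ((g^-1)%VF w).
Proof. by move=> Kg; rewrite MopE ?M_op_KA //; [case: Kg|exact: latQ_KA]. Qed.

Lemma Mop_KAM g h : KA g -> KA h -> Mop (g \o h)%VF = Mop g \o Mop h.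
Proof.
move=> Kg Kh; apply/funext => f; apply: H_eqP => w /=.
rewrite !Mop_KA //; last exact: KAM.
by rewrite (Sp_invM Kg.1 Kh.1) comp_lfunE.
Qed.

Lemma inv1_lfunE w : ((\1 : 'End(W))^-1)%VF w = w.
Proof. by rewrite -[LHS]id_lfunE (SpVK (Sp1 beta)). Qed.

Lemma Mp_ker U : Mp (\1%VF, U) -> exists2 c : R[i], c != 0 & forall f, U f = c *: f.
Proof.
move=> U1; have [c c0 Uc] := Mp_M_op U1 (latQ_KA (KA1 beta A)).
exists c => // f; apply: H_eqP => w; rewrite Uc M_op_KA; last exact: KA1.
by rewrite HZ inv1_lfunE.
Qed.

Lemma H_scale_inj (c d : R[i]) : (forall f : H, c *: f = d *: f) -> c = d.
Proof.
move/(_ phiA)/(congr1 (fun f : H => f 0)); rewrite !HZ phiAT ?mulr1 //.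
exact: lat_0.
Qed.

(** The kernel has two elements, both scalars by [Mp_ker]. The non-trivial scalar [c] satisfies
    [c * c = 1] or [c * c = c], and [c != 1] leaves only [-1]. *)
Lemma Mp_kerP U : Mp (\1%VF, U) <-> (U = id \/ U = -%R).
Proof.
have M1 : Mp (\1%VF, id) by case: MpP => -[].
have [z [z1 nz M2]] : exists z, [/\ Mp z, z.1 = \1%VF /\ z <> (\1%VF, id) &
   forall y, Mp y -> y.1 = \1%VF -> y = (\1%VF, id) \/ y = z].
  case: MpP => _ _ /eq_cardSP [x [Mx x1] /eq_cardSP [y [[My y1] xy]]].
  move=> c0.
  have H0 t : Mp t -> t.1 = \1%VF -> t = x \/ t = y.
    move=> Mt t1; apply: contrapT => nt; move: c0.
    rewrite II0 card_eq0 => /eqP/seteqP [+ _] => /(_ t); apply; split; last first.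
      by move=> ty; apply: nt; right.
    by split=> // tx; apply: nt; left.
  have [e|e] := H0 (\1%VF, id) M1 erefl.
    exists y; split=> //.
      by split=> // ye; apply: xy; rewrite ye e.
    by move=> t Mt t1; have [->|->] := H0 t Mt t1; [left|right].
  exists x; split=> //.
    by split=> // xe; apply: xy; rewrite xe e.
  by move=> t Mt t1; have [->|->] := H0 t Mt t1; [right|left].
case: z z1 nz M2 => z Z z1 [/= ez nz] M2; subst z.
have [c c0 Zc] := Mp_ker z1.
have ZN : Z = -%R.
  suff cN : c = -1 by apply/funext => f; rewrite Zc cN scaleN1r.
  have ZZ := Mp_mul z1 z1.
  have ZZc f : (Z \o Z) f = (c * c) *: f by rewrite /= !Zc scalerA.
  have cn1 : c != 1.
    by apply/eqP => c1; apply: nz; congr pair; apply/funext => f; rewrite Zc c1 scale1r.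
  have [[_ e]|[_ e]] := M2 _ ZZ (comp_lfun1l _).
    have : c * c = 1.
      by apply: H_scale_inj => f; rewrite -ZZc e scale1r.
    move=> /eqP; rewrite -expr2 -subr_eq0 subr_sqr_1 mulf_eq0 subr_eq0 (negPf cn1).
    by rewrite /= addr_eq0 => /eqP.
  have : c * c = c by apply: H_scale_inj => f; rewrite -ZZc e Zc.
  by move=> /(congr1 (fun x => x / c)); rewrite mulfK // mulfV // => /eqP; rewrite (negPf cn1).
split=> [MU|[->|->]] //; last by rewrite -ZN.
by have [/(congr1 snd) /= ->|/(congr1 snd) /= ->] := M2 _ MU erefl; [left|right].
Qed.

Lemma Mp_opp g U : Mp (g, U) -> Mp (g, -%R \o U).
Proof.
move=> gU; have N1 : Mp (\1%VF, -%R) by apply/Mp_kerP; right.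
by have := Mp_mul N1 gU; rewrite comp_lfun1l.
Qed.

Lemma Mp_uniq g U U' : Mp (g, U) -> Mp (g, U') -> U' = U \/ U' = -%R \o U.
Proof.
move=> gU gU'; have [V [gV UV VU]] := Mp_inv gU.
have Sg : Sp beta g by case: (Mp_hat gU).
have := Mp_mul gU' gV; rewrite (Sp_compV Sg) => /Mp_kerP [] e; [left|right];
  apply/funext => f; have := congr1 (@^~ (U f)) e; rewrite /= VU //.
Qed.

(** The commutator of a lift [V] of [h] with a lift [U] of [g] does not depend on the lifts. Its
    scalar is read off at [V phiA], whose value at 0 is non-zero: [U phiA] is a multiple of [phiA],
    and [Mop g'] does not change values at 0. *)
Lemma Mop_fusion g g' h : KA g -> KA g' -> Sp beta h -> finite_set (latQ A h) ->
  (h \o g)%VF = (g' \o h)%VF -> Mp ((g' \o g^-1)%VF, Mop (g' \o g^-1)%VF).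
Proof.
move=> Kg Kg' Sh Qh hg.
have [U gU] := Mp_lift Kg.1; have [V hV] := Mp_lift Sh.
have [V' [hV' VV' V'V]] := Mp_inv hV; have [U' [gU' UU' U'U]] := Mp_inv gU.
have [c c0 Uc] := Mp_M_op gU (latQ_KA Kg).
have M1 : Mp (g', V \o (U \o V')).
  have := Mp_mul hV (Mp_mul gU hV').
  by rewrite comp_lfunA hg -comp_lfunA (Sp_compV Sh) comp_lfun1r.
have [c' c'0 Uc'] := Mp_M_op M1 (latQ_KA Kg').
have V0 : V phiA 0 != 0 by apply: (intertwiner_phi0 odd_res Asd (Mp_hat hV) Qh).
have cc' : c = c'.
  apply: (mulIf V0); have := Uc' (V phiA) 0; rewrite /= V'V.
  have -> : U phiA = c *: phiA.
    apply: H_eqP => w; rewrite Uc M_op_KA // HZ; congr (_ * _).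
    have gw : inA ((g^-1)%VF w) <-> inA w by case: (KAV Kg) => _; apply.
    have [Aw|Aw] := pselect (inA w); first by rewrite !phiAT //; apply/gw.
    by rewrite !phiAF // => /gw.
  by rewrite (Mp_Z _ _ hV) HZ M_op_KA // linear0.
suff -> : Mop (g' \o g^-1)%VF = (V \o (U \o V')) \o U' by apply: Mp_mul.
have KgV := KAV Kg.
apply/funext => f; apply: H_eqP => w; rewrite Mop_KA; last exact: KAM.
have U'E x : U' f x = c^-1 * f (g x).
  have := Uc (U' f) (g x); rewrite UU' M_op_KA // (SpK Kg.1) => ->.
  by rewrite mulKf.
have := Uc' (U' f) w; rewrite -cc' /= => ->; rewrite M_op_KA // U'E mulrA mulfV //.
rewrite mul1r (Sp_invM Kg'.1 KgV.1) comp_lfunE; congr (f _).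
by apply: (can_inj (SpK KgV.1)); rewrite (SpVK KgV.1) (SpK Kg.1).
Qed.

(** The residue of [beta a z / N] determines the class of [a]: when it vanishes, the division by the
    uniformizer in the inverse dilation stays integral. *)
Lemma latQ_dil v z : inA v -> inA z -> beta v z = lf_unif K ^ ach_cond psi ->
  finite_set (latQ A (dil beta v z (lf_unif K))).
Proof.
set N := _ ^ _ => Av Az vz; set h := dil _ _ _ _.
have N0 : N != 0 by apply: unifXz_neq0.
have pi0 := lf_unif_neq0 K.
have Sh : Sp beta h by apply: Sp_dil; rewrite ?vz.
pose phi c := lf_res K (beta (crepr c) z / N).
have OA a x : inA a -> inA x -> ringO K (beta a x / N).
  move=> Aa Ax; apply/ringO_ideal; rewrite -(subrr (ach_cond psi)).
  by apply: ideal_div => //; [rewrite val_unifXz|apply: (Aideal Asd)].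
have inj : {in latQ A h &, injective phi}.
  move=> c d; rewrite !inE => qc qd e.
  have Ac := latQ_crepr qc; have Ad := latQ_crepr qd.
  apply: (latQ_inj qc qd); have Acd : inA (crepr c - crepr d) by apply: latB.
  move: e => /(res_eq (OA _ _ Ac Az) (OA _ _ Ad Az)) I1.
  split=> //; exists (dil beta v z (lf_unif K)^-1 (crepr c - crepr d)); last first.
    by rewrite dilK // vz.
  rewrite dilE vz; apply: lat_D; last first.
    apply: lat_Z => //; apply: ringOM; last exact: OA.
    rewrite invrK; apply: ringOD; last by apply/ringON/ringO1.
    by right; rewrite lf_val_unif.
  apply: lat_D => //; apply: lat_Z => //; rewrite mulrBl mul1r.
  apply: ringOD; last by apply/ringON/OA.
  apply/ringO_ideal; rewrite mulrC sfDl sfNl mulrBl -(subrr 1).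
  by apply: ideal_div => //; rewrite lf_val_unif.
rewrite -(eq_finite_set (inj_card_eq inj)); exact: finite_finset.
Qed.

Lemma Mp_tv v z a : inA v -> inA z -> beta v z = lf_unif K ^ ach_cond psi ->
  idealO K (- ach_cond psi) a -> Mp (tv beta v a, Mop (tv beta v a)).
Proof.
move=> Av Az vz Ia; set pi := lf_unif K.
have pi0 : pi != 0 := lf_unif_neq0 K.
have Opi : ringO K (pi ^+ 2) by right; rewrite val_unifX.
(* [d] is a unit, so [a] can be divided by it, and [tv v a] becomes the commutator of the dilation
   with [tv v (a / d)]. *)
pose d := pi ^+ 2 - 1.
have Od : ringO K d by apply: ringOD => //; apply/ringON/ringO1.
have rd : lf_res K d != 0.
  rewrite lf_resD ?resN ?lf_res1 //; [|exact: ringO1|by apply/ringON/ringO1].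
  suff -> : lf_res K (pi ^+ 2) = 0 by rewrite sub0r oppr_eq0 oner_neq0.
  by apply/res_eq0 => //; apply/idealP; right; rewrite val_unifX.
have [d0 _ Od'] := res_unit Od rd.
have Ia' : idealO K (- ach_cond psi) (a / d) by apply: idealMr.
have -> : tv beta v a = (tv beta v (pi ^+ 2 * (a / d)) \o (tv beta v (a / d))^-1)%VF.
  rewrite tvV tvD -[X in _ - X]mul1r -mulrBl -/d mulrC divfK //.
have vz0 : beta v z != 0 by rewrite vz unifXz_neq0.
apply: (@Mop_fusion _ _ (dil beta v z pi)).
- exact: (KA_tv Asd).
- by apply: (KA_tv Asd) => //; apply: idealMl.
- exact: Sp_dil.
- exact: latQ_dil.
- have Sh := Sp_dil pi0 vz0.
  have := Sp_conj_tv v (a / d) Sh; rewrite dil_fix // tvZ => <-.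
  by rewrite -!comp_lfunA (Sp_Vcomp Sh) comp_lfun1r.
Qed.

Lemma Mp_KA g : KA g -> Mp (g, Mop g).
Proof.
move=> Kg; suff [] : KA g /\ Mp (g, Mop g) by [].
apply: (KA_gen Asd (X := fun g => KA g /\ Mp (g, Mop g))) => //.
  split; first exact: KA1.
  suff -> : Mop \1%VF = id by apply/Mp_kerP; left.
  apply/funext => f; apply: H_eqP => w; rewrite Mop_KA; last exact: KA1.
  by rewrite inv1_lfunE.
move=> u z a p Au Az uz Ia [Kp Mpp]; have Kt := KA_tv Asd Au Ia.
split; first exact: KAM.
by rewrite Mop_KAM //; apply: Mp_mul => //; apply: Mp_tv Az uz Ia.
Qed.

End Metaplectic.

(** * Gauss sums and square classes *)

Section GaussSum.
Context (R : realType) (F : finFieldType) (chi : F -> R[i]).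
Hypothesis F2 : 2 != 0 :> F.
Hypothesis chiD : forall a c, chi (a + c) = chi a * chi c.
Hypothesis chi0 : chi 0 = 1.
Hypothesis chi1 : exists a, chi a != 1.

Lemma chi_sum c : c != 0 -> \sum_t chi (c * t) = 0.
Proof.
move=> c0; have [a ca] := chi1; pose S := \sum_t chi (c * t).
have : S = chi a * S.
  rewrite {1}/S (reindex_inj (addrI (a / c))) mulr_sumr; apply: eq_bigr => t _.
  by rewrite mulrDr chiD [c * (a / c)]mulrC divfK.
move/eqP; rewrite -subr_eq0 -{1}[S]mul1r -mulrBl mulf_eq0 subr_eq0 eq_sym.
by rewrite (negPf ca) => /eqP.
Qed.

Definition gauss a := \sum_(t : F) chi (2^-1 * a * t ^+ 2).

Lemma gauss_sqr a c : c != 0 -> gauss (a * c ^+ 2) = gauss a.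
Proof.
move=> c0; rewrite {2}/gauss (reindex_inj (mulfI c0)); apply: eq_bigr => t _.
by congr chi; rewrite exprMn; ring.
Qed.

Let nsq u := #|[set t : F | t ^+ 2 == u]%SET|.

Let nsq_le2 u : (nsq u <= 2)%N.
Proof.
have [[t0 t0u]|none] := pselect (exists t, t ^+ 2 = u).
  apply: leq_trans (_ : #|[set t0; - t0]%SET| <= 2)%N; last by rewrite cards2; case: eqP.
  apply: subset_leq_card; apply/fintype.subsetP => t.
  by rewrite !inE -t0u eqf_sqr.
rewrite /nsq (_ : [set t | _]%SET = finset.set0) ?cards0 //.
apply/setP => t; rewrite !inE; apply/eqP => tu; apply: none.
by exists t.
Qed.

Let nsq_sum : (\sum_u nsq u = #|F|)%N.
Proof.
rewrite -[RHS]sum1_card [RHS](partition_big (fun t : F => t ^+ 2) xpredT) //=.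
by apply: eq_bigr => u _; rewrite sum1dep_card.
Qed.

Let nsq_gt0 u : (0 < nsq u)%N -> exists t, u = t ^+ 2.
Proof. by rewrite card_gt0 => /set0Pn [t]; rewrite inE => /eqP <-; exists t. Qed.

(* The fibres of squaring over [u] and [u / a] have at most 2 elements in all, and the
   total over all [u] is [2 q], so equality holds throughout. *)
Let nsq_pair (a u : F) : a != 0 -> ~ (exists t, a = t ^+ 2) -> (nsq u + nsq (a^-1 * u)%R = 2)%N.
Proof.
move=> a0 na.
have le2 w : (nsq w + nsq (a^-1 * w)%R <= 2)%N.
  have [w0|w0] := eqVneq w 0.
    have n0 : nsq 0 = 1%N.
      rewrite /nsq (_ : [set t | _]%SET = [set 0]%SET) ?cards1 //.
      by apply/setP => t; rewrite !inE sqrf_eq0.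
    by rewrite w0 mulr0 n0.
  have [/eqP ->|] := boolP (nsq w == 0)%N; first by rewrite nsq_le2.
  rewrite -lt0n => /nsq_gt0 [t wt].
  suff -> : nsq (a^-1 * w) = 0%N by rewrite addn0 nsq_le2.
  apply/eqP; rewrite -leqn0 leqNgt; apply/negP => /nsq_gt0 [s ws].
  apply: na; exists (t / s); rewrite expr_div_n -wt -ws.
  by rewrite invfM invrK mulrCA mulfV // mulr1.
have tot : (\sum_w (nsq w + nsq (a^-1 * w)%R) = \sum_(w : F) 2)%N.
  have a'0 : a^-1 != 0 by rewrite invr_eq0.
  have e : (\sum_w nsq (a^-1 * w)%R = #|F|)%N.
    by rewrite -nsq_sum [RHS](reindex_inj (mulfI a'0)).
  rewrite big_split /= e nsq_sum.
  by rewrite sum_nat_const cardT -cardE muln2 addnn.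
have [_] := leqif_sum (I := F) (P := xpredT) (fun w _ => leqif_eq (le2 w)).
by rewrite tot eqxx => /esym/forallP/(_ u)/eqP.
Qed.

(** Grouped by the values [u = c * t ^ 2] for [c = a] and [c = 1], the two sums have multiplicities
    adding up to 2 by [nsq_pair], so together they are twice a full character sum. *)
Lemma gauss_nonsquare a : a != 0 -> ~ (exists t, a = t ^+ 2) -> gauss a = - gauss 1.
Proof.
move=> a0 na; have a'0 : a^-1 != 0 by rewrite invr_eq0.
have fib c : c != 0 ->
    gauss c = \sum_u chi (2^-1 * u) *+ nsq (c^-1 * u).
  move=> c0; rewrite /gauss (partition_big (fun t : F => c * t ^+ 2) xpredT) //=.
  apply: eq_bigr => u _; rewrite (eq_bigr (fun=> chi (2^-1 * u))).
    rewrite sumr_const; congr (_ *+ _); apply: eq_card => t; rewrite !inE.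
    by rewrite -(inj_eq (mulfI c0)) mulVKf.
  by move=> t /eqP <-; rewrite mulrA.
apply/eqP; rewrite -addr_eq0 fib // fib ?oner_neq0 // -big_split /=; apply/eqP.
rewrite (eq_bigr (fun u => chi (2^-1 * u) *+ 2)) => [|u _].
  by rewrite sumrMnl chi_sum ?mul0rn // invr_eq0.
by rewrite -mulrnDr invr1 mul1r addnC nsq_pair.
Qed.

Lemma nonsquare_mul (a c : F) : a != 0 -> ~ (exists t, a = t ^+ 2) ->
  ~ (exists t, c = t ^+ 2) -> exists t, a * c = t ^+ 2.
Proof.
move=> a0 na nc; have := nsq_pair c a0 na.
have -> : nsq c = 0%N.
  by apply/eqP; rewrite -leqn0 leqNgt; apply/negP => /nsq_gt0.
rewrite add0n => e; have /nsq_gt0 [t act] : (0 < nsq (a^-1 * c)%R)%N by rewrite e.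
by exists (a * t); rewrite exprMn -act expr2 -mulrA mulVKf.
Qed.

(** Each Gauss sum is [gauss 1] up to a sign telling squares from non-squares, and [nonsquare_mul]
    makes this sign multiplicative. *)
Lemma gauss_mul (a c : F) : a != 0 -> c != 0 -> gauss (a * c) * gauss 1 = gauss a * gauss c.
Proof.
have sq x y t : y != 0 -> y = t ^+ 2 -> gauss (x * y) = gauss x.
  move=> y0 yt; rewrite yt gauss_sqr //; apply: contraNneq y0 => t0.
  by rewrite yt t0 expr0n.
have sq1 y t : y != 0 -> y = t ^+ 2 -> gauss y = gauss 1.
  by move=> y0 yt; rewrite -[y]mul1r; apply: sq yt.
move=> a0 c0; have [[t ct]|nc] := pselect (exists t, c = t ^+ 2).
  by rewrite (sq a c t) // (sq1 c t).
have [[t at_]|na] := pselect (exists t, a = t ^+ 2).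
  by rewrite mulrC [a * c]mulrC (sq c a t) // (sq1 a t).
have [t act] := nonsquare_mul a0 na nc.
rewrite (sq1 (a * c) t) ?mulf_neq0 //.
by rewrite (gauss_nonsquare a0 na) (gauss_nonsquare c0 nc) mulrNN.
Qed.

Lemma gauss1_neq0 : gauss 1 != 0.
Proof.
(* Substituting [t + d] for one variable leaves [chi (d ^ 2 / 2 + d * t)], and the sum over [t]
   kills every [d != 0]. *)
suff E : gauss 1 * gauss (-1) = #|F|%:R.
  apply/eqP => g0; move: E; rewrite g0 mul0r => /esym/eqP.
  rewrite pnatr_eq0; apply/negP; rewrite -lt0n; apply/card_gt0P.
  by exists 0.
have -> : gauss 1 * gauss (-1) =
   \sum_d chi (2^-1 * d ^+ 2) * \sum_t chi (d * t).
  rewrite /gauss mulr_sumr.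
  under eq_bigr => t _ do rewrite mulr_suml (reindex_inj (addIr t)).
  rewrite exchange_big; apply: eq_bigr => d _; rewrite mulr_sumr.
  apply: eq_bigr => t _; rewrite -!chiD; congr chi.
  by field.
rewrite (bigD1 0) //= expr0n mulr0 chi0 mul1r.
rewrite (eq_bigr (fun=> 1)) => [|t _]; last by rewrite mul0r chi0.
rewrite sumr_const big1 ?addr0 // => d d0.
by rewrite chi_sum // mulr0.
Qed.

End GaussSum.

Section SquareClass.
Context (F : finFieldType).
Local Notation Sq := (<<unit_squares F>>%g).

Lemma unitM_val (u v : {unit F}) :
  FinRing.uval (u * v)%g = FinRing.uval u * FinRing.uval v.
Proof. by []. Qed.

Lemma mem_squares (u : {unit F}) : u \in Sq ->
  exists2 t : F, t != 0 & FinRing.uval u = t ^+ 2.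
Proof.
have cm (x y : {unit F}) : (x * y = y * x)%g by apply: val_inj; apply: mulrC.
rewrite gen_set_id; last first.
  apply/group_setP; split.
    by apply/imsetP; exists 1%g; rewrite ?inE // expg1n.
  move=> _ _ /imsetP [x _ ->] /imsetP [y _ ->]; apply/imsetP; exists (x * y)%g => //.
  by rewrite expgMn.
case/imsetP => x _ ->; exists (FinRing.uval x); first by rewrite -unitfE (valP x).
by [].
Qed.

Lemma norm_squares (u : {unit F}) : u \in ('N(Sq))%g.
Proof.
apply: (fintype.subsetP (cent_sub _)); apply/centP => v _.
by apply: val_inj; apply: mulrC.
Qed.

(** [omega_class] evaluates [omega] at the chosen representative; this one differs from [u] by a
    square, to which Gauss sums are insensitive. *)
Lemma repr_sq_class (u : {unit F}) : exists2 t : F, t != 0 &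
  FinRing.uval (repr (coset Sq u)) = FinRing.uval u * t ^+ 2.
Proof.
have : repr (coset Sq u) \in (Sq :* u)%g.
  by rewrite -(val_coset (norm_squares u)) mem_repr_coset.
case/rcosetP => h /mem_squares [t t0 ht] ->; exists t => //.
by rewrite unitM_val ht mulrC.
Qed.

Lemma uval_neq0 (u : {unit F}) : FinRing.uval u != 0.
Proof. by rewrite -unitfE (valP u). Qed.

End SquareClass.

(** * The quotient [b] and the splitting over the stabilizer of [B] *)

Section QuotientSpace.
Context (R : realType) (k : fieldType) (F : finFieldType) (K : local_field k F).
Hypothesis odd_res : 2%N \notin [pchar F].
Context (psi : add_char R K) (W : vectType k) (beta : symp_form W).
Context (B : lattice K W).
Hypothesis B_good : good_lattice psi beta B.
Context (A : lattice K W).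
Hypothesis Asd : self_dual psi beta A.
Local Notation inA := (lat_set A).
Local Notation inB := (lat_set B).
Local Notation Bs := (dual_lat psi beta B).
Hypothesis BA : inB `<=` inA.
Hypothesis AB : inA `<=` Bs.
Context (b : vectType F) (pr : quot_space K Bs B b).
Local Notation lam := (ach_cond psi).
Local Notation I := (idealO K).
Local Notation pi := (lf_unif K).
Local Notation res := (lf_res K).
Local Notation bb := (beta_b pr).

(** * The dual lattice, the form on [b] and the Lagrangian *)

Lemma Bs_D v w : Bs v -> Bs w -> Bs (v + w).
Proof. by move=> Bv Bw x Bx; rewrite sfDl; apply: idealD; [apply: Bv|apply: Bw]. Qed.

Lemma Bs_Z a v : ringO K a -> Bs v -> Bs (a *: v).
Proof. by move=> Oa Bv x Bx; rewrite sfZl; apply: idealMl => //; apply: Bv. Qed.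

Lemma Bs_N v : Bs v -> Bs (- v).
Proof. by rewrite -scaleN1r; apply: Bs_Z; apply/ringON/ringO1. Qed.

Lemma Bs_B v w : Bs v -> Bs w -> Bs (v - w).
Proof. by move=> Bv Bw; apply: Bs_D => //; apply: Bs_N. Qed.

Lemma B_Bs v : inB v -> Bs v. Proof. by case: B_good => _; apply. Qed.

Lemma Bs_0 : Bs 0. Proof. by apply: B_Bs; apply: lat_0. Qed.

Lemma Bs_sum (T : Type) (s : seq T) (f : T -> W) :
  (forall i, Bs (f i)) -> Bs (\sum_(i <- s) f i).
Proof. by move=> Bf; elim/big_ind: _ => //; [exact: Bs_0|exact: Bs_D]. Qed.

(** The inclusion of [pi *: Bs] in [B] costs one power of the uniformizer. *)
Lemma ideal_BsBs v w : Bs v -> Bs w -> I (lam - 1) (beta v w).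
Proof.
move=> Bv Bw; have Bpw : inB (pi *: w).
  by case: B_good => + _; apply; exists w.
have := Bv _ Bpw; rewrite sfZr => Iw.
have -> : beta v w = pi * beta v w / pi by rewrite mulrC mulKf // lf_unif_neq0.
by apply: ideal_div => //; [apply: lf_unif_neq0|apply: lf_val_unif].
Qed.

Lemma pr0 : pr 0 = 0.
Proof. by apply/(qs_ker pr Bs_0); apply: lat_0. Qed.

Lemma prN v : Bs v -> pr (- v) = - pr v.
Proof.
move=> Bv; apply/eqP; rewrite -addr_eq0 -qs_D ?addNr ?pr0 //; exact: Bs_N.
Qed.

Lemma prB v w : Bs v -> Bs w -> pr (v - w) = pr v - pr w.
Proof. by move=> Bv Bw; rewrite qs_D ?prN //; apply: Bs_N. Qed.

Lemma pr_sum (T : Type) (s : seq T) (f : T -> W) :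
  (forall i, Bs (f i)) -> pr (\sum_(i <- s) f i) = \sum_(i <- s) pr (f i).
Proof.
move=> Bf; elim: s => [|i s IH]; first by rewrite !big_nil pr0.
by rewrite !big_cons qs_D ?IH //; apply: Bs_sum.
Qed.

Lemma pr_eq v w : Bs v -> Bs w -> (pr v = pr w <-> inB (v - w)).
Proof.
move=> Bv Bw; rewrite -(qs_ker pr); last exact: Bs_B.
by rewrite prB //; split=> [->|/eqP]; rewrite ?subrr // subr_eq0 => /eqP.
Qed.

Lemma lift_bP x : Bs (lift_b pr x) /\ pr (lift_b pr x) = x.
Proof.
rewrite /lift_b; case: xgetP => [v _ //|H].
by have [v Bv pv] := qs_surj pr x; case: (H v).
Qed.

Definition sc v w := pi ^ (1 - lam) * beta v w.

Lemma O_sc v w : Bs v -> Bs w -> ringO K (sc v w).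
Proof.
move=> Bv Bw; apply/ringO_ideal; have := idealM (ideal_unifXz K (1 - lam)) (ideal_BsBs Bv Bw).
by apply: idealO_le; lia.
Qed.

Lemma sc_B v w : Bs v -> inB w -> I 1 (sc v w).
Proof.
move=> Bv Bw; have := idealM (ideal_unifXz K (1 - lam)) (Bv _ Bw).
by apply: idealO_le; lia.
Qed.

(** Independence of the chosen lifts: a change by an element of [B] alters [sc] by an element of the
    maximal ideal. *)
Lemma bbE v w : Bs v -> Bs w -> bb (pr v) (pr w) = res (sc v w).
Proof.
move=> Bv Bw; rewrite /beta_b.
have [Bv' pv] := lift_bP (pr v); have [Bw' pw] := lift_bP (pr w).
apply/(res_eq (O_sc Bv' Bw') (O_sc Bv Bw)).
move/(pr_eq Bv' Bv): pv; move/(pr_eq Bw' Bw): pw.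
move: (lift_b pr (pr v)) (lift_b pr (pr w)) Bv' Bw' => v' w' Bv' Bw' Iw Iv.
rewrite -/(sc v' w').
have -> : sc v' w' - sc v w = sc v' (w' - w) - sc w (v' - v).
  by rewrite /sc !sfE (sfC beta w v') (sfC beta w v); ring.
by apply: idealD; [|apply: idealN]; apply: sc_B.
Qed.

Lemma bb_linl y : scalar (bb ^~ y).
Proof.
move=> a x x'; have [Bv <-] := lift_bP x; have [Bv' <-] := lift_bP x'.
have [Bw <-] := lift_bP y; have [Oa <-] := lift_resP K a.
move: (lift_b pr x) (lift_b pr x') (lift_b pr y) (lift_res K a) Bv Bv' Bw Oa.
move=> v v' w c Bv Bv' Bw Oc; have Bcv : Bs (c *: v) by apply: Bs_Z.
have Bs' : Bs (c *: v + v') by apply: Bs_D.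
rewrite -qs_Z // -qs_D //= !bbE //.
have -> : sc (c *: v + v') w = c * sc v w + sc v' w.
  by rewrite /sc !sfE; ring.
have O1 := O_sc Bv Bw; have O2 := O_sc Bv' Bw.
rewrite lf_resD //; last exact: ringOM.
by rewrite (@lf_resM _ _ K _ _ Oc O1).
Qed.

Lemma bb_alt x : bb x x = 0.
Proof.
by have [Bv <-] := lift_bP x; rewrite bbE // /sc sf_alt mulr0 res0.
Qed.

Lemma bbC x y : bb x y = - bb y x.
Proof.
have [Bv <-] := lift_bP x; have [Bw <-] := lift_bP y; rewrite !bbE //.
rewrite -resN; last exact: O_sc.
by congr res; rewrite /sc sfC mulrN.
Qed.

Lemma bb_linr x : scalar (bb x).
Proof. by move=> a y y'; rewrite bbC bb_linl opprD -mulrN -!bbC. Qed.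

Context (l : nat) (eps phi : 'I_l -> b).
Hypothesis basis_b : is_symp_basis A pr eps phi.

Lemma bb_nondeg x : (forall y, bb x y = 0) -> x = 0.
Proof.
case: basis_b => bas _ bee bpp bep xy.
have l0 y : bb 0 y = 0.
  have := bb_linl y 1 0 0; rewrite scaler0 addr0 mul1r => e.
  by apply: (addrI (bb 0 y)); rewrite -e addr0.
have suml (f : 'I_l -> b) (c : 'I_l -> F) y :
    bb (\sum_i c i *: f i) y = \sum_i c i * bb (f i) y.
  elim/big_rec2: _ => [|i z w _ <-]; first exact: l0.
  exact: bb_linl.
have : x \in <<codom eps ++ codom phi>>%VS by rewrite (span_basis bas) memvf.
rewrite span_cat => /memv_addP [_ /span_codomP [a ->]] [_ /span_codomP [c ->] E].
have add u v y : bb (u + v) y = bb u y + bb v y.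
  by have := bb_linl y 1 u v; rewrite scale1r mul1r.
have a0 j : a j = 0.
  have := xy (phi j); rewrite E add !suml.
  rewrite (eq_bigr (fun i => a i * (i == j)%:R)) => [|i _]; last by rewrite bep.
  by rewrite sum_deltal big1 ?addr0 // => i _; rewrite bpp mulr0.
have c0 j : c j = 0.
  have := xy (eps j); rewrite E add !suml big1 ?add0r => [|i _]; last by rewrite bee mulr0.
  rewrite (eq_bigr (fun i => - c i * (i == j)%:R)) => [|i _].
    by rewrite (sum_deltal (fun i => - c i)) => /eqP; rewrite oppr_eq0 => /eqP.
  by rewrite bbC bep mulrN mulNr eq_sym.
by rewrite E !big1 ?addr0 // => i _; rewrite ?a0 ?c0 scale0r.
Qed.

Definition bform : symp_form b := SympForm bb_linl bb_linr bb_alt bb_nondeg.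

Lemma bas_b : basis_of {:b} (codom eps ++ codom phi). Proof. by case: basis_b. Qed.
Lemma bas_X : <<codom eps>>%VS = x_space A pr. Proof. by case: basis_b. Qed.
Lemma bas_ee i j : bform (eps i) (eps j) = 0. Proof. by case: basis_b => [_ _ + _ _]; apply. Qed.
Lemma bas_pp i j : bform (phi i) (phi j) = 0. Proof. by case: basis_b => [_ _ _ + _]; apply. Qed.
Lemma bas_ep i j : bform (eps i) (phi j) = (i == j)%:R. Proof. by case: basis_b => [_ _ _ _]; apply. Qed.

Local Notation X := (x_space A pr).

(** [x_space] is chosen by [xget], so a subspace with this underlying set must be exhibited. A
    subspace of maximal dimension inside the image of [A] is the whole image, since the line of any
    further [pr a] could be added. *)
Lemma x_spaceP x : x \in X <-> exists2 a, inA a & pr a = x.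
Proof.
suff [U0 U0P] : exists U : {vspace b}, [set` U] = [set pr a | a in inA].
  rewrite /x_space; case: xgetP => [U _ /= UP|/(_ U0) //].
  by change ([set` U] x <-> exists2 a, inA a & pr a = x); rewrite UP; split=> -[a]; exists a.
pose P n := `[< exists2 U : {vspace b}, [set` U] `<=` [set pr a | a in inA] & \dim U = n >].
have exP : exists n, P n.
  exists 0%N; apply/asboolP; exists 0%VS; last exact: dimv0.
  by move=> y /=; rewrite memv0 => /eqP ->; exists 0; [apply: lat_0|apply: pr0].
have ubP n : P n -> (n <= \dim {:b})%N.
  by move=> /asboolP [U _ <-]; apply: dimvS; apply: subvf.
case: (ex_maxnP exP ubP) => n /asboolP [U UP dU] nmax.
exists U; apply/seteqP; split=> // _ [a Aa <-] /=.
apply/negPn/negP => aU.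
have : P (\dim (U + <[pr a]>)).
  apply/asboolP; exists (U + <[pr a]>)%VS => //.
  move=> _ /= /memv_addP [u /UP [a' Aa' <-]] [_ /vlineP [c ->] ->].
  have [Oc <-] := lift_resP K c; set d := lift_res K c in Oc *.
  have Ada : inA (d *: a) by apply: lat_Z.
  exists (a' + d *: a); first exact: lat_D.
  by rewrite qs_D ?qs_Z //; apply: AB.
move/nmax; rewrite -dU leqNgt => /negP; apply.
rewrite ltn_neqAle dimvS ?addvSl // andbT; apply: contraNneq aU => e.
have -> : U = (U + <[pr a]>)%VS by apply/eqP; rewrite eqEdim addvSl -e leqnn.
by apply: (subvP (addvSr _ _)); apply: memv_line.
Qed.

Lemma pr_A a : inA a -> pr a \in X.
Proof. by move=> Aa; apply/x_spaceP; exists a. Qed.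

Lemma pr_memX v : Bs v -> pr v \in X -> inA v.
Proof.
move=> Bv /x_spaceP [a Aa /esym/(pr_eq Bv (AB Aa)) Bva].
by rewrite -(subrK a v); apply: lat_D => //; apply: BA.
Qed.

(** * Reduction of the stabilizer of [B] *)

Section KBelements.
Implicit Types g h : 'End(W).
Local Notation KBg := (KB beta B).

Lemma KB_Sp g : KBg g -> Sp beta g. Proof. by case. Qed.

Lemma KB_B g v : KBg g -> (inB (g v) <-> inB v).
Proof.
move=> [Sg gB]; split=> [|Bv]; last by rewrite -gB; exists v.
by rewrite -{1}gB => -[w Bw /(can_inj (SpK Sg)) <-].
Qed.

Lemma KB_I g : Sp beta g -> (forall v, inB (g v) <-> inB v) -> KBg g.
Proof.
move=> Sg gB; split=> //; apply/seteqP; split=> [_ [v Bv <-]|v Bv]; first exact/gB.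
by exists ((g^-1)%VF v); rewrite ?(SpVK Sg) //; apply/gB; rewrite (SpVK Sg).
Qed.

Lemma KB_Bs g v : KBg g -> (Bs (g v) <-> Bs v).
Proof.
move=> Kg; have Sg := KB_Sp Kg; split=> Bv x Bx.
  by rewrite -Sg; apply: Bv; apply/(KB_B _ Kg).
rewrite -[x](SpVK Sg) Sg; apply: Bv; apply/(KB_B _ Kg).
by rewrite (SpVK Sg).
Qed.

Lemma KB1 : KBg \1%VF.
Proof. by apply: KB_I => [|v]; [apply: Sp1|rewrite id_lfunE]. Qed.

Lemma KBM g h : KBg g -> KBg h -> KBg (g \o h)%VF.
Proof.
move=> Kg Kh; apply: KB_I => [|v]; first by apply: SpM; apply: KB_Sp.
by rewrite comp_lfunE (KB_B _ Kg) (KB_B _ Kh).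
Qed.

Lemma KBV g : KBg g -> KBg (g^-1)%VF.
Proof.
move=> Kg; have Sg := KB_Sp Kg; apply: KB_I => [|v]; first exact: SpV.
by rewrite -(KB_B _ Kg) (SpVK Sg).
Qed.

(** The induced linear map is constructed here, so that [p_Sp] never takes its default value on the
    stabilizer of [B]. *)
Lemma p_SpE g v : KBg g -> Bs v -> p_Sp pr g (pr v) = pr (g v).
Proof.
move=> Kg; have gBs w : Bs w -> Bs (g w) by move/(KB_Bs _ Kg).
pose h0 x := pr (g (lift_b pr x)).
have h0E w : Bs w -> h0 (pr w) = pr (g w).
  move=> Bw; rewrite /h0; have [Bl pl] := lift_bP (pr w).
  apply/pr_eq; [exact: gBs|exact: gBs|].
  rewrite -linearB; apply/(KB_B _ Kg); exact/(pr_eq Bl Bw).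
have h0L : linear h0.
  move=> a x y; have [Bx <-] := lift_bP x; have [By <-] := lift_bP y.
  have [Oa <-] := lift_resP K a.
  move: (lift_b pr x) (lift_b pr y) (lift_res K a) Bx By Oa => v1 v2 c B1 B2 Oc.
  have Bc : Bs (c *: v1) by apply: Bs_Z.
  rewrite -qs_Z // -qs_D // !h0E //; last exact: Bs_D.
  rewrite linearD linearZ /= qs_D ?qs_Z //; first exact: gBs.
    by apply: Bs_Z => //; apply: gBs.
  exact: gBs.
pose h1 : 'End(b) := linfun (HB.pack_for {linear b -> b} h0 (GRing.isLinear.Build F b b *:%R h0 h0L)).
have h1E w : Bs w -> h1 (pr w) = pr (g w) by move=> Bw; rewrite lfunE /= h0E.
by rewrite /p_Sp; case: xgetP => [h _ /= hP|/(_ h1) /(_ h1E) //]; apply: hP.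
Qed.

Lemma p_Sp_uniq g (h : 'End(b)) : KBg g ->
  (forall v, Bs v -> h (pr v) = pr (g v)) -> p_Sp pr g = h.
Proof.
move=> Kg hE; apply/lfunP => x; have [Bv <-] := lift_bP x.
by rewrite p_SpE ?hE.
Qed.

Lemma p_SpM g h : KBg g -> KBg h -> p_Sp pr (g \o h)%VF = (p_Sp pr g \o p_Sp pr h)%VF.
Proof.
move=> Kg Kh; apply: p_Sp_uniq => [|v Bv]; first exact: KBM.
by rewrite !comp_lfunE !p_SpE //; apply/KB_Bs.
Qed.

Lemma p_Sp1 : p_Sp pr \1%VF = \1%VF.
Proof. by apply: p_Sp_uniq => [|v Bv]; [apply: KB1|rewrite !id_lfunE]. Qed.

Lemma Sp_p_Sp g : KBg g -> Sp bform (p_Sp pr g).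
Proof.
move=> Kg x y; have [Bx <-] := lift_bP x; have [By <-] := lift_bP y.
rewrite /= !p_SpE // !bbE //; [|by apply/KB_Bs..].
by rewrite /sc (KB_Sp Kg).
Qed.

Lemma p_SpV g : KBg g -> p_Sp pr (g^-1)%VF = ((p_Sp pr g)^-1)%VF.
Proof.
move=> Kg; have S := Sp_p_Sp Kg; apply/lfunP => x.
apply: (can_inj (SpK S)); rewrite (SpVK S) -comp_lfunE -p_SpM //; last exact: KBV.
by rewrite (Sp_compV (KB_Sp Kg)) p_Sp1 id_lfunE.
Qed.

Lemma KB_KA g : KBg g -> (p_Sp pr g @: X)%VS = X -> KA beta A g.
Proof.
move=> Kg gX; have Sg := KB_Sp Kg; split=> // v.
split=> Av.
  have Bv : Bs v by apply/(KB_Bs _ Kg); apply: AB.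
  apply: pr_memX => //; have : pr (g v) \in X by apply: pr_A.
  rewrite -p_SpE // -{1}gX => /memv_imgP [y yX e].
  by rewrite (can_inj (SpK (Sp_p_Sp Kg)) e).
apply: pr_memX; first by apply/(KB_Bs _ Kg); apply: AB.
have Bv : Bs v by apply: AB.
by rewrite -p_SpE // -gX memv_img // pr_A.
Qed.

Lemma KA_Pst g : KBg g -> KA beta A g -> (p_Sp pr g @: X)%VS = X.
Proof.
move=> Kg Ag; apply/eqP; rewrite eqEdim (Sp_limg_dim _ (Sp_p_Sp Kg)) leqnn andbT.
apply/subvP => _ /memv_imgP [_ /x_spaceP [a Aa <-] ->].
have Ba : Bs a by apply: AB.
by rewrite p_SpE //; apply: pr_A; apply: (KA_mem Ag).
Qed.

(** The factor [pi ^ (1 - lam)] is the one in [beta_b], so that the reduction is a transvection with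
    parameter [res a]. *)
Definition tvb v a : 'End(W) := tv beta v (a * pi ^ (1 - lam)).

Lemma KB_tvb v a : Bs v -> ringO K a -> KBg (tvb v a).
Proof.
have mem a0 x : Bs v -> ringO K a0 -> inB x -> inB (tvb v a0 x).
  move=> Bv Oa Bx; rewrite tvE; apply: lat_D => //.
  have [y Oy ->] : exists2 y, ringO K y & a0 * pi ^ (1 - lam) * beta x v = y * pi.
    have : I 1 (a0 * sc x v).
      apply: idealMl => //; rewrite /sc sfC mulrN; apply: idealN; exact: sc_B.
    by case=> y Oy; rewrite expr1z /sc mulrA mulrC => e; exists y.
  rewrite -scalerA; apply: lat_Z => //.
  by case: B_good => + _; apply; exists v.
move=> Bv Oa; apply: KB_I => [|x]; first exact: Sp_tv.
split; last exact: mem.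
move/(mem (- a) _ Bv (ringON Oa)); rewrite /tvb mulNr -tvV (SpK (Sp_tv _ _ _)) //.
Qed.

Lemma p_Sp_tvb v a : Bs v -> ringO K a ->
  p_Sp pr (tvb v a) = tv bform (pr v) (res a).
Proof.
move=> Bv Oa; apply: p_Sp_uniq => [|w Bw]; first exact: KB_tvb.
have Oc : ringO K (a * sc w v) by apply: ringOM => //; apply: O_sc.
rewrite !tvE /= bbE // -mulrA qs_D //; last by apply: Bs_Z.
by rewrite qs_Z // (@lf_resM _ _ K _ _ Oa (O_sc Bw Bv)).
Qed.

End KBelements.

(** * The residual character *)

Lemma psibar_res x : ringO K x -> psi (pi ^ (lam - 1) * x) = psibar psi (res x).
Proof.
move=> Ox; have [Ol rl] := lift_resP K (res x); apply: psi_congr.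
rewrite -mulrBr; have /(res_eq Ox Ol) Ix : res x = res (lift_res K (res x)) by [].
by have := idealM (ideal_unifXz K (lam - 1)) Ix; apply: idealO_le; lia.
Qed.

Lemma psibarD a c : psibar psi (a + c) = psibar psi a * psibar psi c.
Proof.
have [Oa <-] := lift_resP K a; have [Oc <-] := lift_resP K c.
rewrite -lf_resD // -!psibar_res //; last exact: ringOD.
by rewrite -ach_D mulrDr.
Qed.

Lemma psibar0 : psibar psi 0 = 1.
Proof. by rewrite -(res0 K) -psibar_res ?mulr0 ?psi0 //; apply: ringO0. Qed.

Lemma psibar_ntriv : exists a, psibar psi a != 1.
Proof.
have [x [y Oy <-] px] := ach_cond_ntriv psi.
by exists (res y); rewrite -psibar_res //; apply/eqP.
Qed.

Lemma psi_half v w : Bs v -> Bs w ->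
  psi (2^-1 * beta v w) = psibar psi (2^-1 * bb (pr v) (pr w)).
Proof.
move=> Bv Bw; rewrite bbE // -(res_half K odd_res).
rewrite -(@lf_resM _ _ K _ _ (ringO_half K odd_res) (O_sc Bv Bw)).
rewrite -psibar_res; last by apply: ringOM; [apply: ringO_half|apply: O_sc].
congr (psi _); rewrite /sc mulrCA [X in _ = _ * X]mulrA.
rewrite -expfzDr ?lf_unif_neq0 //.
have -> : lam - 1 + (1 - lam) = 0 by ring.
by rewrite expr0z mul1r.
Qed.


(** * Coordinates on [A / B] and on [Bs / A] *)

Lemma F2b : 2 != 0 :> F. Proof. exact: F2_neq0. Qed.

Local Notation T := {ffun 'I_l -> F}.
Local Notation memXb := (memXP bas_b bas_ee bas_pp bas_ep).

Lemma eps_X i : eps i \in X.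
Proof. by rewrite -bas_X mem_eps. Qed.

Definition le i : W := xget 0 [set a | inA a /\ pr a = eps i].
Definition lf i : W := lift_b pr (phi i).

Lemma leP i : inA (le i) /\ pr (le i) = eps i.
Proof.
rewrite /le; case: xgetP => [v _ //|H].
by have /x_spaceP [a Aa pa] := eps_X i; case: (H a).
Qed.

Lemma lfP i : Bs (lf i) /\ pr (lf i) = phi i. Proof. exact: lift_bP. Qed.

Definition epsv (c : T) : b := \sum_i c i *: eps i.
Definition phiv (c : T) : b := \sum_i c i *: phi i.
(** Representatives of [A / B] and, for [Fv], of [Bs / A]. Both are additive only modulo [B],
    because [lift_res] is merely a choice of lifts. *)
Definition Ev (c : T) : W := \sum_i lift_res K (c i) *: le i.
Definition Fv (c : T) : W := \sum_i lift_res K (c i) *: lf i.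

Lemma A_sum (I0 : Type) (s : seq I0) (f : I0 -> W) :
  (forall i, inA (f i)) -> inA (\sum_(i <- s) f i).
Proof. by move=> Bf; elim/big_ind: _ => //; [exact: lat_0|exact: lat_D]. Qed.

Lemma A_Ev c : inA (Ev c).
Proof. by apply: A_sum => i; apply: lat_Z; [case: (lift_resP K (c i))|case: (leP i)]. Qed.

Lemma Bs_Ev c : Bs (Ev c). Proof. by apply: AB; apply: A_Ev. Qed.

Lemma Bs_lift_res a v : Bs v -> Bs (lift_res K a *: v).
Proof. by apply: Bs_Z; case: (lift_resP K a). Qed.

Lemma Bs_Fv c : Bs (Fv c).
Proof. by apply: Bs_sum => i; apply: Bs_lift_res; case: (lfP i). Qed.

Lemma pr_lift_res a v : Bs v -> pr (lift_res K a *: v) = a *: pr v.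
Proof. by move=> Bv; have [Oa ra] := lift_resP K a; rewrite qs_Z // ra. Qed.

Lemma pr_Ev c : pr (Ev c) = epsv c.
Proof.
have Ble i : Bs (le i) by apply: AB; case: (leP i).
rewrite pr_sum => [|i]; last exact: Bs_lift_res.
by apply: eq_bigr => i _; rewrite pr_lift_res //; case: (leP i) => _ ->.
Qed.

Lemma pr_Fv c : pr (Fv c) = phiv c.
Proof.
have Blf i : Bs (lf i) by case: (lfP i).
rewrite pr_sum => [|i]; last exact: Bs_lift_res.
by apply: eq_bigr => i _; rewrite pr_lift_res //; case: (lfP i) => _ ->.
Qed.

Lemma epsv_X c : epsv c \in X.
Proof. by apply: rpred_sum => i _; rewrite rpredZ // eps_X. Qed.

Lemma epsvD c d : epsv (c + d) = epsv c + epsv d.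
Proof. by rewrite -big_split; apply: eq_bigr => i _; rewrite ffunE scalerDl. Qed.

Lemma epsv_phi c j : bform (epsv c) (phi j) = c j.
Proof.
rewrite sf_suml (eq_bigr (fun i => c i * (i == j)%:R)) ?sum_deltal // => i _.
by rewrite sfZl bas_ep.
Qed.

Lemma eps_phiv c j : bform (eps j) (phiv c) = c j.
Proof.
rewrite sf_sumr (eq_bigr (fun i => c i * (i == j)%:R)) ?sum_deltal // => i _.
by rewrite sfZr bas_ep eq_sym.
Qed.

Lemma X_epsv x : x \in X -> x = epsv [ffun i => bform x (phi i)].
Proof.
rewrite -bas_X => xX; rewrite {1}(X_expand bas_b bas_ee bas_pp bas_ep xX).
by apply: eq_bigr => i _; rewrite ffunE.
Qed.

Lemma epsv_inj c d : epsv c = epsv d -> c = d.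
Proof. by move=> e; apply/ffunP => i; rewrite -!epsv_phi e. Qed.

Lemma X_iso x y : x \in X -> y \in X -> bform x y = 0.
Proof. by rewrite -bas_X; apply: (X_isotropic bas_b bas_ee bas_pp bas_ep). Qed.

Lemma memX x : reflect (forall i, bform (eps i) x = 0) (x \in X).
Proof. by rewrite -bas_X; apply: memXb. Qed.

Lemma B_latI g : KB beta B g -> inB `<=` latI A g.
Proof.
move=> Kg x Bx; apply: (latI_of_inv (KB_Sp Kg)); first exact: BA.
by apply/BA/(KB_B _ (KBV Kg)).
Qed.

Lemma latQ_KB g : KB beta B g -> finite_set (latQ A g).
Proof.
move=> Kg; pose f c : T := [ffun i => bform (pr (crepr c)) (phi i)].
have inj : {in latQ A g &, injective f}.
  move=> c d; rewrite !inE => qc qd e.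
  have Ac := latQ_crepr qc; have Ad := latQ_crepr qd.
  apply: (latQ_inj qc qd); apply: (B_latI Kg).
  apply/(pr_eq (AB Ac) (AB Ad)).
  by rewrite (X_epsv (pr_A Ac)) (X_epsv (pr_A Ad)) -/(f c) -/(f d) e.
rewrite -(eq_finite_set (inj_card_eq inj)); exact: finite_finset.
Qed.

(** * The operators [M_op] on functions on [b] *)

Local Notation H := (Hilb psi beta A).
Local Notation M_op := (M_op psi beta A).
Local Notation phiA := (phiA odd_res Asd).
Local Notation dlt := (dlt odd_res Asd).

Lemma half_psi1 x : I lam x -> psi (2^-1 * x) = 1.
Proof. by move=> Ix; apply: ach_cond_triv; apply: half_ideal. Qed.

Lemma M_op_term (f : H) g w a a' : Sp beta g -> inA a -> inA a' ->
  latI A g (a - a') ->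
  psi (2^-1 * beta a w) * f ((g^-1)%VF (a + w)) =
  psi (2^-1 * beta a' w) * f ((g^-1)%VF (a' + w)).
Proof.
move=> Sg Aa Aa'; have [d ea] : exists d, a = d + a' by exists (a - a'); rewrite subrK.
rewrite ea addrK => N; have Ad : inA d by case: N.
rewrite -addrA linearD HE; last by apply: latI_inv.
rewrite (SpV Sg) mulrA -ach_D; congr (_ * _); apply: psi_congr.
have -> : 2^-1 * beta (d + a') w + 2^-1 * beta (a' + w) d - 2^-1 * beta a' w
   = 2^-1 * beta a' d.
  by rewrite !sfE (sfC beta w d); ring.
by apply: half_ideal => //; apply: (Aideal Asd).
Qed.

Definition qC : R[i] := #|F|%:R.

Lemma qC_neq0 : qC != 0.
Proof. by rewrite pnatr_eq0 -lt0n; apply/card_gt0P; exists 0. Qed.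

Lemma card_T : (#|T|%:R : R[i]) = qC ^+ l.
Proof. by rewrite card_ffun card_ord natrX. Qed.

(** [B] is contained in [A :&: g A], so the average may be taken over [A / B], where each coset of
    [A :&: g A] is represented the same number [m] of times. The range of summation no longer
    depends on [g]. *)
Lemma M_opT g (f : H) w : KB beta B g -> M_op g f w = qC ^- l *
  \sum_(c : T) psi (2^-1 * beta (Ev c) w) * f ((g^-1)%VF (Ev c + w)).
Proof.
move=> Kg; have Sg := KB_Sp Kg; have Qf := latQ_KB Kg.
rewrite M_opE //; set Q := fset_set _.
have QP c : (c \in Q) = (c \in latQ A g) by rewrite in_fset_set.
pose t a := psi (2^-1 * beta a w) * f ((g^-1)%VF (a + w)).
pose P d c := `[< latI A g (Ev c - crepr d) >].
pose m := #|[set c : T | `[< latI A g (Ev c) >]]%SET|.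
have EvD c d : latI A g (Ev (c + d) - (Ev c + Ev d)).
  apply: (B_latI Kg); apply/pr_eq; [exact: Bs_Ev|by apply: Bs_D; apply: Bs_Ev|].
  by rewrite qs_D ?pr_Ev ?epsvD //; apply: Bs_Ev.
have cnt d : d \in Q -> (\sum_(c | P d c) 1 = m)%N.
  rewrite QP inE => qd; have Ad := latQ_crepr qd.
  pose cd : T := [ffun i => bform (pr (crepr d)) (phi i)].
  have Nd : latI A g (Ev cd - crepr d).
    apply: (B_latI Kg); apply/pr_eq; [exact: Bs_Ev|exact: AB|].
    by rewrite pr_Ev -(X_epsv (pr_A Ad)).
  have Nc c : latI A g (Ev (cd + c) - crepr d - Ev c).
    have -> : Ev (cd + c) - crepr d - Ev c =
        (Ev (cd + c) - (Ev cd + Ev c)) + (Ev cd - crepr d).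
      by rewrite opprD !addrA (addrAC _ (- Ev c) (Ev cd)) subrK addrAC.
    exact: latI_D.
  rewrite (reindex_inj (addrI cd)) sum1dep_card; apply: eq_card => c.
  rewrite !inE /P; apply/asboolP/asboolP => N.
    rewrite -(subKr (Ev (cd + c) - crepr d) (Ev c)).
    by apply: latI_D => //; apply: latI_N.
  by rewrite -(subrK (Ev c) (Ev (cd + c) - crepr d)); apply: latI_D.
have part (G : T -> R[i]) : \sum_c G c = \sum_(d <- Q) \sum_(c | P d c) G c.
  under [RHS]eq_bigr => d _ do rewrite big_mkcond.
  rewrite exchange_big; apply: eq_bigr => c _.
  have [d qd Nd] := latQ_cover g (A_Ev c).
  have dQ : d \in Q by rewrite QP inE.
  have Pd : P d c by apply/asboolP.
  transitivity (\sum_(d' <- Q) if d' == d then G c else 0).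
    by rewrite (bigD1_seq d) ?fset_uniq //= eqxx big1 ?addr0 // => i /negPf ->.
  rewrite big_seq [RHS]big_seq; apply: eq_bigr => d' d'Q; case: eqVneq => [->|dd].
    by rewrite Pd.
  rewrite ifN //; apply/asboolP => Nd'; case/eqP: dd.
  move: d'Q; rewrite QP inE => qd'; apply: (latQ_inj qd' qd).
  have -> : crepr d' - crepr d = (Ev c - crepr d) - (Ev c - crepr d').
    by rewrite opprB [RHS]addrC addrA subrK.
  by apply: latI_D => //; apply: latI_N.
have e1 : qC ^+ l = #|` Q|%:R * m%:R.
  rewrite -card_T -sum1_card natr_sum part.
  rewrite big_seq (eq_bigr (fun=> m%:R)) => [|d dQ].
    by rewrite -big_seq big_const_seq count_predT iter_addr_0 -[LHS]mulr_natl.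
  by rewrite -(cnt d dQ) natr_sum.
have e2 : \sum_c t (Ev c) = m%:R * \sum_(d <- Q) t (crepr d).
  rewrite part mulr_sumr big_seq [RHS]big_seq; apply: eq_bigr => d dQ.
  rewrite (eq_bigr (fun=> t (crepr d))).
    by rewrite -(cnt d dQ) natr_sum mulr_suml; apply: eq_bigr => c _; rewrite mul1r.
  move=> c /asboolP Nd; apply: M_op_term => //; first exact: A_Ev.
  by apply: latQ_crepr; move: dQ; rewrite QP inE; apply.
rewrite -/t e2 e1 invfM mulrA; congr (_ * _).
rewrite -mulrA mulVf ?mulr1 //; apply: contraTneq (expf_neq0 l qC_neq0) => m0.
by rewrite e1 m0 mulr0 eqxx.
Qed.

Lemma H_pr (f : H) v w : Bs v -> Bs w -> pr v = pr w -> f v = f w.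
Proof.
move=> Bv Bw /(pr_eq Bv Bw) Bd; rewrite -(subrK w v) HE; last exact: BA.
by rewrite half_psi1 ?mul1r //; apply: Bw.
Qed.

(** On [Bs] a vector of the model is invariant under [B]; this is the function it induces on [b]. *)
Definition fb (f : H) (x : b) : R[i] := f (lift_b pr x).

Lemma fbE (f : H) v : Bs v -> f v = fb f (pr v).
Proof. by move=> Bv; have [Bl pl] := lift_bP (pr v); apply: H_pr => //. Qed.

Lemma fb_X (f : H) x y : y \in X -> fb f (y + x) = psibar psi (2^-1 * bform x y) * fb f x.
Proof.
move=> /x_spaceP [a Aa <-]; have [Bx <-] := lift_bP x; set v := lift_b _ _ in Bx *.
have Ba := AB Aa; rewrite -qs_D // -!fbE //; last exact: Bs_D.
by rewrite HE // psi_half.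
Qed.

Lemma fb_phiA x : fb phiA x = (x \in X)%:R.
Proof.
have [Bx <-] := lift_bP x; set v := lift_b _ _ in Bx *; rewrite -fbE //.
have [vX|vX] := boolP (pr v \in X); first by rewrite phiAT //; apply: pr_memX.
by rewrite phiAF // => /pr_A; rewrite (negPf vX).
Qed.

Lemma Mb g (f : H) w : KB beta B g -> Bs w -> M_op g f w = qC ^- l *
  \sum_(c : T) psibar psi (2^-1 * bform (epsv c) (pr w)) *
     fb f (((p_Sp pr g)^-1)%VF (epsv c + pr w)).
Proof.
move=> Kg Bw; rewrite M_opT //; congr (_ * _); apply: eq_bigr => c _.
have Bc := Bs_Ev c; have KgV := KBV Kg; have Bcw : Bs (Ev c + w) by apply: Bs_D.
rewrite psi_half // pr_Ev fbE; last by apply/(KB_Bs _ KgV).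
by rewrite -p_SpE // p_SpV // qs_D // pr_Ev.
Qed.

Lemma card_epsv (U : {vspace b}) : (U <= X)%VS ->
  #|[set c : T | epsv c \in U]%SET| = (#|F| ^ \dim U)%N.
Proof.
move=> UX; pose n := \dim U.
pose vs (d : {ffun 'I_n -> F}) := \sum_i d i *: (vbasis U)`_i.
pose f d : T := [ffun i => bform (vs d) (phi i)].
have vsU d : vs d \in U.
  by apply: rpred_sum => i _; rewrite rpredZ // vbasis_mem // mem_nth ?size_tuple.
have ef d : epsv (f d) = vs d by rewrite -(X_epsv (subvP UX _ (vsU d))).
have finj : injective f.
  move=> d d' e; have {e} : vs d = vs d' by rewrite -!ef e.
  have fr : free (vbasis U) := basis_free (vbasisP U).
  by move=> e; apply/ffunP => i; rewrite -(coord_sum_free d i fr) -/(vs d) e coord_sum_free.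
rewrite -[RHS](_ : #|{ffun 'I_n -> F}| = _); last by rewrite card_ffun card_ord.
rewrite -(card_imset _ finj); apply: eq_card => c; rewrite inE.
apply/idP/imsetP => [cU|[d _ ->]]; last by rewrite ef.
exists [ffun i => coord (vbasis U) i (epsv c)] => //; apply: epsv_inj; rewrite ef.
rewrite {1}(coord_vbasis cU); apply: eq_bigr => i _.
by rewrite ffunE.
Qed.

Local Notation jf := (j_fun A pr l).

Lemma dim_X : \dim X = l.
Proof. by rewrite -bas_X (dimX bas_b). Qed.

(** The average is the proportion of vectors of [X] that lie in [h X]. *)
Lemma Mcoef g : KB beta B g -> M_op g phiA 0 = qC ^- jf (p_Sp pr g).
Proof.
move=> Kg; have S := Sp_p_Sp Kg; rewrite Mb //; last exact: Bs_0.
set h := p_Sp pr g in S *.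
have -> : \sum_(c : T) psibar psi (2^-1 * bform (epsv c) (pr 0)) *
    fb phiA ((h^-1)%VF (epsv c + pr 0)) = qC ^+ \dim (X :&: h @: X).
  rewrite /qC -natrX -card_epsv ?capvSl // -sum1dep_card natr_sum [RHS]big_mkcond.
  apply: eq_bigr => c _; rewrite pr0 sf0r mulr0 psibar0 mul1r addr0 fb_phiA memv_cap.
  rewrite epsv_X /=; have -> : (epsv c \in (h @: X)%VS) = ((h^-1)%VF (epsv c) \in X).
    apply/idP/idP => [/memv_imgP [y yX ->]|hX]; first by rewrite (SpK S).
    by rewrite -(SpVK S (epsv c)) memv_img.
  by case: (_ \in X).
have dl : (\dim (X :&: h @: X) <= l)%N.
  by have := dimvS (capvSl X (h @: X)%VS); rewrite dim_X.
rewrite /j_fun -{1}(subnK dl) exprD invfM -mulrA mulVf ?mulr1 //.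
by rewrite expf_neq0 // qC_neq0.
Qed.

(** * The scalar factor of [S_op] *)

Context (theta : 'End(b) -> sq_class F).
Hypothesis thetaP : is_theta A pr eps phi theta.

Local Notation om := (omega psi).
Local Notation gs := (gauss (psibar psi)).
Local Notation rq := (Num.sqrt (#|F|%:R : R)).
Local Notation rqC := (rq%:C%C).

Lemma rq_sqr : rqC ^+ 2 = qC.
Proof. by rewrite -rmorphXn /= sqr_sqrtr ?ler0n // rmorph_nat. Qed.

Lemma rq_neq0 : rqC != 0.
Proof. by apply: contraNneq qC_neq0 => e; rewrite -rq_sqr e expr0n. Qed.

Lemma omE a : om a = rqC^-1 * gs a.
Proof. by rewrite /omega fmorphV. Qed.

Lemma om_sqr a t : t != 0 -> om (a * t ^+ 2) = om a.
Proof. by move=> t0; rewrite !omE gauss_sqr. Qed.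

Lemma om_mul a c : a != 0 -> c != 0 -> om (a * c) * om 1 = om a * om c.
Proof.
move=> a0 c0; rewrite !omE.
have E := gauss_mul F2b psibarD psibar_ntriv a0 c0.
by rewrite mulrACA E mulrACA.
Qed.

Lemma om1_neq0 : om 1 != 0.
Proof.
by rewrite omE mulf_neq0 ?invr_eq0 ?rq_neq0 // (gauss1_neq0 F2b psibarD psibar0 psibar_ntriv).
Qed.

Lemma om_pm a : a != 0 -> om a = om 1 \/ om a = - om 1.
Proof.
move=> a0; have [[t at_]|na] := pselect (exists t, a = t ^+ 2).
  left; rewrite -[a]mul1r at_ om_sqr //; apply: contraNneq a0 => t0.
  by rewrite at_ t0 expr0n.
by right; rewrite !omE (gauss_nonsquare F2b psibarD psibar_ntriv a0 na) mulrN.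
Qed.

Local Notation omc := (omega_class psi).

Lemma omc_coset (u : {unit F}) : omc (coset <<unit_squares F>>%g u) = om (FinRing.uval u).
Proof.
by rewrite /omega_class; have [t t0 ->] := repr_sq_class u; rewrite om_sqr.
Qed.

Lemma omc_to a : a != 0 -> omc (to_sq_class a) = om a.
Proof.
by move=> a0; rewrite /to_sq_class omc_coset -[FinRing.uval _]/(val _) val_insubd unitfE a0.
Qed.

(** [omc x / om 1] is a sign character of the square classes. *)
Lemma omcM x y : omc (x * y)%g * om 1 = omc x * omc y.
Proof.
rewrite -(coset_reprK x) -(coset_reprK y) -morphM ?norm_squares //=.
by rewrite !omc_coset unitM_val om_mul ?uval_neq0.
Qed.

Lemma omc_pm x : omc x = om 1 \/ omc x = - om 1.
Proof. by apply: om_pm; apply: uval_neq0. Qed.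

Lemma omc_neq0 x : omc x != 0.
Proof. by have [->|->] := omc_pm x; rewrite ?oppr_eq0 om1_neq0. Qed.

Lemma omc1 : omc 1%g = om 1.
Proof.
rewrite -[1%g](morph1 (coset_morphism _)) /= omc_coset.
by [].
Qed.

Lemma Pst_stab p : Pst bform eps p <-> P_stab A pr p.
Proof. by rewrite /Pst /P_stab bas_X. Qed.

Local Notation Pb := (Pst bform eps).

Lemma theta1 : theta \1%VF = 1%g.
Proof.
case: thetaP => _ _ /(_ finset.set0 \1%VF); apply=> i.
by rewrite !inE !id_lfunE.
Qed.

Lemma Pb1 : Pb \1%VF.
Proof. by apply: PstI => [|y yX]; [apply: Sp1|rewrite id_lfunE]. Qed.

Lemma thetaMl p g : Pb p -> Sp bform g -> theta (p \o g)%VF = (theta p * theta g)%g.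
Proof.
move=> /Pst_stab Pp Sg; case: thetaP => t1 _ _.
have := t1 p g \1%VF Pp Sg; rewrite comp_lfun1r theta1 mulg1; apply.
by apply/Pst_stab; apply: Pb1.
Qed.

Lemma thetaMr p g : Pb p -> Sp bform g -> theta (g \o p)%VF = (theta g * theta p)%g.
Proof.
move=> /Pst_stab Pp Sg; case: thetaP => t1 _ _.
have := t1 \1%VF g p; rewrite comp_lfun1l theta1 mul1g; apply=> //.
by apply/Pst_stab; apply: Pb1.
Qed.

Lemma theta_tauS s : uniq s -> theta (tauS bform eps phi s) = 1%g.
Proof.
move=> us; case: thetaP => _ _ /(_ [set i in s]%SET); apply=> i; rewrite inE.
exact: (tauSE bas_ee bas_pp bas_ep us).
Qed.

Lemma jMl p g : Pb p -> jf (p \o g)%VF = jf g.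
Proof.
move=> [S pX]; congr (_ - _)%N; rewrite limg_comp.
rewrite bas_X in pX.
rewrite -{1}pX -[RHS](Sp_limg_dim _ S); congr (\dim _).
apply/eqP; rewrite eqEsubv limg_cap andbT; apply/subvP => _ /memv_capP [/memv_imgP [y yX ->]].
move=> /memv_imgP [z zg /(can_inj (SpK S)) yz].
by rewrite memv_img // memv_cap yX yz.
Qed.

Lemma jMr p g : Pb p -> jf (g \o p)%VF = jf g.
Proof. by move=> [S pX]; rewrite bas_X in pX; congr (_ - _)%N; rewrite limg_comp pX. Qed.

Lemma jP p : Pb p -> jf p = 0%N.
Proof. by move=> [S pX]; rewrite bas_X in pX; rewrite /j_fun pX capvv dim_X subnn. Qed.

(* The opaque witnesses below keep unification from unfolding the operators. *)
Fact sS_sig : {s : 'End(b) -> R[i] |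
  forall h, s h = m_fun A pr l theta h * (rq ^+ jf h)%:C%C}.
Proof. by exists (fun h => m_fun A pr l theta h * (rq ^+ jf h)%:C%C). Qed.

Definition sS := sval sS_sig.

Lemma sS_def h : sS h = m_fun A pr l theta h * (rq ^+ jf h)%:C%C.
Proof. by rewrite /sS; case: sS_sig. Qed.

Lemma sSE h : sS h = (omc (theta h))^-1 * om 1 * (om 1)^- jf h * rqC ^+ jf h.
Proof.
rewrite sS_def /m_fun; congr (_ * _); last by rewrite rmorphXn.
rewrite -mulrA; congr (_ * _).
by rewrite expfzDr ?om1_neq0 // expr1z exprnN.
Qed.

Lemma sS_neq0 h : sS h != 0.
Proof.
rewrite sSE; apply: mulf_neq0; last by rewrite expf_neq0 // rq_neq0.
apply: mulf_neq0; last by rewrite invr_eq0 expf_neq0 // om1_neq0.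
by apply: mulf_neq0; [rewrite invr_eq0 omc_neq0|apply: om1_neq0].
Qed.

Lemma omcM' x y : omc (x * y)%g = omc x * omc y / om 1.
Proof. by rewrite -omcM mulfK ?om1_neq0. Qed.

(** A parabolic factor leaves [j] unchanged and enters [theta] multiplicatively, so only the
    normalisation by [om 1] has to be tracked. *)
Lemma sSMl p g : Pb p -> Sp bform g -> sS (p \o g)%VF = sS p * sS g.
Proof.
move=> Pp Sg; rewrite !sSE thetaMl // jMl // (jP Pp) !expr0 invr1 !mulr1 omcM'.
move: (om 1) (omc (theta p)) (omc (theta g)) (rqC ^+ _) => o x y t.
by rewrite !invfM invrK; ring.
Qed.

Lemma sSMr p g : Pb p -> Sp bform g -> sS (g \o p)%VF = sS g * sS p.
Proof.
move=> Pp Sg; rewrite !sSE thetaMr // jMr // (jP Pp) !expr0 invr1 !mulr1 omcM'.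
move: (om 1) (omc (theta p)) (omc (theta g)) (rqC ^+ _) => o x y t.
by rewrite !invfM invrK; ring.
Qed.

Lemma sS_pm p : Pb p -> sS p = 1 \/ sS p = -1.
Proof.
move=> Pp; rewrite sSE (jP Pp) !expr0 invr1 !mulr1; have o0 := om1_neq0.
by have [->|->] := omc_pm (theta p); rewrite ?invrN ?mulNr mulVf //; [left|right].
Qed.

Lemma sS_sqr p : Pb p -> sS (p \o p)%VF = 1.
Proof.
by move=> Pp; rewrite sSMl //; [have [->|->] := sS_pm Pp; rewrite ?mulrNN mulr1|case: Pp].
Qed.

(** * Multiplicativity against the parabolic *)

Context (Mp : set (pair_type psi beta A)).
Hypothesis MpP : is_metaplectic Mp.
Local Notation Mop := (@Mop R k F K psi W beta A).
Local Notation KBB := (KB beta B).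

Fact Sop_sig : {S : 'End(W) -> H -> H |
  forall g (f : H), S g f = insubd f (S_op A pr l theta g f)}.
Proof. by exists (fun g (f : H) => insubd f (S_op A pr l theta g f)). Qed.

Definition Sop := sval Sop_sig.

Lemma Sop_def g (f : H) : Sop g f = insubd f (S_op A pr l theta g f).
Proof. by rewrite /Sop; case: Sop_sig. Qed.

Lemma S_opE g (f : W -> R[i]) w : S_op A pr l theta g f w = sS (p_Sp pr g) * M_op g f w.
Proof. by rewrite sS_def. Qed.

Lemma S_op_mem g (f : H) : KBB g -> S_op A pr l theta g f \in Hpred psi beta A.
Proof.
move=> Kg; rewrite (_ : S_op _ _ _ _ _ _ = sS (p_Sp pr g) *: M_op g f); last first.
  by apply/funext => w; rewrite S_opE.
apply: rpredZ; exact: (inH_M_op odd_res Asd MpP f (KB_Sp Kg) (latQ_KB Kg)).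
Qed.

Lemma SopE g f w : KBB g -> Sop g f w = sS (p_Sp pr g) * M_op g f w.
Proof. by move=> Kg; rewrite Sop_def /= val_insubd S_op_mem // S_opE. Qed.

Lemma Sop_Mp g U : KBB g -> Mp (g, U) ->
  exists2 s : R[i], s != 0 & forall f, Sop g f = s *: U f.
Proof.
move=> Kg gU; have [c c0 Uc] := Mp_M_op odd_res Asd MpP gU (latQ_KB Kg).
exists (sS (p_Sp pr g) / c) => [|f].
  by rewrite mulf_neq0 ?invr_eq0 // sS_neq0.
by apply: H_eqP => w; rewrite SopE // HZ Uc [RHS]mulrA divfK.
Qed.

Lemma Mp_ex g : KBB g -> exists U, Mp (g, U).
Proof. by move=> Kg; apply: (Mp_lift MpP (KB_Sp Kg)). Qed.

Lemma SopZ g c f : KBB g -> Sop g (c *: f) = c *: Sop g f.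
Proof.
move=> Kg; have [U gU] := Mp_ex Kg; have [s s0 Ss] := Sop_Mp Kg gU.
by rewrite !Ss (Mp_Z MpP _ _ gU) !scalerA mulrC.
Qed.

Lemma Sop_proj g h : KBB g -> KBB h -> exists2 c : R[i], c != 0 &
  forall f, Sop g (Sop h f) = c *: Sop (g \o h)%VF f.
Proof.
move=> Kg Kh; have [U gU] := Mp_ex Kg; have [V hV] := Mp_ex Kh.
have [s s0 Ss] := Sop_Mp Kg gU; have [t t0 St] := Sop_Mp Kh hV.
have [r r0 Sr] := Sop_Mp (KBM Kg Kh) (Mp_mul MpP gU hV).
exists (s * t / r) => [|f]; first by rewrite !mulf_neq0 ?invr_eq0.
by rewrite Sr /= scalerA divfK // Ss St (Mp_Z MpP _ _ gU) scalerA.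
Qed.

Lemma Sop_phi0 g : KBB g -> Sop g phiA 0 = sS (p_Sp pr g) * qC ^- jf (p_Sp pr g).
Proof. by move=> Kg; rewrite SopE // Mcoef. Qed.

Lemma Sop_phi0_neq0 g : KBB g -> Sop g phiA 0 != 0.
Proof.
move=> Kg; rewrite Sop_phi0 //.
by apply: mulf_neq0; [apply: sS_neq0|rewrite invr_eq0 expf_neq0 // qC_neq0].
Qed.

Lemma Sop_mul g h : KBB g -> KBB h ->
  Sop g (Sop h phiA) 0 = Sop (g \o h)%VF phiA 0 ->
  forall f, Sop g (Sop h f) = Sop (g \o h)%VF f.
Proof.
move=> Kg Kh e f; have [c c0 Sc] := Sop_proj Kg Kh.
suff -> : Sop g (Sop h f) = 1 *: Sop (g \o h)%VF f by rewrite scale1r.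
rewrite Sc; congr (_ *: _); apply: (mulIf (Sop_phi0_neq0 (KBM Kg Kh))).
by rewrite mul1r -[in RHS]e Sc HZ.
Qed.

Definition KAB p := KBB p /\ KA beta A p.

Lemma KAB_Pb p : KAB p -> Pb (p_Sp pr p).
Proof. by move=> [Kp Ap]; apply/Pst_stab; split; [apply: Sp_p_Sp|apply: KA_Pst]. Qed.

Lemma KAB_I p : KBB p -> Pb (p_Sp pr p) -> KAB p.
Proof. by move=> Kp /Pst_stab [_ pX]; split=> //; apply: KB_KA. Qed.

Lemma KABM p p' : KAB p -> KAB p' -> KAB (p \o p')%VF.
Proof. by move=> [K1 A1] [K2 A2]; split; [apply: KBM|apply: KAM]. Qed.

Lemma KABV p : KAB p -> KAB (p^-1)%VF.
Proof. by move=> [K1 A1]; split; [apply: KBV|apply: KAV]. Qed.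

Lemma Sop_KA p f w : KAB p -> Sop p f w = sS (p_Sp pr p) * f ((p^-1)%VF w).
Proof. by move=> [Kp Ap]; rewrite SopE // M_op_KA. Qed.

Lemma Sop_KA_phi p : KAB p -> Sop p phiA = sS (p_Sp pr p) *: phiA.
Proof.
move=> Kp; apply: H_eqP => w; rewrite Sop_KA // HZ; congr (_ * _).
have [_ pA] := KAV Kp.2; have [Aw|Aw] := pselect (inA w).
  by rewrite !phiAT //; apply/pA.
by rewrite !phiAF // => /pA.
Qed.

Lemma Sop_Ml p g f : KAB p -> KBB g -> Sop p (Sop g f) = Sop (p \o g)%VF f.
Proof.
move=> Kp Kg; have [Kp1 _] := Kp; apply: Sop_mul => //.
have P := KAB_Pb Kp; have S := Sp_p_Sp Kg.
have p0 : (p^-1)%VF 0 = 0 by rewrite linear0.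
rewrite (Sop_KA _ _ Kp) p0 (Sop_phi0 Kg) (Sop_phi0 (KBM Kp1 Kg)).
by rewrite p_SpM // sSMl // jMl // mulrA.
Qed.

Lemma Sop_Mr p g f : KAB p -> KBB g -> Sop g (Sop p f) = Sop (g \o p)%VF f.
Proof.
move=> Kp Kg; have [Kp1 _] := Kp; apply: Sop_mul => //.
have P := KAB_Pb Kp; have S := Sp_p_Sp Kg.
rewrite (Sop_KA_phi Kp) (SopZ _ _ Kg) HZ (Sop_phi0 Kg) (Sop_phi0 (KBM Kg Kp1)).
by rewrite p_SpM // sSMr // jMr // mulrA [X in X * _]mulrC.
Qed.

(** On the parabolic [sS] is a sign, and [Mp] is stable under change of sign. *)
Lemma Mp_Sop_KA p : KAB p -> Mp (p, Sop p).
Proof.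
move=> Kp; have Mpp := Mp_KA odd_res Asd MpP Kp.2.
have e f w : Sop p f w = sS (p_Sp pr p) * Mop p f w.
  by rewrite Sop_KA // (Mop_KA odd_res Asd MpP) //; case: Kp.
have [s1|s1] := sS_pm (KAB_Pb Kp).
  suff -> : Sop p = Mop p by [].
  by apply/funext => f; apply: H_eqP => w; rewrite e s1 mul1r.
suff -> : Sop p = -%R \o Mop p by apply: (Mp_opp odd_res Asd MpP).
by apply/funext => f; apply: H_eqP => w; rewrite e s1 mulN1r.
Qed.

(** * The matrix of [Sop] on the vectors invariant under [B] *)

Lemma Fv_dlt (c d : T) : inA (Fv c - Fv d) <-> c = d.
Proof.
split=> [Acd|->]; last by rewrite subrr; apply: lat_0.
have := pr_A Acd; rewrite prB ?pr_Fv; [|exact: Bs_Fv..].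
move=> /memX e; apply/ffunP => i; apply/eqP; rewrite -subr_eq0 -!eps_phiv.
by rewrite -sfNr -sfDr e.
Qed.

Lemma H_Fv_expand (f : H) v : Bs v -> f v = \sum_(e : T) f (Fv e) * dlt (Fv e) v.
Proof.
move=> Bv; pose d : T := [ffun i => bform (eps i) (pr v)].
have Ad : inA (v - Fv d).
  apply: pr_memX; first by apply: Bs_B => //; apply: Bs_Fv.
  rewrite prB //; last exact: Bs_Fv.
  by apply/memX => i; rewrite pr_Fv sfDr sfNr eps_phiv ffunE subrr.
transitivity (f (Fv d) * dlt (Fv d) v + \sum_(e | e != d) f (Fv e) * dlt (Fv e) v).
  rewrite big1 ?addr0 -?H_dlt // => e ed; rewrite dltF ?mulr0 // => Ae.
  case/eqP: ed; apply/Fv_dlt.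
  have -> : Fv e - Fv d = (v - Fv d) - (v - Fv e).
    by rewrite opprB [RHS]addrC addrA subrK.
  exact: latB.
by rewrite [RHS](bigD1 d).
Qed.

(** At a point of [Bs] only values of [f] on [Bs] enter, so [f] may be replaced by its expansion in
    delta functions supported there. *)
Lemma Sop_Fv_expand g (f : H) w : KBB g -> Bs w ->
  Sop g f w = \sum_(e : T) f (Fv e) * Sop g (dlt (Fv e)) w.
Proof.
move=> Kg Bw; rewrite SopE // Mb //.
under eq_bigr => c _ do rewrite /fb (H_Fv_expand f (proj1 (lift_bP _))) mulr_sumr.
rewrite exchange_big mulr_sumr mulr_sumr; apply: eq_bigr => e _.
rewrite SopE // Mb // !mulr_sumr; apply: eq_bigr => c _; rewrite /fb.
by rewrite 3!(mulrCA _ (f (Fv e))).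
Qed.

Local Notation NT := #|{: T}|.
Local Notation ev := (fun i : 'I_NT => Fv (enum_val i)).

(** In the basis [dlt (Fv e)] the coordinates of a function are its values at the points [Fv e], one
    for each coset of [A] in [Bs]. *)
Fact Tmx_sig : {M : 'End(W) -> 'M[R[i]]_NT |
  forall g i j, M g i j = Sop g (dlt (ev j)) (ev i)}.
Proof.
by exists (fun g => \matrix_(i, j) Sop g (dlt (ev j)) (ev i)) => g i j; apply: mxE.
Qed.

Definition Tmx := sval Tmx_sig.

Lemma TmxE g i j : Tmx g i j = Sop g (dlt (ev j)) (ev i).
Proof. by rewrite /Tmx; case: Tmx_sig. Qed.

Lemma Tmx_mul g h g' (c : R[i]) : KBB g -> KBB h ->
  (forall f, Sop g (Sop h f) = c *: Sop g' f) -> Tmx g *m Tmx h = c *: Tmx g'.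
Proof.
move=> Kg Kh E; apply/matrixP => i j.
have Eij : Sop g (Sop h (dlt (ev j))) (ev i) = c * Sop g' (dlt (ev j)) (ev i).
  by rewrite E.
rewrite [RHS]mxE (TmxE g') -Eij mxE (Sop_Fv_expand _ Kg (Bs_Fv _)).
rewrite (reindex (@enum_val T T)); last exact/onW_bij/enum_val_bij.
by apply: eq_bigr => m _; rewrite (TmxE g) (TmxE h) mulrC.
Qed.

(** Although [Sop g] depends on [g] itself, its matrix at finite level sees only the image in
    [Sp(b)]; orders of elements can thus be computed in a finite group. *)
Lemma Tmx_p_Sp g g' : KBB g -> KBB g' -> p_Sp pr g = p_Sp pr g' -> Tmx g = Tmx g'.
Proof.
move=> Kg Kg' e; apply/matrixP => i j.
rewrite (TmxE g) (TmxE g') (SopE _ _ Kg) (SopE _ _ Kg').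
by rewrite (Mb _ Kg (Bs_Fv _)) (Mb _ Kg' (Bs_Fv _)) e.
Qed.

Lemma sS1 : sS \1%VF = 1.
Proof.
rewrite sSE theta1 omc1 (jP Pb1) !expr0 invr1 !mulr1 mulVf //.
exact: om1_neq0.
Qed.

Lemma KAB1 : KAB \1%VF. Proof. by split; [apply: KB1|apply: KA1]. Qed.

Lemma Sop1 f : Sop \1%VF f = f.
Proof.
apply: H_eqP => w; rewrite (Sop_KA _ _ KAB1) p_Sp1 sS1 mul1r.
by rewrite (inv1_lfunE beta).
Qed.

Lemma Tmx1 : Tmx \1%VF = 1%:M.
Proof.
apply/matrixP => i j; rewrite TmxE [RHS]mxE Sop1; case: eqVneq => [->|ij].
  by rewrite dltT ?sf_alt ?mulr0 ?psi0 // subrr; apply: lat_0.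
rewrite dltF // => /Fv_dlt /enum_val_inj e.
by rewrite e eqxx in ij.
Qed.

Lemma det_Tmx_neq0 g : KBB g -> \det (Tmx g) != 0.
Proof.
move=> Kg; have [c c0 Sc] := Sop_proj Kg (KBV Kg).
have := congr1 determinant (Tmx_mul Kg (KBV Kg) Sc).
rewrite (Sp_compV (KB_Sp Kg)) Tmx1 det_mulmx detZ det1 mulr1 => e.
have := expf_neq0 NT c0; rewrite -e.
by apply: contraNneq => d0; apply/eqP; rewrite d0; apply: mul0r.
Qed.

(** * Scalars of diagonal and Weyl elements *)

Local Notation hdb := (hd bform eps phi).
Local Notation tau1b := (tau1 bform eps phi).
Local Notation tauSb := (tauS bform eps phi).
Local Notation Tb := (T_op bform).

(* Conjugating by the change of basis between [vbasis] and [eps] makes [hd i a] diagonal. *)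
Lemma det_hd i a : det_on X (hdb i a) = a.
Proof.
set g := hdb i a; have lX : l = \dim X by rewrite dim_X.
pose ep j := eps (cast_ord (esym lX) j); pose ph j := phi (cast_ord (esym lX) j).
have expand y : y \in X -> y = \sum_j bform y (ph j) *: ep j.
  move=> yX; rewrite {1}(X_epsv yX) /epsv (reindex (cast_ord (esym lX))) /=.
    by apply: eq_bigr => j _; rewrite ffunE.
  by exists (cast_ord lX) => j _; apply: val_inj.
have vX (j : 'I_(\dim X)) : (vbasis X)`_j \in X by apply: vbasis_mem; rewrite mem_nth // size_tuple.
pose P := \matrix_(j, m) bform (vbasis X)`_(j : 'I_(\dim X)) (ph m).
pose Q := \matrix_(j, m) coord (vbasis X) m (ep j).
pose d := \row_j (if cast_ord (esym lX) j == i then a else 1).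
have gep j : g (ep j) = d 0 j *: ep j by rewrite mxE (hd_eps bas_ee bas_ep).
have PQ : P *m Q = 1%:M.
  apply/matrixP => j m; rewrite !mxE.
  under eq_bigr => s _ do rewrite !mxE -linearZ /=.
  rewrite -linear_sum -(expand _ (vX j)) /= coord_free //.
  exact: basis_free (vbasisP _).
rewrite /det_on (_ : \matrix_(_, _) _ = P *m diag_mx d *m Q).
  rewrite !det_mulmx mulrAC -det_mulmx PQ det1 mul1r det_diag.
  rewrite (bigD1 (cast_ord lX i)) //= mxE (_ : cast_ord _ _ = i) ?eqxx; last exact: val_inj.
  rewrite big1 ?mulr1 // => j ji; rewrite mxE ifN //; apply: contraNneq ji => e.
apply/matrixP => j m; rewrite !mxE {1}(expand _ (vX j)) !linear_sum.
apply: eq_bigr => s _; rewrite !linearZ /= gep linearZ /= mxE.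
by rewrite mul_mx_diag !mxE mulrA.
Qed.

Lemma Pb_hd i a : a != 0 -> Pb (hdb i a).
Proof. by move=> a0; apply: (Pst_hd bas_b bas_ee bas_pp bas_ep). Qed.

Lemma omc_hd i a : a != 0 -> omc (theta (hdb i a)) = om a.
Proof.
move=> a0; have -> : theta (hdb i a) = to_sq_class (det_on X (hdb i a)).
  by case: thetaP => _ t2 _; apply: t2; apply/Pst_stab; apply: Pb_hd.
by rewrite det_hd omc_to.
Qed.

(** [X :&: tau_S X] is spanned by the [eps i] with [i] outside [s]: for [i] in [s] the coordinate on
    [eps i] is a pairing with [phi i = tau_S (eps i)], and [tau_S X] is isotropic. *)
Lemma jf_tauS s : uniq s -> jf (tauSb s) = size s.
Proof.
move=> us; have tE := tauSE bas_ee bas_pp bas_ep us.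
have St : Sp bform (tauSb s) by apply: Sp_tauS.
pose V0 := [seq eps i | i <- enum 'I_l & i \notin s].
have -> : jf (tauSb s) = (l - \dim <<V0>>)%N.
  congr (_ - \dim _)%N; apply/eqP; rewrite eqEsubv; apply/andP; split.
    apply/subvP => y /memv_capP [yX /memv_imgP [z zX yz]].
    rewrite (X_epsv yX); apply: rpred_sum => i _; rewrite ffunE.
    have [is_|is_] := boolP (i \in s).
      have [ti _] := tE i; rewrite is_ in ti.
      by rewrite yz -ti St (X_iso zX (eps_X i)) scale0r mem0v.
    rewrite rpredZ // memv_span //; apply: map_f.
    by rewrite mem_filter is_ mem_enum.
  apply/span_subvP => _ /mapP [i + ->]; rewrite mem_filter => /andP [is_ _].
  rewrite memv_cap eps_X /=; have [ti _] := tE i; rewrite (negPf is_) in ti.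
  by rewrite -[X in X \in _]ti memv_img // eps_X.
have fV : free V0.
  have : perm_eq (codom eps)
      (V0 ++ [seq eps i | i <- enum 'I_l & predC [pred i | i \notin s] i]).
    rewrite -map_cat; apply: perm_map; rewrite perm_sym.
    exact: (permEl (perm_filterC [pred i | i \notin s] _)).
  move/perm_free; rewrite (free_eps bas_b) => /esym; exact: catl_free.
move: fV; rewrite /free => /eqP ->; rewrite size_map size_filter.
have := count_predC (mem s) (enum 'I_l); rewrite -cardE card_ord => cl.
have cs : count (mem s) (enum 'I_l) = size s.
  rewrite -size_filter -(card_uniqP us) cardE; apply: perm_size.
  apply: uniq_perm => [||i]; [by apply/filter_uniq/enum_uniq|exact: enum_uniq|].
  by rewrite mem_filter !mem_enum andbT.
by rewrite -{1}cl cs; apply: addnK.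
Qed.

Lemma avg_coord (h : F -> R[i]) (i : 'I_l) :
  qC ^- l * \sum_(c : T) h (c i) = qC^-1 * \sum_t h t.
Proof.
pose n := #|[set c : T | c i == 0]%SET|.
have cnt t : (\sum_(c : T | c i == t) 1 = n)%N.
  rewrite (reindex_inj (addrI [ffun _ : 'I_l => t])) sum1dep_card; apply: eq_card => c.
  by rewrite !inE !ffunE -subr_eq0 addrAC subrr add0r.
have E (h0 : F -> R[i]) : \sum_(c : T) h0 (c i) = n%:R * \sum_t h0 t.
  rewrite (partition_big (fun c : T => c i) xpredT) //= mulr_sumr.
  apply: eq_bigr => t _; rewrite (eq_bigr (fun=> h0 t)) => [|c /eqP -> //].
  by rewrite -(cnt t) natr_sum mulr_suml; apply: eq_bigr => c _; rewrite mul1r.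
have e1 : qC ^+ l = n%:R * qC.
  rewrite -card_T -sum1_card natr_sum (E (fun=> 1)) sumr_const.
  by congr (_ * _).
have n0 : (n%:R : R[i]) != 0.
  by apply: contraTneq (expf_neq0 l qC_neq0) => n0; rewrite e1 n0 mul0r eqxx.
by rewrite E e1 invfM mulrACA mulVf // mul1r.
Qed.

Lemma Pb_tv i a : Pb (tv bform (eps i) a).
Proof.
apply: PstI => [|y]; first exact: Sp_tv.
rewrite bas_X => yX; rewrite tvE (X_iso yX (eps_X i)) mulr0 scale0r addr0 //.
Qed.

(** As 2 is invertible, the transvection is a square of an element of the parabolic, where [sS] is a
    sign. *)
Lemma sS_tv i a : sS (tv bform (eps i) a) = 1.
Proof.
have -> : tv bform (eps i) a = (tv bform (eps i) (a / 2) \o tv bform (eps i) (a / 2))%VF.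
  by rewrite tvD; congr tv; field; rewrite F2b.
by apply: sS_sqr; apply: Pb_tv.
Qed.

Lemma tau1_hd i c : c != 0 -> tau1b i c = (hdb i c^-1 \o tauSb [:: i])%VF.
Proof.
move=> c0; have tE := tauSE bas_ee bas_pp bas_ep (s := [:: i]) isT.
have o0 : (1 : F) != 0 := oner_neq0 F.
apply: (eq_on_basis bas_b bas_ee bas_pp bas_ep) => j; have [e1 e2] := tE j.
  rewrite comp_lfunE e1 inE (tau1_eps bas_ee bas_ep) //; case: eqVneq => [->|ji].
    by rewrite (hd_phi bas_pp bas_ep) eqxx invrK.
  by rewrite (hd_eps bas_ee bas_ep) (negPf ji) scale1r.
rewrite comp_lfunE e2 inE (tau1_phi bas_ee bas_pp bas_ep) //; case: eqVneq => [->|ji].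
  by rewrite linearN /= (hd_eps bas_ee bas_ep) eqxx scaleNr.
by rewrite (hd_phi bas_pp bas_ep) (negPf ji) scale1r.
Qed.

Lemma sS_tauS s : uniq s -> sS (tauSb s) = (rqC / om 1) ^+ size s.
Proof.
move=> us; rewrite sSE theta_tauS // omc1 jf_tauS // mulVf ?om1_neq0 // mul1r.
by rewrite [in RHS]exprMn exprVn mulrC.
Qed.

Lemma jf_tau1 i c : c != 0 -> jf (tau1b i c) = 1%N.
Proof.
move=> c0; rewrite tau1_hd // jMl ?jf_tauS //.
by apply: Pb_hd; rewrite invr_eq0.
Qed.

Lemma om_inv c : c != 0 -> om c^-1 = om c.
Proof.
move=> c0; have c'0 : c^-1 != 0 by rewrite invr_eq0.
by rewrite -[RHS](om_sqr c c'0) expr2 mulrA mulfV // mul1r.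
Qed.

(** Here [sS (tau1b i c) = rqC / om c] while [gs c = rqC * om c]. This cancellation is what the
    normalisation of [m] and the power of [q] in [S_op] are designed for. *)
Lemma gs_tau1 i c : c != 0 -> sS (tau1b i c) * gs c = qC.
Proof.
move=> c0; have c'0 : c^-1 != 0 by rewrite invr_eq0.
have oc0 : om c != 0 by have [->|->] := om_pm c0; rewrite ?oppr_eq0 om1_neq0.
rewrite tau1_hd // sSMl; [|exact: Pb_hd|exact: Sp_tauS].
rewrite sS_tauS // expr1 sSE omc_hd // om_inv // (jP (Pb_hd i c'0)) !expr0 invr1 !mulr1.
have -> : gs c = rqC * om c by rewrite omE mulVKf // rq_neq0.
rewrite -rq_sqr expr2; have o0 := om1_neq0; move: (om 1) (om c) (rqC) o0 oc0 => o x t o0 x0.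
by field; rewrite o0 x0.
Qed.

(** * Membership in [Mp] and determinants on generators *)

Context (pc : nat).
Hypothesis pcF : pc \in [pchar F].

Definition Good g := Mp (g, Sop g) /\ \det (Tmx g) ^+ pc = 1.

Lemma det_Ml p g : KAB p -> KBB g ->
  \det (Tmx (p \o g)%VF) = \det (Tmx p) * \det (Tmx g).
Proof.
move=> Kp Kg; rewrite -det_mulmx; congr (\det _).
rewrite (@Tmx_mul p g (p \o g)%VF 1) ?scale1r //; first by case: Kp.
by move=> f; rewrite Sop_Ml // scale1r.
Qed.

Lemma det_Mr p g : KAB p -> KBB g ->
  \det (Tmx (g \o p)%VF) = \det (Tmx g) * \det (Tmx p).
Proof.
move=> Kp Kg; rewrite -det_mulmx; congr (\det _).
rewrite (@Tmx_mul g p (g \o p)%VF 1) ?scale1r //; first by case: Kp.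
by move=> f; rewrite Sop_Mr // scale1r.
Qed.

(** The powers of [T_op u v] are [T_op u (n%:R *: v)], so its order divides [pc]. The lift [g]
    itself need not have finite order, but [Tmx] depends only on the image. *)
Lemma det_T_op g u v : KAB g -> bform u v = 0 ->
  p_Sp pr g = Tb u v -> \det (Tmx g) ^+ pc = 1.
Proof.
move=> Kg uv pg; pose gn n := iter n (fun x => g \o x)%VF (\1%VF : 'End(W)).
have Kgn n : KAB (gn n) by elim: n => [|n IH]; [exact: KAB1|apply: KABM].
have pgn n : p_Sp pr (gn n) = Tb u (n%:R *: v).
  elim: n => [|n IH]; first by rewrite p_Sp1 scale0r T_op0.
  have [K1 _] := Kg; have [K2 _] := Kgn n.
  rewrite [gn _]iterS (p_SpM K1 K2) IH pg T_opD ?sfZr ?uv ?sf_alt ?mulr0 //.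
  by rewrite -{1}[v]scale1r -scalerDl -mulrS.
have dgn n : \det (Tmx (gn n)) = \det (Tmx g) ^+ n.
  elim: n => [|n IH]; first by rewrite Tmx1 det1.
  by rewrite [gn _]iterS det_Ml ?IH ?exprS //; case: (Kgn n).
rewrite -dgn -[RHS](det1 R[i] NT) -Tmx1; congr (\det _).
apply: Tmx_p_Sp; [by case: (Kgn pc)|exact: KB1|].
by rewrite pgn p_Sp1 (pcharf0 pcF) scale0r T_op0.
Qed.

Lemma Good_KAB g : KAB g -> \det (Tmx g) ^+ pc = 1 -> Good g.
Proof. by move=> Kg dg; split=> //; apply: Mp_Sop_KA. Qed.

Lemma tv_T_op i a : tv bform (eps i) a = Tb (eps i) ((a / 2) *: eps i).
Proof.
apply/lfunP => y; rewrite tvE T_opE sfZr scalerA -addrA -scalerDl.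
congr (_ + _ *: _); field; exact: F2b.
Qed.

Lemma Good_tv g i a : KBB g -> p_Sp pr g = tv bform (eps i) a -> Good g.
Proof.
move=> Kg pg; have Ag : KAB g by apply: KAB_I => //; rewrite pg; apply: Pb_tv.
apply: Good_KAB => //; apply: (det_T_op (u := eps i) (v := (a / 2) *: eps i)) => //.
  by rewrite sfZr sf_alt mulr0.
by rewrite pg tv_T_op.
Qed.

Section LongElement.
Variables (i : 'I_l) (c : F).
Hypothesis c0 : c != 0.

Let ct := lift_res K c.
Let ct' := lift_res K c^-1.
Let Oct : ringO K ct. Proof. by case: (lift_resP K c). Qed.
Let Oct' : ringO K ct'. Proof. by case: (lift_resP K c^-1). Qed.
Let Ble : Bs (le i). Proof. by apply: AB; case: (leP i). Qed.
Let Blf : Bs (lf i). Proof. by case: (lfP i). Qed.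

Let nl := tvb (le i) ct'.
Let ml := tvb (lf i) ct.

(** A lift of [tau1b i c] formed by the same product of three transvections, so that the relations
    below hold in [Sp(W)] and not only after reduction. *)
Definition Wl : 'End(W) := (nl \o (ml \o nl))%VF.

Let Knl : KBB nl. Proof. exact: KB_tvb. Qed.
Let Kml : KBB ml. Proof. exact: KB_tvb. Qed.
Lemma KB_Wl : KBB Wl. Proof. by do 2?apply: KBM. Qed.

Let pnl : p_Sp pr nl = tv bform (eps i) c^-1.
Proof.
rewrite p_Sp_tvb //; case: (leP i) => _ ->.
by case: (lift_resP K c^-1) => _ ->.
Qed.

Lemma p_Wl : p_Sp pr Wl = tau1b i c.
Proof.
rewrite /Wl p_SpM //; last exact: KBM.
rewrite p_SpM // pnl p_Sp_tvb //; case: (lfP i) => _ ->.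
by case: (lift_resP K c) => _ ->.
Qed.

Let SW : Sp beta Wl. Proof. exact: KB_Sp KB_Wl. Qed.
Let Sn : Sp beta nl. Proof. exact: KB_Sp Knl. Qed.
Let SpW : Sp bform (tau1b i c). Proof. exact: Sp_tau1. Qed.

Let Anl : KAB nl.
Proof. by apply: KAB_I => //; rewrite pnl; apply: Pb_tv. Qed.

Let u' := (Wl^-1)%VF (lf i).
Let Bu' : Bs u'. Proof. by apply/(KB_Bs _ (KBV KB_Wl)). Qed.
(** This is [Wl^-1 ml Wl]. The inverse of the long element carries [phi i] to a multiple of [eps i],
    so [n'] lies over the parabolic although [ml] does not. *)
Let n' := tvb u' ct.
Let Kn' : KBB n'. Proof. exact: KB_tvb. Qed.

Let pu' : pr u' = c^-1 *: eps i.
Proof.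
rewrite -(p_SpE (KBV KB_Wl) Blf) p_SpV ?p_Wl; last exact: KB_Wl.
apply: (can_inj (SpK SpW)); rewrite (SpVK SpW) linearZ /=.
rewrite (tau1_eps bas_ee bas_ep) // eqxx scalerA mulVf // scale1r.
by case: (lfP i).
Qed.

Let pn' : p_Sp pr n' = tv bform (eps i) (c^-1 ^+ 2 * c).
Proof. by rewrite p_Sp_tvb // pu' tvZ; case: (lift_resP K c) => _ ->. Qed.

Let An' : KAB n'.
Proof. by apply: KAB_I => //; rewrite pn'; apply: Pb_tv. Qed.

Let Wn' : (Wl \o n')%VF = (ml \o Wl)%VF.
Proof.
have E : (Wl \o n' \o Wl^-1)%VF = ml by rewrite (Sp_conj_tv _ _ SW) (SpVK SW).
by rewrite -E -comp_lfunA (Sp_Vcomp SW) comp_lfun1r.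
Qed.

(** Cancelling one [nl] in [Wl = nl ml nl] gives [Wl nl^-1 Wl = nl ml Wl], and [ml] moves past [Wl]
    as [n']. *)
Let groupE : (Wl \o (nl^-1 \o Wl))%VF = (nl \o (Wl \o n'))%VF.
Proof.
rewrite Wn' {1}/Wl -!comp_lfunA; congr (_ \o (_ \o _))%VF.
by rewrite comp_lfunA (Sp_compV Sn) comp_lfun1l.
Qed.

Lemma memW (d : T) v :
  (((tau1b i c)^-1)%VF (epsv d + v *: phi i) \in X) = (d i == 0).
Proof.
set z := epsv d + _; have zE j : bform (eps j) (((tau1b i c)^-1)%VF z) =
    if j == i then - (c * d i) else v * (j == i)%:R.
  rewrite -SpW (SpVK SpW) (tau1_eps bas_ee bas_ep) //.
  case: eqVneq => [->|ji]; rewrite !sfE.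
    by rewrite bas_pp (sfC bform (phi i)) epsv_phi; ring.
  by rewrite (X_iso (eps_X j) (epsv_X d)) bas_ep (negPf ji) add0r.
apply/memX/eqP => [/(_ i)|di j].
  by rewrite zE eqxx => /eqP; rewrite oppr_eq0 mulf_eq0 (negPf c0) => /eqP.
by rewrite zE di mulr0 oppr0; case: eqP => //; rewrite mulr0.
Qed.

(** The surviving terms have [d i = 0] and hence pair trivially with [phi i], so the value does not
    depend on [v] and is read off at 0. *)
Lemma Wphi v : fb (Sop Wl phiA) (v *: phi i) = sS (tau1b i c) * qC^-1.
Proof.
have KW := KB_Wl.
have val x : fb (Sop Wl phiA) (x *: phi i) = sS (tau1b i c) * (qC ^- l *
    \sum_(d : T) (d i == 0)%:R).
  have [Bw pw] := lift_bP (x *: phi i); rewrite /fb (SopE _ _ KW) p_Wl (Mb _ KW Bw) pw.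
  congr (_ * (_ * _)); apply: eq_bigr => d _; rewrite p_Wl fb_phiA memW.
  case: eqP => [di|_]; last by rewrite mulr0.
  by rewrite sfZr epsv_phi di !mulr0 psibar0 mul1r.
rewrite val -(val 0) scale0r; have [B0 p0] := lift_bP (0 : b).
rewrite -{1}(pr0) -fbE; last exact: Bs_0.
by rewrite (Sop_phi0 KW) p_Wl jf_tau1 // expr1.
Qed.

Lemma tau1V_epsv (d : T) : ((tau1b i c)^-1)%VF (epsv d) =
  epsv d - d i *: eps i - (c * d i) *: phi i.
Proof.
apply: (can_inj (SpK SpW)); rewrite (SpVK SpW) !linearB /= !linearZ /=.
rewrite (tau1_eps bas_ee bas_ep) // (tau1_phi bas_ee bas_pp bas_ep) // eqxx.
have -> : tau1b i c (epsv d) = epsv d - d i *: eps i + (d i * c) *: phi i.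
  rewrite /epsv (bigD1 i) //= [d i *: eps i + _]addrC addrK linearD linear_sum linearZ /=.
  rewrite (tau1_eps bas_ee bas_ep) // eqxx scalerA; congr (_ + _).
  apply: eq_bigr => j ji; rewrite linearZ /= (tau1_eps bas_ee bas_ep) //.
  by rewrite (negPf ji).
rewrite !scalerN !scalerA addrK mulrN scaleNr opprK [c * d i]mulrC mulfK //.
by rewrite subrK.
Qed.

(** By [Sop_mul] the transforms of [phiA] need only be compared at 0. Moving [tau1^-1 (epsv d)] by
    the unipotent and reducing modulo [X] leaves [psibar (2^-1 * c * d i ^ 2)]; the average over [d]
    is a Gauss sum divided by [q], which [gs_tau1] cancels against [sS]. *)
Lemma Sop_W_braid f :
  Sop Wl (Sop (nl^-1)%VF (Sop Wl f)) = Sop nl (Sop Wl (Sop n' f)).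
Proof.
have KW := KB_Wl; have AnV := KABV Anl; have KnV : KBB (nl^-1)%VF by case: AnV.
have KnW := KBM KnV KW; have KWn := KBM KW Kn'.
rewrite (Sop_Mr _ An' KW) (Sop_Ml _ Anl KWn) (Sop_Ml _ AnV KW) -groupE.
apply: Sop_mul => //.
have -> : Sop (Wl \o (nl^-1 \o Wl))%VF phiA 0 = sS (tau1b i c) * qC^-1.
  rewrite groupE (Sop_phi0 (KBM Knl KWn)) (p_SpM Knl KWn) (p_SpM KW Kn') p_Wl pnl pn'.
  have P1 := Pb_tv i c^-1; have P2 := Pb_tv i (c^-1 ^+ 2 * c).
  have S2 := SpM SpW P2.1.
  rewrite (sSMl P1 S2) (sSMr P2 SpW) (jMl _ P1) (jMr _ P2) !sS_tv mul1r mulr1.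
  by rewrite jf_tau1.
have snV : sS (p_Sp pr (nl^-1)%VF) = 1.
  by rewrite (p_SpV Knl) pnl tvV sS_tv.
have F1 x : fb (Sop (nl^-1 \o Wl)%VF phiA) x = fb (Sop Wl phiA) (tv bform (eps i) c^-1 x).
  have [Bx <-] := lift_bP x; set y := lift_b _ _ in Bx *.
  rewrite -(fbE _ Bx) -(Sop_Ml _ AnV KW) (Sop_KA _ _ AnV) snV mul1r.
  have -> : ((nl^-1)^-1)%VF y = nl y.
    by apply: (can_inj (SpK (SpV Sn))); rewrite (SpVK (SpV Sn)) (SpK Sn).
  by rewrite -pnl (p_SpE Knl Bx) -fbE //; apply/(KB_Bs _ Knl).
rewrite (SopE _ _ KW) p_Wl; congr (_ * _); rewrite (Mb _ KW Bs_0) p_Wl pr0.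
transitivity (sS (tau1b i c) * qC^-1 *
  (qC ^- l * \sum_(d : T) psibar psi (2^-1 * c * (d i) ^+ 2))).
  rewrite mulrCA; congr (_ * _); rewrite mulr_sumr; apply: eq_bigr => d _.
  rewrite sf0r mulr0 psibar0 mul1r addr0 F1 tau1V_epsv.
  have -> : tv bform (eps i) c^-1 (epsv d - d i *: eps i - (c * d i) *: phi i) =
      epsv d + (- (c * d i)) *: phi i.
    rewrite tvE !sfE (X_iso (epsv_X d) (eps_X i)) sf_alt (sfC bform (phi i)) bas_ep eqxx.
    rewrite mulr1n mulr0 subr0 sub0r mulrN1 opprK mulKf // scaleNr.
    by rewrite addrAC subrK.
  rewrite fb_X ?epsv_X // Wphi [LHS]mulrC; congr (_ * psibar psi _).
  by rewrite !sfE (sfC bform (phi i)) epsv_phi; ring.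
rewrite (avg_coord (fun t => psibar psi (2^-1 * c * t ^+ 2))) -/(gauss (psibar psi) c).
rewrite [qC^-1 * gs c]mulrC mulrA [X in X * _]mulrAC gs_tau1 //.
by rewrite divff ?mul1r // qC_neq0.
Qed.

Lemma Good_Wl : Good Wl.
Proof.
have KW := KB_Wl; have AnV := KABV Anl; have KnV : KBB (nl^-1)%VF by case: AnV.
have Gn : Good nl by apply: Good_tv pnl.
have Gn' : Good n' by apply: Good_tv pn'.
have GnV : Good (nl^-1)%VF.
  by apply: (@Good_tv _ i (- c^-1)) => //; rewrite (p_SpV Knl) pnl tvV.
have [[M1 d1] [M2 d2] [M3 d3]] := And3 Gn Gn' GnV.
split.
  have [Y WY] := Mp_ex KW; have [s s0 Ws] := Sop_Mp KW WY.
  have [Y' [WY' YY' Y'Y]] := Mp_inv MpP WY.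
  (* The lift [Y] of [Wl] is arbitrary: both [Y] and its inverse occur, so the scalar relating [Y]
     to [Sop Wl] drops out. *)
  have MU := Mp_mul MpP M1 (Mp_mul MpP WY (Mp_mul MpP M2 (Mp_mul MpP WY' M1))).
  have eW : (nl \o (Wl \o (n' \o (Wl^-1 \o nl))))%VF = Wl.
    have gen (a w : 'End(W)) : Sp beta a -> Sp beta w ->
        (w \o (a^-1 \o w) \o (w^-1 \o a))%VF = w.
      by move=> Sa Sw; apply/lfunP => x; rewrite !comp_lfunE (SpVK Sw) (SpK Sa).
    by rewrite -[RHS](gen _ _ Sn SW) groupE !comp_lfunA.
  rewrite eW in MU; suff <- : Sop nl \o (Y \o (Sop n' \o (Y' \o Sop nl))) = Sop Wl by [].
  apply/funext => f.
  have [f' ->] : exists f', f = Sop (nl^-1)%VF (Y f').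
    exists (Y' (Sop nl f)); rewrite YY' (Sop_Ml _ AnV Knl) (Sp_Vcomp Sn) Sop1 //.
  have e1 : Sop nl (Sop (nl^-1)%VF (Y f')) = Y f'.
    by rewrite (Sop_Ml _ Anl KnV) (Sp_compV Sn) Sop1.
  rewrite /= e1 Y'Y.
  have := Sop_W_braid f'; rewrite (Ws f') (Ws (Sop n' f')) !SopZ //.
  by move/(scalerI s0).
(* In determinants [Wl] occurs twice on the left of the relation and once on the right, while the
   [pc]-th powers of the other factors are 1. *)
have KnW := KBM KnV KW; have KWn := KBM KW Kn'.
have : Tmx Wl *m Tmx (nl^-1 \o Wl)%VF = 1 *: Tmx (nl \o (Wl \o n'))%VF.
  apply: Tmx_mul => // f; rewrite -(Sop_Ml _ AnV KW) Sop_W_braid.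
  by rewrite (Sop_Mr _ An' KW) (Sop_Ml _ Anl KWn) scale1r.
rewrite scale1r => /(congr1 determinant); rewrite det_mulmx (det_Ml AnV KW).
rewrite (det_Ml Anl KWn) (det_Mr An' KW) => /(congr1 (fun x => x ^+ pc)).
rewrite !exprMn d1 d2 d3 !mul1r mulr1 => e.
have dW : \det (Tmx Wl) ^+ pc != 0 by rewrite expf_neq0 // det_Tmx_neq0.
by apply: (mulIf dW); rewrite mul1r.
Qed.

End LongElement.

Lemma Good_mul g h : KBB g -> KBB h -> Good g -> Good h ->
  (forall f, Sop g (Sop h f) = Sop (g \o h)%VF f) -> Good (g \o h)%VF.
Proof.
move=> Kg Kh [Mg dg] [Mh dh] E; split.
  have -> : Sop (g \o h)%VF = Sop g \o Sop h by apply/funext => f /=; rewrite E.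
  exact: (Mp_mul MpP).
have : Tmx g *m Tmx h = 1 *: Tmx (g \o h)%VF.
  by apply: Tmx_mul => // f; rewrite E scale1r.
by rewrite scale1r => <-; rewrite det_mulmx exprMn dg dh mulr1.
Qed.

Lemma lift_T_op u v : u \in X -> bform u v = 0 ->
  exists2 g, KAB g & p_Sp pr g = Tb u v.
Proof.
move=> uX uv; have [Bu pu] := lift_bP u; have [Bv pv] := lift_bP v.
move: (lift_b pr u) (lift_b pr v) Bu pu Bv pv => u0 v0 Bu pu Bv pv.
have O1 := ringO1 K; have N1 := ringON O1; have Buv := Bs_D Bu Bv.
have K1 := KB_tvb Buv O1; have K2 := KB_tvb Bu N1; have K3 := KB_tvb Bv N1.
have pg : p_Sp pr (tvb (u0 + v0) 1 \o (tvb u0 (-1) \o tvb v0 (-1)))%VF = Tb u v.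
  rewrite (p_SpM K1 (KBM K2 K3)) (p_SpM K2 K3) !p_Sp_tvb //.
  by rewrite (qs_D pr Bu Bv) pu pv resN // lf_res1 T_op_tv.
exists (tvb (u0 + v0) 1 \o (tvb u0 (-1) \o tvb v0 (-1)))%VF => //.
apply: KAB_I; first by apply: KBM => //; apply: KBM.
rewrite pg; apply: (Pst_T bas_b bas_ee bas_pp bas_ep) => //.
by rewrite bas_X.
Qed.

(** A diagonal element is not unipotent, so its determinant comes from writing it as a quotient of
    two long elements, with parameters [a^-1] and 1. *)
Lemma lift_hd i a : a != 0 -> exists g,
  [/\ KAB g, p_Sp pr g = hdb i a & \det (Tmx g) ^+ pc = 1].
Proof.
move=> a0; have a'0 : a^-1 != 0 by rewrite invr_eq0.
have o0 : (1 : F) != 0 by apply: oner_neq0.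
pose w := Wl i 1; pose w' := Wl i a^-1.
have Kw : KBB w by apply: KB_Wl.
have Kw' : KBB w' by apply: KB_Wl.
have Sw := KB_Sp Kw; have KwV := KBV Kw.
have pg : p_Sp pr (w' \o w^-1)%VF = hdb i a.
  rewrite (p_SpM Kw' KwV) (p_SpV Kw) !p_Wl // tau1_hd // invrK.
  rewrite /tauS /= comp_lfun1r -comp_lfunA (Sp_compV (Sp_tau1 _ _ _ _ _)) comp_lfun1r //.
have Kg : KAB (w' \o w^-1)%VF.
  by apply: KAB_I; [apply: KBM|rewrite pg; apply: Pb_hd].
exists (w' \o w^-1)%VF; split=> //.
have [_ dw] := Good_Wl i o0; have [_ dw'] := Good_Wl i a'0.
have := det_Ml Kg Kw; rewrite -comp_lfunA (Sp_Vcomp Sw) comp_lfun1r.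
by move=> /(congr1 (fun x => x ^+ pc)); rewrite exprMn dw dw' mulr1 => <-.
Qed.

Lemma det_KAB g : KAB g -> \det (Tmx g) ^+ pc = 1.
Proof.
move=> Kg0; pose G (h : 'End(b)) := forall g, KAB g -> p_Sp pr g = h -> \det (Tmx g) ^+ pc = 1.
suff : G (p_Sp pr g) by apply.
have step t h (p : 'End(b)) : KAB t -> \det (Tmx t) ^+ pc = 1 -> p_Sp pr t = h ->
    G p -> G (h \o p)%VF.
  move=> Kt dt pt Gp g1 Kg1 pg1; have [K1 _] := Kg1; have [Kt1 _] := Kt.
  have KtV := KABV Kt; have [KtV1 _] := KtV; have St := KB_Sp Kt1.
  have -> : g1 = (t \o (t^-1 \o g1))%VF.
    by rewrite comp_lfunA (Sp_compV St) comp_lfun1l.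
  rewrite (det_Ml Kt (KBM KtV1 K1)) exprMn dt mul1r; apply: Gp; first exact: KABM.
  rewrite (p_SpM KtV1 K1) pg1 (p_SpV Kt1) pt comp_lfunA.
  by rewrite -pt (Sp_Vcomp (Sp_p_Sp Kt1)) comp_lfun1l.
apply: (P_gen F2b bas_b bas_ee bas_pp bas_ep (G := G)); last exact: KAB_Pb.
- move=> g1 [K1 _] p1; rewrite (Tmx_p_Sp K1 KB1) ?p_Sp1 //.
  by rewrite Tmx1 det1 expr1n.
- move=> u v p uX uv Gp; rewrite bas_X in uX.
  have [t Kt pt] := lift_T_op uX uv.
  by apply: (step t) => //; apply: (det_T_op Kt uv pt).
- by move=> i c p c0 Gp; have [t [Kt pt dt]] := lift_hd i c0; apply: (step t).
Qed.

Lemma Good_P g : KAB g -> Good g.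
Proof. by move=> Kg; apply: Good_KAB => //; apply: det_KAB. Qed.

(** The image of [g] acts trivially on the [i]-th hyperbolic pair, so in that direction [Sop g phiA]
    keeps the support of [phiA]. *)
Lemma fb_tauS_out g s i y : KBB g -> uniq s -> p_Sp pr g = tauSb s ->
  i \notin s -> bform (eps i) y != 0 -> fb (Sop g phiA) y = 0.
Proof.
move=> Kg us pg is_ yi; have [By py] := lift_bP y; have S := Sp_tauS bform eps phi s.
rewrite /fb (SopE _ _ Kg) (Mb _ Kg By) py pg big1 ?mulr0 // => d _.
rewrite fb_phiA (_ : (_ \in X) = false) ?mulr0 //; apply/negP => /memX/(_ i)/eqP.
have [ti _] := tauSE bas_ee bas_pp bas_ep us i; rewrite (negPf is_) in ti.
by rewrite -S (SpVK S) ti sfDr (X_iso (eps_X i) (epsv_X d)) add0r (negPf yi).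
Qed.

(** Long elements for distinct pairs multiply without a Gauss sum: [fb_tauS_out] leaves only the
    terms with [d i = 0], a proportion [qC^-1], and this matches the exponents in [sS_tauS] and
    [jf_tauS]. *)
Lemma lift_tauS s : uniq s -> exists g, [/\ KBB g, p_Sp pr g = tauSb s & Good g].
Proof.
elim: s => [_|i s IH /= /andP [is_ us]].
  exists \1%VF; split; [exact: KB1|exact: p_Sp1|].
  by apply: Good_P; apply: KAB1.
have [g [Kg pg Gg]] := IH us; have o0 : (1 : F) != 0 by apply: oner_neq0.
have KW := KB_Wl i 1; have pW := p_Wl i 1.
exists (Wl i 1 \o g)%VF; split; [exact: KBM|by rewrite (p_SpM KW Kg) pW pg|].
apply: Good_mul => //; first exact: Good_Wl.
apply: Sop_mul => //.
have uis : uniq (i :: s) by rewrite /= is_.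
have tW : tau1b i 1 = tauSb [:: i] by rewrite /tauS /= comp_lfun1r.
have -> : Sop (Wl i 1 \o g)%VF phiA 0 = (rqC / om 1) ^+ (size s).+1 * qC ^- (size s).+1.
  rewrite (Sop_phi0 (KBM KW Kg)) (p_SpM KW Kg) pW pg.
  by rewrite -[(_ \o _)%VF]/(tauSb (i :: s)) sS_tauS // jf_tauS.
have F0 : Sop g phiA 0 = (rqC / om 1) ^+ size s * qC ^- size s.
  by rewrite (Sop_phi0 Kg) pg sS_tauS // jf_tauS.
rewrite (SopE _ _ KW) pW (Mb _ KW Bs_0) pW pr0.
transitivity (sS (tau1b i 1) * (Sop g phiA 0 *
    (qC ^- l * \sum_(d : T) (d i == 0)%:R))).
  congr (_ * _); rewrite mulrCA; congr (_ * _); rewrite mulr_sumr.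
  apply: eq_bigr => d _; rewrite sf0r mulr0 psibar0 mul1r addr0 tau1V_epsv //.
  case: eqVneq => [di|di].
    rewrite di mulr0 !scale0r !subr0 mulr1 -[epsv d]addr0 fb_X ?epsv_X //.
    by rewrite sf0l mulr0 psibar0 mul1r -pr0 -fbE //; apply: Bs_0.
  rewrite mulr0; apply: (fb_tauS_out (i := i) Kg us pg is_).
  rewrite !sfE (X_iso (eps_X i) (epsv_X d)) bas_ee bas_ep eqxx !mulr0 subr0 sub0r.
  by rewrite mulr1 mul1r oppr_eq0.
rewrite (avg_coord (fun t => (t == 0)%:R)) (bigD1 0) //= eqxx big1 => [|t /negPf -> //].
rewrite addr0 mulr1 F0 tW sS_tauS // expr1; move: (rqC / om 1) (qC) => x y.
by rewrite [x ^+ _.+1]exprS [y ^+ _.+1]exprSr invfM !mulrA.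
Qed.

Lemma lift_Tgen p : Tgen bform eps p -> exists2 g, KAB g & p_Sp pr g = p.
Proof.
elim=> [|u v p' uX uv _ [g Kg pg]].
  by exists \1%VF; [exact: KAB1|exact: p_Sp1].
rewrite bas_X in uX; have [t Kt pt] := lift_T_op uX uv.
exists (t \o g)%VF; first exact: KABM.
by rewrite p_SpM ?pt ?pg //; [case: Kt|case: Kg].
Qed.

Lemma Good_KB g : KBB g -> Good g.
Proof.
move=> Kg.
have [p1 [s [p2 [T1 us P2 E]]]] := bruhat F2b bas_b bas_ee bas_pp bas_ep (Sp_p_Sp Kg).
have [g1 A1 e1] := lift_Tgen T1; have [g2 [K2 e2 G2]] := lift_tauS us.
have [K1 _] := A1; have K12 := KBM K1 K2; have K12V := KBV K12.
(* Only [p1] and [tau_S] are lifted; the third factor is what remains of [g], and it lies over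
   [p2]. *)
have S12 := KB_Sp K12; pose g3 := ((g1 \o g2)^-1 \o g)%VF.
have K3 : KBB g3 by apply: KBM.
have e3 : p_Sp pr g3 = p2.
  rewrite (p_SpM K12V Kg) (p_SpV K12) (p_SpM K1 K2) e1 e2 E [(p1 \o (_ \o _))%VF]comp_lfunA.
  by rewrite comp_lfunA -e1 -e2 -(p_SpM K1 K2) (Sp_Vcomp (Sp_p_Sp K12)) comp_lfun1l.
have A3 : KAB g3 by apply: KAB_I => //; rewrite e3.
have -> : g = (g1 \o (g2 \o g3))%VF.
  by rewrite /g3 !comp_lfunA (Sp_compV S12) comp_lfun1l.
have K23 := KBM K2 K3.
apply: Good_mul => //; [exact: Good_P| |by move=> f; rewrite Sop_Ml].
by apply: Good_mul => //; [exact: Good_P|move=> f; rewrite Sop_Mr].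
Qed.

(** * Parity and the removal of the sign *)

Lemma pc_odd : odd pc.
Proof.
have pp := pcharf_prime pcF; apply/negPn/negP => /(prime_oddPn pp) p2.
by move: pcF; rewrite p2 (negPf odd_res).
Qed.

Lemma NT_odd : odd NT.
Proof.
rewrite card_ffun oddX; apply/orP; right.
have := abelian.fin_ring_pchar_abelem pcF => /abelian.abelem_pgroup/pgroup.card_pgroup.
by rewrite cardsT => ->; rewrite oddX pc_odd orbT.
Qed.

Lemma Sop_KBM g h : KBB g -> KBB h -> Sop (g \o h)%VF = Sop g \o Sop h.
Proof.
move=> Kg Kh; have Kgh := KBM Kg Kh.
have [Mg dg] := Good_KB Kg; have [Mh dh] := Good_KB Kh; have [Mgh dgh] := Good_KB Kgh.
have [//|eN] := Mp_uniq odd_res Asd MpP (Mp_mul MpP Mg Mh) Mgh.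
have : Tmx g *m Tmx h = (-1) *: Tmx (g \o h)%VF.
  by apply: Tmx_mul => // f; rewrite eN /= scaleN1r opprK.
(* A wrong sign would contribute [(-1) ^+ (NT * pc)], which is [-1] since both exponents are odd,
   whereas all determinants have [pc]-th power 1. *)
move=> /(congr1 determinant) /(congr1 (fun x => x ^+ pc)).
rewrite det_mulmx detZ !exprMn dg dh dgh !mulr1 -exprM -signr_odd oddM NT_odd pc_odd.
by move/eqP; rewrite expr1 eq_sym -subr_eq0 -opprD oppr_eq0 -mulr2n pnatr_eq0.
Qed.

Lemma s_B_homomorphism :
  [/\ (forall g f, KBB g -> inH psi beta A f -> inH psi beta A (S_op A pr l theta g f)),
      (forall g, KBB g -> Mp (s_B A pr l theta g))
    & (forall g h, KBB g -> KBB h -> s_B A pr l theta (g \o h)%VF =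
         pair_mul (s_B A pr l theta g) (s_B A pr l theta h))].
Proof.
have sE g : s_B A pr l theta g = (g, Sop g).
  by congr pair; apply/funext => f; rewrite Sop_def.
split=> [g f Kg Hf|g Kg|g h Kg Kh].
- have fP : f \in Hpred psi beta A by rewrite inE.
  by have := S_op_mem (MkHilb fP) Kg; rewrite inE.
- by rewrite sE; case: (Good_KB Kg).
- by rewrite !sE /pair_mul /= Sop_KBM.
Qed.

End QuotientSpace.

Theorem mainTheorem5
  (R : realType)
  (k : fieldType) (F : finFieldType) (K : local_field k F)
  (res_char_odd : 2%N \notin [pchar F])
  (psi : add_char R K)
  (W : vectType k) (beta : symp_form W)
  (r : nat) (r_gt0 : (0 < r)%N) (dimW : \dim {:W} = (2 * r)%N)
  (B : lattice K W) (B_good : good_lattice psi beta B)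
  (A : lattice K W) (A_self_dual : self_dual psi beta A)
  (BA : (B : set W) `<=` A) (AB : (A : set W) `<=` dual_lat psi beta B)
  (b : vectType F) (pr : quot_space K (dual_lat psi beta B) B b)
  (l : nat) (dimb : \dim {:b} = (2 * l)%N)
  (eps phi : 'I_l -> b) (basis_b : is_symp_basis A pr eps phi)
  (theta : 'End(b) -> sq_class F) (thetaP : is_theta A pr eps phi theta)
  (Mp : set (pair_type psi beta A)) (MpP : is_metaplectic Mp) :
  [/\ (forall g f, KB beta B g -> inH psi beta A f ->
         inH psi beta A (S_op A pr l theta g f)),
      (forall g, KB beta B g -> Mp (s_B A pr l theta g))
    & (forall g h, KB beta B g -> KB beta B h ->
         s_B A pr l theta (g \o h)%VF =
         pair_mul (s_B A pr l theta g) (s_B A pr l theta h))].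
Proof.
have [p _ pF] := finfield.finPcharP F.
exact: (s_B_homomorphism res_char_odd B_good A_self_dual BA AB basis_b thetaP MpP pF).
Qed.
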